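(* Let $u>0$, $\rho\ge0$, $\lambda>0$, let $\{X_i\}_{i\ge1}$ be iid random variables with finite mean $\mu>0$, and let $$R^{\alpha_1,\alpha_2}(t)=u+\mu(1+\rho)\lambda Y_{\alpha_1,\alpha_2}(t)-\sum_{i=1}^{N^{\alpha_1,\alpha_2}(t)}X_i,\quad t\ge0,$$ be the mixed fractional risk process. Then $\{R^{\alpha_1,\alpha_2}(t)\}_{t\ge0}$ exhibits the long-range dependence (LRD) property.
   Context: Fix $0<\alpha_2<\alpha_1<1$ and $C_1,C_2\ge0$ with $C_1+C_2=1$. The mixed stable subordinator $\{D_{\alpha_1,\alpha_2}(t)\}_{t\ge0}$ is the subordinator (non-decreasing L\'evy process) with $\mathbb{E}(e^{-sD_{\alpha_1,\alpha_2}(t)})=e^{-t(C_1s^{\alpha_1}+C_2s^{\alpha_2})}$, $s\ge0$. Its inverse is $Y_{\alpha_1,\alpha_2}(t)=\inf\{s\ge0:D_{\alpha_1,\alpha_2}(s)>t\}$. The mixed fractional Poisson process (MFPP) is $N^{\alpha_1,\alpha_2}(t)=N(Y_{\alpha_1,\alpha_2}(t))$, where $\{N(t)\}_{t\ge0}$ is a homogeneous Poisson process with intensity $\lambda$ independent of $\{Y_{\alpha_1,\alpha_2}(t)\}_{t\ge0}$. The MFPP is assumed to be independent of the sequence $\{X_i\}_{i\ge1}$. LRD/SRD: Let $s>0$ be fixed and $t>s$. If the correlation function of a stochastic process $\{X(t)\}_{t\ge0}$ satisfies $\operatorname{Corr}(X(s),X(t))\sim d(s)t^{-\nu}$ as $t\to\infty$,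 where the constant $d(s)$ is independent of $t$, then $\{X(t)\}_{t\ge0}$ is said to exhibit the LRD property if $\nu\in(0,1)$ and the short-range dependence (SRD) property if $\nu\in(1,2)$.
   Formalization: The claims X_i are assumed to have finite second moment, since otherwise the correlation of the risk process is undefined; independence of the MFPP from {X_i} is read as independence of the pair (Y, N(Y)) from {X_i}. *)

(* Defs.v *)
(* Stochastic processes are families R -> T -> R (or R -> T -> nat) of which
   only the members with index t >= 0 are constrained. *)
From HB Require Import structures.
From mathcomp Require Import all_boot all_order all_algebra.
From mathcomp Require Import all_classical all_reals all_analysis.

Set Implicit Arguments.
Unset Strict Implicit.
Unset Printing Implicit Defensive.

Import Order.TTheory GRing.Theory Num.Theory.
Import numFieldNormedType.Exports.

Local Open Scope classical_set_scope.
Local Open Scope ring_scope.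

Section independence.
Context (d : measure_display) (T : measurableType d) (R : realType)
        (P : probability T R).

(* The product rule over an arbitrary finite subfamily is the case where
   [B i] is [setT] for the other indices. *)
Definition mutually_independent (X : nat -> T -> R) : Prop :=
  forall (n : nat) (B : nat -> set R), (forall i, measurable (B i)) ->
    P (\bigcap_(i < n) (X i @^-1` B i)) =
    (\prod_(i < n) P (X i @^-1` B i))%E.

Definition same_law (X Y : T -> R) : Prop :=
  forall B : set R, measurable B -> P (X @^-1` B) = P (Y @^-1` B).

Definition events (I : Type) (J : set I) (X : I -> T -> R) : set (set T) :=
  \bigcup_(i in J) preimage_set_system setT (X i) measurable.

(* independence of the sigma-algebras generated by G and H *)
Definition independent_systems (G H : set (set T)) : Prop :=
  forall A B : set T, <<s G >> A -> <<s H >> B ->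
    P (A `&` B) = (P A * P B)%E.

End independence.

Section processes.
Context (d : measure_display) (T : measurableType d) (R : realType)
        (P : probability T R).

Definition cadlag (f : R -> R) : Prop :=
  (forall t : R, 0 <= t -> f x @[x --> t^'+] --> f t) /\
  (forall t : R, 0 < t -> cvg (f x @[x --> t^'-])).

(* Stochastic continuity follows from stationarity of the increments and
   right-continuity of the paths. Finitely many increments are obtained from
   sequences t that are eventually constant. *)
Definition levy_process (X : R -> T -> R) : Prop :=
  [/\ {ae P, forall w, X 0 w = 0},
      (forall t : nat -> R, 0 <= t 0%N -> nondecreasing_seq t ->
         mutually_independent P (fun i w => X (t i.+1) w - X (t i) w)),
      (forall s t : R, 0 <= s -> s <= t ->
         same_law P (fun w => X t w - X s w) (X (t - s))) &
      (forall w, cadlag (X ^~ w))].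

Definition subordinator (D : R -> {RV P >-> R}) : Prop :=
  levy_process D /\
  {ae P, forall w, forall s t : R, 0 <= s -> s <= t -> D s w <= D t w}.

Definition mixed_stable_subordinator (a1 a2 C1 C2 : R)
    (D : R -> {RV P >-> R}) : Prop :=
  subordinator D /\
  forall t s : R, 0 <= t -> 0 <= s ->
    ('E_P[(fun w => expR (- (s * D t w)))] =
     (expR (- (t * (C1 * s `^ a1 + C2 * s `^ a2))))%:E)%E.

(* The set is almost surely nonempty when D is unbounded; on the exceptional
   event [inf] is 0. *)
Definition inverse_process (D : R -> T -> R) (t : R) (w : T) : R :=
  inf [set s | 0 <= s /\ t < D s w].

(* [poisson_pmf] is the Poisson law only for positive rates, whence 0 < t. *)
Definition poisson_process (lambda : R) (N : R -> {RV P >-> nat}) : Prop :=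
  levy_process (fun t w => (N t w)%:R) /\
  forall (t : R) (k : nat), 0 < t ->
    P [set w | N t w = k] = (poisson_pmf (lambda * t) k)%:E.

Definition time_change (N : R -> T -> nat) (Y : R -> T -> R)
    (t : R) (w : T) : nat := N (Y t w) w.

(* [X i] is the (i+1)-st claim. *)
Definition risk_process (u mu rho lambda : R) (Y : R -> T -> R)
    (M : R -> T -> nat) (X : nat -> T -> R) (t : R) (w : T) : R :=
  u + mu * (1 + rho) * lambda * Y t w - \sum_(i < M t w) X i w.

Definition correlation (X Y : T -> R) : R :=
  fine (covariance P X Y) /
  (Num.sqrt (fine ('V_P[X])) * Num.sqrt (fine ('V_P[Y]))).

(* Square integrability is what makes the correlation function meaningful.
   A limit 1 of the ratio forces c != 0, as division by 0 yields 0. *)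
Definition long_range_dependent (X : R -> T -> R) : Prop :=
  (forall t : R, 0 <= t -> X t \in Lfun P 2%:E) /\
  exists2 nu : R, 0 < nu < 1 &
    forall s : R, 0 < s -> exists c : R,
      correlation (X s) (X t) / (c * t `^ (- nu)) @[t --> +oo] --> (1 : R).

End processes.

(* Main.v *)
Require Import Defs.
From HB Require Import structures.
From mathcomp Require Import all_boot all_order all_algebra.
From mathcomp Require Import all_classical all_reals all_analysis.
From mathcomp Require Import measurable_realfun ring lra.

(** Let D be the subordinator, phi its Laplace exponent, Y its inverse, and
    alpha the smallest index with a positive coefficient in phi, so that
    phi s is equivalent to C s^alpha at 0.

    Given Y, the number of claims N(Y t) is Poisson with mean lambda (Y t), and
    given that number the claims are iid.  Conditioning twice reduces the second
    moments of the risk process R to those of Y: for s <= t,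

      Cov (R s) (R t) = kappa^2 Cov (Y s) (Y t) + theta E[Y s]

    with kappa = mu rho lambda, the safety loading times the mean claim rate,
    and theta = lambda E[X^2] > 0 (risk_covariance).

    The first two moments of Y are read off the random walk n |-> D (n e): the
    number of steps that it spends below t is Y t / e up to an error of one
    (grid_count), so that e times its renewal function approximates E[Y t], and
    a renewal series over ordered pairs of steps, the first below s and the
    second below t, approximates E[Y s Y t] - E[(Y s)^2] / 2
    (pair_renewal_mean).  The Laplace transforms of these series are geometric:
    1 / (1 - exp (- phi s)) and its square.  By a tauberian theorem (tauberian),
    E[Y t] is asymptotic to l1 t^alpha and Var (Y t) to l t^(2 alpha);
    exponential moment bounds for D make l1 and l positive
    (inverse_mean_regular, inverse_variance_regular).

    Independence of the increments of D puts the series over pairs between the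
    products of renewal functions that approximate E[Y s] E[Y (t - s)] and
    E[Y s] E[Y t].  The mean of D being infinite, the increments of the
    renewal function vanish at infinity, as in the renewal theorem of Blackwell
    (renewal_increment_cvg0).  Hence Cov (Y s) (Y t) tends to E[(Y s)^2] / 2
    (inverse_covariance_cvg).

    Thus Cov (R s) (R t) has a positive limit as t tends to infinity, and the
    decay of the correlation is that of the standard deviation of R t: it is of
    order t^(- alpha) if rho > 0, and of order t^(- alpha / 2) if rho = 0.  Both
    exponents lie in ]0, 1[. *)

Set Implicit Arguments.
Unset Strict Implicit.
Unset Printing Implicit Defensive.

Import Order.TTheory GRing.Theory Num.Theory.
Import numFieldNormedType.Exports.

Local Open Scope classical_set_scope.
Local Open Scope ring_scope.

(** * Decoupling of independent sigma-algebras *)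

Section decoupling.
Local Open Scope ereal_scope.
Context d (T : measurableType d) (R : realType) (P : probability T R).

(** The product rule on rectangles identifies the joint law of f and g with a
    product measure, to which Tonelli's theorem applies. *)
Lemma decoupling_maps d1 d2 (T1 : measurableType d1) (T2 : measurableType d2)
    (f : T -> T1) (g : T -> T2) (F : (T1 * T2)%type -> \bar R) :
  measurable_fun setT f -> measurable_fun setT g ->
  (forall A B, measurable A -> measurable B ->
    P (f @^-1` A `&` g @^-1` B) = P (f @^-1` A) * P (g @^-1` B)) ->
  measurable_fun setT F -> (forall x, 0 <= F x) ->
  \int[P]_w F (f w, g w) = \int[P]_v \int[P]_w F (f w, g v).
Proof.
move=> mf mg fg mF F0.
pose f' : {mfun T >-> T1} := mfun_Sub (mem_set mf).
pose g' : {mfun T >-> T2} := mfun_Sub (mem_set mg).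
pose fg' w := (f w, g w).
have mfg : measurable_fun setT fg' by exact: measurable_fun_pair.
pose h' : {mfun T >-> (T1 * T2)%type} := mfun_Sub (mem_set mfg).
pose Pf := distribution P f'; pose Pg := distribution P g'.
pose Ph := distribution P h'.
transitivity (\int[Ph]_z F z).
  by rewrite ge0_integral_distribution.
transitivity (\int[(Pf \x Pg)%E]_z F z).
  apply: eq_measure_integral => A mA _; symmetry.
  by apply: product_measure_unique => // B C mB mC; exact: fg.
rewrite fubini_tonelli2//= ge0_integral_distribution//=.
- apply: eq_integral => v _.
  rewrite /fubini_G ge0_integral_distribution//.
  exact: measurableT_comp.
- exact: measurable_fun_fubini_tonelli_G.
- by move=> v; apply: integral_ge0.
Qed.

Lemma generated_measurable (G : set (set T)) (A : set T) :
  G `<=` measurable -> <<s G >> A -> measurable A.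
Proof.
by move=> mG; move: A; apply: smallest_sub => //; exact: sigma_algebra_measurable.
Qed.

(** Conditioning on a sigma-algebra independent of the rest: if F depends on its
    first argument through G and on the second through H, the H-randomness can
    be frozen at v while the G-randomness is averaged. *)
Lemma decoupling_systems (G H : set (set T))
    (F : (g_sigma_algebraType G * g_sigma_algebraType H)%type -> \bar R) :
  G `<=` measurable -> H `<=` measurable -> independent_systems P G H ->
  measurable_fun setT F -> (forall x, 0 <= F x) ->
  \int[P]_w F (w, w) = \int[P]_v \int[P]_w F (w, v).
Proof.
move=> mG mH GH mF F0.
pose iG (w : T) : g_sigma_algebraType G := w.
pose iH (w : T) : g_sigma_algebraType H := w.
apply: (@decoupling_maps _ _ _ _ iG iH F) => //.
- by move=> _ A mA; rewrite setTI; exact: generated_measurable mA.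
- by move=> _ A mA; rewrite setTI; exact: generated_measurable mA.
Qed.
End decoupling.

(** * A tauberian theorem *)

Section tauberian.
Context {R : realType}.

Lemma near_pinftyP (A : set R) :
  (\forall t \near +oo, A t) <-> exists2 M : R, 0 < M & forall t : R, M <= t -> A t.
Proof.
split => [[M [_ MA]]|[M M0 MA]].
  exists (`|M| + 1) => [|t Mt]; first by rewrite ltr_pwDr.
  by apply: MA; rewrite (le_lt_trans (ler_norm _))// (lt_le_trans _ Mt)// ltrDl.
by exists M; split; [exact: num_real|move=> t /ltW; exact: MA].
Qed.

Lemma geometric_small (q e : R) : 0 <= q < 1 -> 0 < e ->
  exists n, q ^+ n.+1 <= e.
Proof.
move=> /andP[q0 q1] e0.
have : q ^+ n @[n --> \oo] --> 0 by apply: cvg_expr; rewrite ger0_norm.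
move=> /cvgrPdist_le /(_ _ e0)[n _ /(_ n.+1 (leqnSn n))].
by rewrite /= sub0r normrN ger0_norm ?exprn_ge0//; exists n.
Qed.

(** The approximation behind Karamata's proof of the tauberian theorem.  The
    polynomial 1 - (1 - y^n)^N, with N between a^-n and b^-n, is close to the
    step from 0 to 1 that takes place between b and a, by Bernoulli's
    inequality.  The bound e * y, and not only e, is what an infinite measure
    requires, as e^(-x) is integrable against it and constants may not be. *)
Lemma step_polynomial (a b e : R) : 0 < b -> b < a -> a <= 1 -> 0 < e ->
  exists p : {poly R}, p`_0 = 0 /\ forall y : R, 0 <= y <= 1 ->
    [/\ 0 <= p.[y] <= 1, a <= y -> 1 - e <= p.[y] & y <= b -> p.[y] <= e * y].
Proof.
move=> b0 ba a1 e0.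
have [c bc ca] : exists2 c, b < c & c < a by exists ((a + b) / 2); lra.
have c0 : 0 < c by lra.
have a0 : 0 < a by lra.
pose q := Num.max (c / a) (b / c).
have q01 : 0 <= q < 1.
  rewrite /q le_max divr_ge0 ?(ltW a0) ?(ltW c0)//= gt_max.
  by rewrite !ltr_pdivrMr// !mul1r ca bc.
have ca0 : 0 <= c / a by rewrite divr_ge0 ?(ltW c0) ?(ltW a0).
have bc0 : 0 <= b / c by rewrite divr_ge0 ?(ltW c0) ?(ltW b0).
have q0 : 0 <= q by case/andP : q01.
have qa : c / a <= q by rewrite /q le_max lexx.
have qb : b / c <= q by rewrite /q le_max lexx orbT.
have e'0 : 0 < Num.min e (e * b / 2).
  by rewrite lt_min e0 divr_gt0// mulr_gt0.
have [m] := geometric_small q01 e'0.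
rewrite le_min => /andP[qe qeb].
set n := m.+1 in qe qeb.
(* N is about c^-n with b < c < a: N b^n is small and N a^n is large. *)
pose N := (Num.truncn (c ^- n)).+1.
have cn0 : 0 < c ^- n by rewrite invr_gt0 exprn_gt0.
have cN : c ^- n < N%:R by rewrite /N truncnS_gt.
have Nc : N%:R <= 2 * c ^- n.
  have h1 : 1 <= c ^- n by rewrite -exprVn exprn_ege1// invf_ge1//; lra.
  have h2 : (Num.truncn (c ^- n))%:R <= c ^- n by rewrite truncn_le ltW.
  by rewrite /N -natr1; lra.
exists (1 - (1 - 'X^n) ^+ N); split.
  by rewrite -horner_coef0 !hornerE expr0n /= subr0 expr1n subrr.
move=> y /andP[y0 y1]; rewrite !hornerE.
have yn0 : 0 <= y ^+ n by rewrite exprn_ge0.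
have yn1 : y ^+ n <= 1 by rewrite exprn_ile1.
have z0 : 0 <= 1 - y ^+ n by rewrite subr_ge0.
have z1 : 1 - y ^+ n <= 1 by rewrite gerBl.
have bern : forall k (x : R), -1 <= x -> 1 + k%:R * x <= (1 + x) ^+ k.
  move=> k x x1; elim: k => [|k IH]; first by rewrite mul0r addr0 expr0.
  rewrite exprS -natr1.
  have : (1 + x) * (1 + k%:R * x) <= (1 + x) * (1 + x) ^+ k.
    by apply: ler_wpM2l => //; lra.
  apply: le_trans.
  have : 0 <= k%:R * (x * x) by rewrite mulr_ge0// -expr2 sqr_ge0.
  nra.
split.
- by rewrite subr_ge0 exprn_ile1//= gerBl exprn_ge0.
- move=> ay; rewrite lerD2l lerN2.
  have an0 : 0 < a ^+ n by rewrite exprn_gt0.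
  have ayn : a ^+ n <= y ^+ n by rewrite lerXn2r// nnegrE ltW.
  have B1 := bern N (y ^+ n) ltac:(lra).
  have B2 : (1 - y ^+ n) ^+ N * (1 + y ^+ n) ^+ N <= 1.
    rewrite -exprMn exprn_ile1//; nra.
  have w0 : 0 <= (1 - y ^+ n) ^+ N by rewrite exprn_ge0.
  set w := (1 - y ^+ n) ^+ N in B2 w0 *.
  have Na : N%:R * a ^+ n <= N%:R * y ^+ n by rewrite ler_wpM2l.
  have B3 : w * (N%:R * a ^+ n) <= 1.
    apply: le_trans B2; apply: ler_wpM2l => //.
    by apply: le_trans B1; lra.
  have B4 : w * (c ^- n * a ^+ n) <= 1.
    apply: le_trans B3; apply: ler_wpM2l => //.
    by rewrite ler_pM2r// ltW.
  have : w <= (c / a) ^+ n.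
    rewrite expr_div_n ler_pdivlMr// -[leRHS]mul1r -ler_pdivrMr ?exprn_gt0//.
    by rewrite -mulrA [a ^+ n * _]mulrC.
  move=> /le_trans; apply; apply: le_trans qe.
  by rewrite lerXn2r ?nnegrE.
- move=> yb.
  have B1 := bern N (- y ^+ n) ltac:(lra).
  have : 1 - (1 - y ^+ n) ^+ N <= N%:R * y ^+ n.
    by move: B1; rewrite mulrN lerBlDl -lerBlDr.
  move=> /le_trans; apply.
  rewrite {1}/n exprSr mulrA; apply: ler_wpM2r => //.
  have yb' : y ^+ m <= b ^+ m by rewrite lerXn2r// nnegrE ltW.
  apply: (@le_trans _ _ (2 * c ^- n * b ^+ m)).
    by apply: ler_pM => //; rewrite exprn_ge0.
  have -> : 2 * c ^- n * b ^+ m = (b / c) ^+ n * (2 / b).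
    rewrite expr_div_n /n [b ^+ m.+1]exprS; field.
    by rewrite expf_eq0 /= !gt_eqF.
  have : (b / c) ^+ n <= e * b / 2.
    apply: le_trans qeb.
    by rewrite lerXn2r ?nnegrE.
  move=> h; apply: (@le_trans _ _ ((e * b / 2) * (2 / b))).
    by rewrite ler_wpM2r// divr_ge0// ltW.
  by rewrite le_eqVlt; apply/orP; left; apply/eqP; field; rewrite gt_eqF.
Qed.

Variables (m : {measure set R -> \bar R}) (L : R -> R).
Hypothesis mL : forall s : R, 0 < s ->
  (\int[m]_(x in [set x | (0 <= x)%R]) (expR (- (s * x)))%:E = (L s)%:E)%E.

Let D : set R := [set x | (0 <= x)%R].

Let mD : measurable D.
Proof. by rewrite /D -set_itvcy. Qed.

Let mexp s : measurable_fun D (fun x : R => expR (- (s * x))).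
Proof.
apply: measurableT_comp => //; apply: measurableT_comp => //.
Qed.

Let intexp (s : R) : 0 < s -> m.-integrable D (fun x => (expR (- (s * x)))%:E).
Proof.
move=> s0; apply/integrableP; split.
  by apply/measurable_EFinP; exact: mexp.
under eq_integral => x _ do rewrite gee0_abs ?lee_fin ?expR_ge0//.
by rewrite mL// ltry.
Qed.

(** The integral of p(e^(-x/t)), when p has no constant term. *)
Let LT (p : {poly R}) t := \sum_(i < size p) p`_i * L (i%:R / t).

Let int_poly (p : {poly R}) (t : R) : p`_0 = 0 -> 0 < t ->
  m.-integrable D (fun x => (p.[expR (- (x / t))])%:E) /\
  (\int[m]_(x in D) (p.[expR (- (x / t))])%:E = (LT p t)%:E)%E.
Proof.
move=> p0 t0.
have E x : (p.[expR (- (x / t))])%:E =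
    (\sum_(i < size p) (p`_i * expR (- (i%:R / t * x)))%:E)%E.
  rewrite sumEFin horner_coef; congr EFin; apply: eq_bigr => i _.
  by rewrite -expRM_natl; congr (_ * expR _); field; rewrite gt_eqF.
have I (i : 'I_(size p)) :
  m.-integrable D (fun x => (p`_i * expR (- (i%:R / t * x)))%:E) /\
  (\int[m]_(x in D) (p`_i * expR (- (i%:R / t * x)))%:E
    = (p`_i * L (i%:R / t))%:E)%E.
  have [i0|i0] := posnP i.
    have -> : p`_i = 0 by rewrite i0.
    rewrite (mul0r (L _)).
    have -> : (fun x => (0 * expR (- (i%:R / t * x)))%:E) = cst 0%E :> (R -> \bar R).
      by apply/funext => x; rewrite mul0r.
    by split; [exact: integrable0|rewrite integral0].
  have it0 : 0 < i%:R / t by rewrite divr_gt0// ltr0n.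
  split.
    by under eq_fun do rewrite EFinM; apply: integrableZl => //; exact: intexp.
  under eq_integral do rewrite EFinM.
  by rewrite integralZl//; [rewrite mL|exact: intexp].
split.
  under eq_fun do rewrite E.
  by apply: integrable_sum => // i _; case: (I i).
under eq_integral do rewrite E.
rewrite integral_sum//; last by move=> i; case: (I i).
rewrite /LT -sumEFin.
by apply: eq_bigr => i _; case: (I i).
Qed.

Let A (t : R) := fine (m [set x | (0 <= x <= t)%R]).

Let mA t : measurable [set x : R | (0 <= x <= t)%R].
Proof.
rewrite (_ : [set _ | _] = `[0, t]%classic); first exact: measurable_itv.
by apply/seteqP; split => x; rewrite /= in_itv.
Qed.

Let AE t : [set x : R | (0 <= x <= t)%R] = [set x : R | (0 <= x <= t)%R] `&` D.
Proof. by apply/seteqP; split => x /=; [move=> /[dup] ? /andP[]|case]. Qed.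

Let int_indic (c t : R) : 0 <= c ->
  (\int[m]_(x in D) (c * \1_[set x : R | (0 <= x <= t)%R] x)%:E
    = c%:E * m [set x : R | (0 <= x <= t)%R])%E.
Proof.
move=> c0; under eq_integral do rewrite EFinM.
rewrite ge0_integralZl//; first by rewrite integral_indic// -AE.
by apply/measurable_EFinP; exact: measurable_indic.
Qed.

Let mcA (c t : R) : measurable_fun D
  (fun x => (c * \1_[set x : R | (0 <= x <= t)%R] x)%:E).
Proof. by apply/measurable_EFinP; exact: measurable_funM. Qed.

Let A_bound (t : R) : 0 < t ->
  (m [set x | (0 <= x <= t)%R] <= (expR 1 * L (1 / t))%:E)%E.
Proof.
move=> t0.
rewrite -[leLHS]mul1e -int_indic// EFinM -mL ?divr_gt0// -integralZl//; last first.
  by apply: intexp; rewrite divr_gt0.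
apply: ge0_le_integral => //.
- by apply: measurable_funeM; apply/measurable_EFinP; exact: mexp.
- move=> x _; rewrite -EFinM lee_fin [leLHS]mul1r indicE.
  have [|] := boolP (x \in _); last by rewrite mulr0n mulr_ge0// expR_ge0.
  rewrite inE /= => /andP[x0 xt]; rewrite mulr1n -expRD -[leLHS]expR0 ler_expR subr_ge0.
  by rewrite mul1r mulrC ler_pdivrMr// mul1r.
Qed.

Let A_fin (t : R) : 0 < t -> m [set x | (0 <= x <= t)%R] = (A t)%:E.
Proof.
move=> t0; rewrite /A fineK// ge0_fin_numE//.
by apply: le_lt_trans (A_bound t0) _; rewrite ltry.
Qed.

Let A_le (t : R) : 0 < t -> A t <= expR 1 * L (1 / t).
Proof. by move=> t0; rewrite -lee_fin -A_fin//; exact: A_bound. Qed.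

(** The polynomial of step_polynomial with the step between e^(-1-d) and e^(-1),
    evaluated at e^(-x/t), compares with the indicators of [0, t] and of
    [0, (1+d) t]. *)
Let sandwich (d e : R) : 0 < d -> 0 < e -> exists p : {poly R}, p`_0 = 0 /\
  forall t : R, 0 < t -> A t <= LT p t + e * A t /\
    LT p t <= A ((1 + d) * t) + e * L (1 / t).
Proof.
move=> d0 e0.
have d1 : 0 < 1 + d by lra.
have [||||p [p0 pP]] := @step_polynomial (expR (- 1)) (expR (- (1 + d))) e.
- exact: expR_gt0.
- by rewrite ltr_expR; lra.
- by rewrite expR_le1; lra.
- exact: e0.
exists p; split=> // t t0.
have [ip Ep] := int_poly p0 t0.
have y01 x : 0 <= x -> 0 <= expR (- (x / t)) <= 1.
  by move=> x0; rewrite expR_ge0 expR_le1 oppr_le0 divr_ge0// ltW.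
have mp : measurable_fun D (fun x => (p.[expR (- (x / t))])%:E).
  exact: measurable_int ip.
have p_ge0 x : D x -> (0 <= (p.[expR (- (x / t))])%:E)%E.
  by move=> /y01 /pP[/andP[+ _] _ _]; rewrite lee_fin.
have dt0 : 0 < (1 + d) * t by rewrite mulr_gt0.
split.
  rewrite -lee_fin EFinD -Ep EFinM -A_fin// -(int_indic _ (ltW e0)).
  rewrite -[leLHS]mul1e -(int_indic _ ler01) -ge0_integralD//; last first.
    by move=> x _; rewrite lee_fin mulr_ge0// ltW.
  apply: ge0_le_integral => //.
  - exact: emeasurable_funD.
  - move=> x Dx; rewrite -EFinD lee_fin mul1r indicE.
    have [/andP[h0 h1] h2 h3] := pP _ (y01 _ Dx).
    have [|_] := boolP (x \in _); last by rewrite mulr0n mulr0 addr0.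
    rewrite inE /= => /andP[_ xt].
    rewrite mulr1n mulr1 -lerBlDr; apply: h2.
    by rewrite ler_expR lerN2 ler_pdivrMr// mul1r.
have it0 : 0 < 1 / t by rewrite divr_gt0.
rewrite -lee_fin EFinD -Ep EFinM -A_fin// -[X in (_ <= X + _)%E]mul1e.
rewrite -(int_indic _ ler01) -mL// -integralZl//; last exact: intexp.
have mE : measurable_fun D (fun x => e%:E * (expR (- (1 / t * x)))%:E)%E.
  by apply: measurable_funeM; apply/measurable_EFinP; exact: mexp.
rewrite -ge0_integralD//; last first.
  by move=> x _; rewrite -EFinM lee_fin mulr_ge0 ?expR_ge0 ?(ltW e0).
apply: ge0_le_integral => //.
- exact: emeasurable_funD.
- move=> x Dx; rewrite -EFinM -EFinD lee_fin [X in _ <= X + _]mul1r indicE.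
  have [/andP[h0 h1] h2 h3] := pP _ (y01 _ Dx).
  have ee : 0 <= e * expR (- (1 / t * x)) by rewrite mulr_ge0 ?expR_ge0 ?(ltW e0).
  have [_|] := boolP (x \in _); first by rewrite mulr1n (le_trans h1)// lerDl.
  move=> /negP xt; rewrite mulr0n add0r mul1r [t^-1 * x]mulrC; apply: h3.
  rewrite ler_expR lerN2 ler_pdivlMr// leNgt; apply/negP => xt'; apply: xt.
  by rewrite inE /=; apply/andP; split => //; exact: ltW.
Qed.

Let LT_cvg (b : R) (p : {poly R}) : p`_0 = 0 ->
  (forall j : nat, exists K : R, L (j.+1%:R / t) / t `^ b @[t --> +oo] --> K) ->
  exists l : R, LT p t / t `^ b @[t --> +oo] --> l.
Proof.
move=> p0 cK.
have /choice[k kP] (i : 'I_(size p)) :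
    exists l : R, p`_i * (L (i%:R / t) / t `^ b) @[t --> +oo] --> l.
  case: i => -[|i] ip /=.
    by exists 0; under eq_fun do rewrite p0 mul0r; exact: cvg_cst.
  by have [K KP] := cK i; exists (p`_i.+1 * K); exact: cvgZr.
exists (\sum_(i < size p) k i).
have -> : (fun t => LT p t / t `^ b) =
    fun t => \sum_(i < size p) p`_i * (L (i%:R / t) / t `^ b).
  by apply/funext => t; rewrite /LT mulr_suml; apply: eq_bigr => i _; rewrite mulrA.
apply: cvg_big => [|i _]; last exact: kP.
by move=> /= ?; exact: add_continuous.
Qed.

(** A tauberian theorem of Karamata: regular variation of the Laplace transform
    L at 0 passes to the distribution function of the measure.  The convergence
    of L (c / t) / t^b is assumed for positive integers c, since these are the
    values that polynomials in e^(-x/t) involve. *)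
Lemma tauberian (b : R) : 0 < b ->
  (forall j : nat, exists K : R, L (j.+1%:R / t) / t `^ b @[t --> +oo] --> K) ->
  exists l : R, fine (m [set x | (0 <= x <= t)%R]) / t `^ b @[t --> +oo] --> l.
Proof.
move=> b0 cK; apply/cvg_ex; apply/cauchy_cvgP/cauchy_exP => _/posnumP[eta].
have [K1 /cvgrPdist_le /(_ 1 ltr01) /near_pinftyP[M0 M00 M0P]] := cK 0%N.
pose B1 := `|K1| + 1.
have L_B1 t : M0 <= t -> L (1 / t) / t `^ b <= B1.
  move=> /M0P; rewrite ler_distlC => /andP[_] /le_trans; apply.
  by rewrite lerD2r ler_norm.
have B10 : 0 < B1 by rewrite /B1 ltr_pwDr.
pose B := expR 1 * B1.
have B0 : 0 < B by rewrite /B mulr_gt0// expR_gt0.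
have A_B t : M0 <= t -> A t / t `^ b <= B.
  move=> Mt; have t0 : 0 < t by exact: lt_le_trans Mt.
  have tb : 0 < t `^ b by rewrite powR_gt0.
  apply: (@le_trans _ _ (expR 1 * (L (1 / t) / t `^ b))).
    by rewrite mulrA ler_wpM2r ?invr_ge0 ?(ltW tb)// A_le.
  by rewrite ler_wpM2l ?expR_ge0// L_B1.
(* The final estimates differ by at most e * S. *)
pose S := 2 * B + B1 + 3.
have S0 : 0 < S by rewrite /S; lra.
pose e := eta%:num / S.
have e0 : 0 < e by rewrite divr_gt0.
(* Dilating t by 1 + d multiplies t^b by 1 + e. *)
pose d := (1 + e) `^ b^-1 - 1.
have db : (1 + d) `^ b = 1 + e.
  rewrite /d addrC subrK -powRrM mulVf ?gt_eqF// powRr1//; lra.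
have d0 : 0 < d.
  rewrite subr_gt0 /powR gt_eqF ?addr_gt0// expR_gt1 mulr_gt0 ?invr_gt0//.
  by rewrite ln_gt0// ltrDl.
have [p [p0 pP]] := sandwich d0 e0.
have [l /cvgrPdist_le /(_ _ e0) /near_pinftyP[M1 M10 M1P]] := LT_cvg p0 cK.
pose M := Num.max M0 M1.
have M_gt0 : 0 < M by rewrite lt_max M00.
have up t : M <= t -> A t / t `^ b <= l + e + e * B.
  rewrite ge_max => /andP[Mt0 Mt1].
  have t0 : 0 < t by exact: lt_le_trans Mt0.
  have tb : 0 < (t `^ b)^-1 by rewrite invr_gt0 powR_gt0.
  have [h _] := pP t t0.
  have := M1P t Mt1; rewrite ler_distlC => /andP[_ h1].
  have h2 : A t / t `^ b <= LT p t / t `^ b + e * (A t / t `^ b).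
    by rewrite mulrA -mulrDl ler_wpM2r// ltW.
  have h3 : e * (A t / t `^ b) <= e * B by rewrite ler_pM2l// A_B.
  lra.
have lo t : (1 + d) * M <= t -> l - e - e * B1 <= (1 + e) * (A t / t `^ b).
  move=> dMt; pose s := t / (1 + d).
  have d1 : 0 < 1 + d by lra.
  have sE : (1 + d) * s = t by rewrite /s mulrC divfK// gt_eqF.
  have Ms : M <= s by rewrite /s ler_pdivlMr// mulrC.
  have s0 : 0 < s by exact: lt_le_trans Ms.
  have sb : 0 < (s `^ b)^-1 by rewrite invr_gt0 powR_gt0.
  move: (Ms); rewrite ge_max => /andP[Ms0 Ms1].
  have [_ h] := pP s s0.
  have := M1P s Ms1; rewrite ler_distlC => /andP[h1 _].
  have h2 : LT p s / s `^ b <= A t / s `^ b + e * (L (1 / s) / s `^ b).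
    by rewrite mulrA -mulrDl ler_wpM2r ?(ltW sb)// -sE.
  have h3 : e * (L (1 / s) / s `^ b) <= e * B1 by rewrite ler_pM2l// L_B1.
  have -> : (1 + e) * (A t / t `^ b) = A t / s `^ b.
    rewrite -sE powRM ?(ltW d1) ?(ltW s0)// db; field.
    by rewrite !gt_eqF ?powR_gt0//; lra.
  lra.
have MdM : M <= (1 + d) * M by rewrite ler_peMl ?(ltW M_gt0)//; lra.
pose x0 := (1 + d) * M.
exists (A x0 / x0 `^ b); apply/near_pinftyP; exists x0.
  by rewrite mulr_gt0//; lra.
move=> t xt; rewrite /ball /= /ball_.
have key x y : x0 <= x -> x0 <= y ->
    A x / x `^ b - A y / y `^ b < eta%:num.
  move=> hx hy.
  have u := up x (le_trans MdM hx); have v := lo y hy.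
  have w : e * (A y / y `^ b) <= e * B.
    rewrite ler_pM2l//; apply: A_B; apply: le_trans hy; apply: le_trans MdM.
    by rewrite le_max lexx.
  have eS : e * S = eta%:num by rewrite /e divfK// gt_eqF.
  rewrite -eS /S; nra.
by rewrite ltr_norml ltrNl opprB !key.
Qed.

End tauberian.

(** * Bounds for a subordinator with given Laplace exponent *)

Section almost_sure.
Context d (T : measurableType d) (R : realType) (P : probability T R).

Lemma ae_le_prob (A B : set T) : measurable A -> measurable B ->
  {ae P, forall w, A w -> B w} -> (P A <= P B)%E.
Proof.
move=> mA mB [N [mN PN NAB]].
apply: (@le_trans _ _ (P (B `|` N))).
  apply: le_measure; rewrite ?inE//; first exact: measurableU.
  move=> w Aw; have [Bw|Bw] := pselect (B w); first by left.
  by right; apply: NAB => /= /(_ Aw).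
rewrite (le_trans (measureU2 _ _ _))//.
by rewrite [X in (_ + X)%E]PN adde0.
Qed.

Lemma ae_eq_prob (A B : set T) : measurable A -> measurable B ->
  {ae P, forall w, A w <-> B w} -> P A = P B.
Proof.
move=> mA mB AB; apply/eqP; rewrite eq_le; apply/andP; split;
  by apply: ae_le_prob => //; apply: filterS AB => w [].
Qed.

Lemma prob_fine (A : set T) : measurable A -> P A = (fine (P A))%:E.
Proof. by move=> mA; rewrite fineK// fin_num_measure. Qed.

End almost_sure.

Section subordinator_bounds.
Context d (T : measurableType d) (R : realType) (P : probability T R).
Variables (D : R -> {RV P >-> R}) (phi : R -> R).
Hypothesis Dsub : subordinator D.
Hypothesis Dlap : forall t s : R, 0 <= t -> 0 <= s ->
  ('E_P[(fun w => expR (- (s * D t w)))] = (expR (- (t * phi s)))%:E)%E.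

Lemma subordinator_zero : {ae P, forall w, D 0 w = 0}.
Proof. by case: Dsub => -[]. Qed.

Lemma subordinator_mono : {ae P, forall w, forall s t : R, 0 <= s -> s <= t -> D s w <= D t w}.
Proof. by case: Dsub. Qed.

Lemma subordinator_ge0 : {ae P, forall w, forall t : R, 0 <= t -> 0 <= D t w}.
Proof.
have := subordinator_zero; apply: filterS2 subordinator_mono => w mono D0 t t0.
by rewrite -D0; exact: mono.
Qed.

Lemma measurable_subordinator_le (x t : R) : measurable [set w | (D x w <= t)%R].
Proof.
have := measurable_funPTI (D x) (measurable_itv `]-oo, t]).
by congr measurable; apply/seteqP; split => w /=; rewrite in_itv.
Qed.

Lemma measurable_subordinator_exp (x s : R) :
  measurable_fun setT (fun w => (expR (- (s * D x w)))%:E).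
Proof.
apply/measurable_EFinP; apply: measurableT_comp => //.
by apply: measurableT_comp => //; exact: measurable_funM.
Qed.

(** The independence of two consecutive increments, the first of which starts
    from D 0 = 0 almost surely. *)
Lemma subordinator_independent (a b : R) (A B : set R) : 0 <= a -> a <= b ->
  measurable A -> measurable B ->
  P ((D a @^-1` A) `&` ((fun w => D b w - D a w) @^-1` B)) =
  (P (D a @^-1` A) * P (D (b - a) @^-1` B))%E.
Proof.
move=> a0 ab mA mB.
have [[_ ind sta _] _] := Dsub.
pose t n : R := match n with 0 => 0 | 1 => a | _ => b end.
have t0 : 0 <= t 0%N by [].
have tn : nondecreasing_seq t.
  by apply/nondecreasing_seqP => -[|[|n]] /=.
pose C (n : nat) := if n == 0%N then A else B.
have mC i : measurable (C i) by rewrite /C; case: ifP.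
have := ind t t0 tn 2%N C mC.
have mba : measurable_fun setT (fun w => D b w - D a w) by exact: measurable_funB.
have ma0 : measurable_fun setT (fun w => D a w - D 0 w) by exact: measurable_funB.
have mD0 : measurable ((fun w => D a w - D 0 w) @^-1` A).
  by rewrite -[X in measurable X]setTI; exact: ma0.
have mDa : measurable (D a @^-1` A).
  by rewrite -[X in measurable X]setTI; exact: measurable_funP.
have mDba : measurable ((fun w => D b w - D a w) @^-1` B).
  by rewrite -[X in measurable X]setTI; exact: mba.
rewrite (_ : \bigcap_(i < 2) _ = ((fun w => D a w - D 0 w) @^-1` A) `&`
    ((fun w => D b w - D a w) @^-1` B)); last first.
  rewrite bigcap_mkord !big_ord_recr big_ord0 /= setTI //.
rewrite !big_ord_recr big_ord0 /= mul1e => H.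
transitivity (P ((fun w => D a w - D 0 w) @^-1` A `&`
    (fun w => D b w - D a w) @^-1` B)).
  apply: ae_eq_prob; try exact: measurableI.
  by apply: filterS subordinator_zero => w /= ->; rewrite subr0.
rewrite [LHS]H; congr (_ * _)%E.
- apply: ae_eq_prob => //.
  by apply: filterS subordinator_zero => w /= ->; rewrite subr0.
- exact: sta.
Qed.

(** Markov's inequality for exp (- (r / t) D x). *)
Lemma subordinator_le_bound (x t r : R) : 0 <= x -> 0 < t -> 0 <= r ->
  (P [set w | (D x w <= t)%R] <= (expR r * expR (- (x * phi (r / t))))%:E)%E.
Proof.
move=> x0 t0 r0.
have mS := measurable_subordinator_le x t.
have rt : 0 <= r / t by rewrite divr_ge0// ltW.
have mE := measurable_subordinator_exp x (r / t).
rewrite EFinM -Dlap// unlock -ge0_integralZl//.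
rewrite -[X in P X]setIT -integral_indic//.
apply: ge0_le_integral => //.
- by apply/measurable_EFinP; exact: measurable_indic.
- exact: measurable_funeM.
- move=> w _; rewrite -EFinM lee_fin indicE.
  have [|] := boolP (w \in _); last by rewrite mulr_ge0 ?expR_ge0.
  rewrite inE /= => Dt; rewrite -expRD -[leLHS]expR0 ler_expR subr_ge0.
  by rewrite mulrAC ler_pdivrMr// ler_wpM2l.
Qed.

(** Split E[exp (- D x / t)] >= 3/4 according to whether D x <= t: on the other
    event the variable is at most 1 / e <= 1/2. *)
Lemma subordinator_le_half (x t : R) : 0 <= x -> 0 < t -> x * phi (1 / t) <= 4^-1 ->
  ((2^-1)%:E <= P [set w | (D x w <= t)%R])%E.
Proof.
move=> x0 t0 xphi.
have mS := measurable_subordinator_le x t.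
have t1 : 0 <= 1 / t by rewrite divr_ge0// ltW.
have mI : measurable_fun setT (fun w => (\1_[set w | (D x w <= t)%R] w)%:E : \bar R).
  by apply/measurable_EFinP; exact: measurable_indic.
have : ((expR (- (x * phi (1 / t))))%:E <= 2^-1%:E + 2^-1%:E * P [set w | (D x w <= t)%R])%E.
  rewrite -Dlap// unlock -[[set w | _]]setIT -(integral_indic P)//.
  rewrite -ge0_integralZl//.
  rewrite -[X in (_ <= X + _)%E]mule1 -(probability_setT P) -integral_cst//.
  rewrite -ge0_integralD//; last 2 first.
  - by move=> w _; rewrite /= lee_fin invr_ge0.
  - exact: measurable_funeM.
  apply: ae_ge0_le_integral => //.
  - exact: measurable_subordinator_exp.
  - by move=> w _; rewrite -EFinM -EFinD lee_fin addr_ge0.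
  - by apply: emeasurable_funD => //; exact: measurable_funeM.
  - apply: filterS subordinator_ge0 => w /(_ _ x0) Dx _.
    rewrite -EFinM -EFinD lee_fin indicE.
    have Dt0 : 0 <= 1 / t * D x w by exact: mulr_ge0.
    have [_|] := boolP (w \in _).
      rewrite mulr1n mulr1.
      have : expR (- (1 / t * D x w)) <= 1 by rewrite expR_le1; lra.
      lra.
    rewrite mulr0n mulr0 addr0 => /negP; rewrite inE /= => /negP; rewrite -ltNge => tD.
    have : 1 <= 1 / t * D x w by rewrite mul1r mulrC ler_pdivlMr// mul1r ltW.
    move=> h; rewrite expRN invf_ple ?posrE ?expR_gt0// invrK.
    apply: le_trans (expR_ge1Dx _); lra.
rewrite (@prob_fine _ _ _ P _ mS).
rewrite -EFinM -EFinD !lee_fin.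
have := expR_ge1Dx (- (x * phi (1 / t))).
lra.
Qed.
End subordinator_bounds.

(** * Vanishing increments of a subadditive renewal function *)

Section vanishing_increments.
Context {R : realType}.
Variables (V q : R -> R) (s K p : R).
Let g t := V t - V (t - s).
Hypotheses (s0 : 0 < s) (sK : s <= K) (p01 : 0 < p <= 1).
Hypothesis V_nd : forall x y : R, x <= y -> V x <= V y.
Hypothesis V_subadd : forall t L : R, 0 <= L -> V t - V (t - L) <= V L.
Hypothesis V_sublinear : V t / t @[t --> +oo] --> 0.
Hypothesis q_cvg0 : q t @[t --> +oo] --> 0.
Hypothesis one_step : forall t A B T0 : R, s < t -> 0 <= A -> A <= B ->
  (forall z, s <= z <= K -> g (t - z) <= A) ->
  (forall y, T0 <= y -> g y <= B) ->
  g t <= A * p + B * (1 - p) + V s * q (t - T0).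

Let g_ge0 t : 0 <= g t.
Proof. by rewrite subr_ge0 V_nd// gerBl ltW. Qed.

Let Vs0 : 0 <= V s.
Proof. by apply: le_trans (V_subadd s (ltW s0)); exact: g_ge0. Qed.

(** Let eta be the limsup of the increments g t = V t - V (t - s).  By one_step,
    g t is dominated by an average of earlier increments in which the times
    t - z with s <= z <= K have total weight at least p > 0; so whenever g t is
    close to eta, g (t - z) is close to eta for some such z.  Iterating m times
    finds m disjoint windows of length s, within distance m K, on each of which
    V increases by nearly eta: V (m K) is at least about m eta, against
    sublinearity unless eta = 0. *)
Lemma vanishing_increments : V t - V (t - s) @[t --> +oo] --> 0.
Proof.
(* inf E is the limsup of g. *)
pose E := [set x : R | exists T : R, forall y, T <= y -> g y <= x].
have hE : has_inf E.
  split; first by exists (V s), 0 => y _; exact/V_subadd/ltW.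
  by exists 0 => x [T /(_ _ (lexx T))]; exact: le_trans.
have E_up (e : R) : 0 < e -> exists T : R, forall y, T <= y -> g y <= inf E + e.
  move=> e0; have [x [T Tx] xe] := inf_adherent e0 hE.
  by exists T => y /Tx /le_trans; apply; exact: ltW.
have E_lo (e T : R) : 0 < e -> exists2 y, T <= y & inf E - e <= g y.
  move=> e0; apply: contrapT => H.
  have : E (inf E - e).
    exists T => y Ty; rewrite leNgt; apply/negP => h; apply: H.
    by exists y => //; exact: ltW.
  by move=> /(ge_inf hE.2); rewrite leNgt ltrBlDr ltrDl e0.
have [eta0|eta0] := leP (inf E) 0.
  apply/cvgrPdist_le => e e0; have [T HT] := E_up e e0.
  near=> t; rewrite sub0r normrN ger0_norm; last exact: g_ge0.
  apply: (@le_trans _ _ (inf E + e)); last by lra.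
  by apply: HT; near: t; apply: nbhs_pinfty_ge; exact: num_real.
exfalso; set eta := inf E in E_up E_lo eta0.
have step (e : R) : 0 < e -> e < eta -> exists e' T : R, 0 < e' /\
    forall t, T <= t -> eta - e' <= g t ->
      exists2 z, s <= z <= K & eta - e <= g (t - z).
  move=> e0 ee; have /andP[p0 p1] := p01.
  pose e' := e * p / 4.
  have e'0 : 0 < e' by rewrite divr_gt0// mulr_gt0.
  have [T0 HT0] := E_up e' e'0.
  have d0 : 0 < e' / (V s + 1) by rewrite divr_gt0// ltr_wpDl.
  have /cvgrPdist_le /(_ _ d0) /near_pinftyP[M M0 HM] := q_cvg0.
  exists e', (Num.max (M + T0) (s + 1)); split=> // t.
  rewrite ge_max => /andP[Mt st] gt; apply: contrapT => H.
  have qs : V s * q (t - T0) <= e'.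
    have := HM (t - T0); rewrite lerBrDr => /(_ Mt); rewrite sub0r normrN => /ler_normlW h.
    apply: (@le_trans _ _ (V s * (e' / (V s + 1)))); first exact: ler_wpM2l.
    by rewrite mulrCA ler_piMr ?(ltW e'0)// ler_pdivrMr ?ltr_wpDl// mul1r lerDl.
  have h : g t <= (eta - e) * p + (eta + e') * (1 - p) + V s * q (t - T0).
    apply: one_step; [lra|lra|lra| |exact: HT0].
    move=> z zs; rewrite leNgt; apply/negP => h; apply: H.
    by exists z => //; exact: ltW.
  have : (eta - e) * p + (eta + e') * (1 - p) <= eta - e * p + e'.
    by nra.
  have ep : e * p = 4 * e' by rewrite /e'; field.
  lra.
have iter (m : nat) (e : R) : 0 < e -> e < eta -> exists e' T : R, 0 < e' /\
    forall t, T <= t -> eta - e' <= g t ->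
      exists t', [/\ t - m%:R * K <= t', eta - e <= g t' &
                     m%:R * (eta - e) <= V t - V t'].
  elim: m e => [|m IH] e e0 ee.
    by exists e, 0; split=> // t _ ht; exists t; rewrite !mul0r subr0 subrr lexx.
  have [e1 [T1 [e10 H1]]] := step e e0 ee.
  have [|| e2 [T2 [e20 H2]]] := IH (Num.min e e1).
  - by rewrite lt_min e0.
  - by rewrite gt_min ee.
  exists e2, (Num.max T2 (T1 + m%:R * K)); split=> // t.
  rewrite ge_max => /andP[t2 t1] /(H2 _ t2)[t' [tt' gt' Vt']].
  have min1 : Num.min e e1 <= e1 by rewrite ge_min lexx orbT.
  have min0 : Num.min e e1 <= e by rewrite ge_min lexx.
  have [||z /andP[sz zK] gz] := H1 t'; [lra|lra|].
  exists (t' - z); split => //.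
    by rewrite -natr1 mulrDl mul1r; lra.
  have : V (t' - z) <= V (t' - s) by apply: V_nd; lra.
  have : m%:R * (eta - e) <= m%:R * (eta - Num.min e e1).
    by rewrite ler_wpM2l//; lra.
  rewrite -natr1 mulrDl mul1r; move: gt'; rewrite /g; lra.
have K0 : 0 < K by exact: lt_le_trans sK.
have d0 : 0 < eta / (4 * K) by rewrite divr_gt0// mulr_gt0.
have /cvgrPdist_le /(_ _ d0) /near_pinftyP[M M0 HM] := V_sublinear.
pose m := (Num.truncn (M / K)).+1.
have mM : M <= m%:R * K by rewrite -ler_pdivrMr// ltW// truncnS_gt.
have m0 : (0 : R) < m%:R by [].
have mK0 : 0 < m%:R * K by rewrite mulr_gt0.
have [|| e' [T [e'0 H]]] := iter m (eta / 2); [lra|lra|].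
have [t Tt gt] := E_lo e' T e'0.
have [t' [tt' _ Vt']] := H t Tt gt.
have : V t - V t' <= V (m%:R * K).
  apply: le_trans (V_subadd t (ltW mK0)).
  by rewrite lerD2l lerN2 V_nd.
have := HM _ mM; rewrite sub0r normrN => /ler_normlW.
rewrite ler_pdivrMr// => h.
have h' : eta / (4 * K) * (m%:R * K) = m%:R * eta / 4 by field; rewrite gt_eqF.
have : 0 < m%:R * eta by rewrite mulr_gt0.
have : m%:R * (eta - eta / 2) = m%:R * eta / 2 by field.
lra.
Unshelve. all: by end_near.
Qed.
End vanishing_increments.

(** * The renewal function of a sampled subordinator *)

Section walk.
Context d (T : measurableType d) (R : realType) (P : probability T R).
Variables (D : R -> {RV P >-> R}) (phi : R -> R).
Hypothesis Dsub : subordinator D.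
Hypothesis Dlap : forall t s : R, 0 <= t -> 0 <= s ->
  ('E_P[(fun w => expR (- (s * D t w)))] = (expR (- (t * phi s)))%:E)%E.
Variable eps : R.
Hypothesis eps0 : 0 < eps.

Let S (n : nat) := D (n%:R * eps).

Definition renewal (t : R) : \bar R :=
  (\sum_(n <oo) P [set w | (D (n%:R * eps) w <= t)%R])%E.

(** The exponential bound with r = 1 majorizes the series by a geometric one. *)
Lemma renewal_bound (t : R) : 0 < t -> 0 < phi (1 / t) ->
  (renewal t <= (expR 1 * (1 + 1 / (eps * phi (1 / t))))%:E)%E.
Proof.
move=> t0 phi0.
set x := eps * phi (1 / t).
have x0 : 0 < x by rewrite mulr_gt0.
apply: lime_le; first by apply: is_cvg_nneseries.
apply: nearW => n.
pose q := expR (- x).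
apply: (@le_trans _ _ (\sum_(0 <= i < n) (expR 1 * q ^+ i)%:E)%E).
  apply: lee_sum => i _.
  apply: le_trans (subordinator_le_bound Dlap _ t0 ler01) _.
    by rewrite mulr_ge0// ltW.
  by rewrite lee_fin ler_pM2l ?expR_gt0// -expRM_natl mulrN mulrA.
rewrite sumEFin lee_fin -mulr_sumr ler_pM2l ?expR_gt0// big_mkord.
set s := \sum_(i < n) q ^+ i.
have s0 : 0 <= s by apply: sumr_ge0 => i _; rewrite exprn_ge0// expR_ge0.
have h : (1 - q) * s <= 1.
  have := subrX1 q n; rewrite -/s => E.
  have : 0 <= q ^+ n by rewrite exprn_ge0// expR_ge0.
  by rewrite -opprB mulNr -E; lra.
have h1 : q * (1 + x) <= 1.
  by rewrite /q expRN mulrC ler_pdivrMr ?expR_gt0// mul1r expR_ge1Dx.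
have : x * s <= 1 + x by nra.
move=> xs; have -> : 1 + 1 / x = (1 + x) / x by field; rewrite gt_eqF.
by rewrite ler_pdivlMr// mulrC.
Qed.

(** Conditioning on the first step of the walk. *)
Lemma renewal_step (B : set R) n : measurable B ->
  P [set w | B (S n.+1 w)] = (\int[P]_v P [set w | B (S n w + D eps v)%R])%E.
Proof.
move=> mB.
pose b := n.+1%:R * eps.
have eb : eps <= b by rewrite /b ler_peMl ?(ltW eps0)// ler1n.
have bE : b - eps = n%:R * eps by rewrite /b -natr1 mulrDl mul1r addrK.
pose f w := D b w - D eps w.
have mf : measurable_fun setT f by exact: measurable_funB.
pose F (z : R * R) : \bar R := (\1_B (z.1 + z.2))%:E.
have mF : measurable_fun setT F.
  apply/measurable_EFinP; apply: measurableT_comp.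
    exact: measurable_indic.
  exact: measurable_funD.
have sta A : measurable A -> P (f @^-1` A) = P (S n @^-1` A).
  have [[_ _ sta _] _] := Dsub.
  by move=> mA; rewrite (sta eps b (ltW eps0) eb)// bE.
have H : (\int[P]_w F (f w, D eps w) = \int[P]_v \int[P]_w F (f w, D eps v))%E.
  apply: decoupling_maps => //.
  - move=> A A' mA mA'; rewrite setIC muleC.
    rewrite (subordinator_independent Dsub (ltW eps0) eb mA' mA) bE.
    by rewrite (sta A mA).
  - by move=> z; rewrite lee_fin.
transitivity (\int[P]_w F (f w, D eps w))%E.
  rewrite -[X in P X]setIT -integral_indic//; last first.
    by rewrite -[X in measurable X]setTI; exact: measurable_funP.
  apply: eq_integral => w _; rewrite /F /= /f subrK.
  by rewrite !indicE; congr (_ _)%:E.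
rewrite H; apply: eq_integral => v _.
have mBv : measurable [set x | B (x + D eps v)].
  rewrite -[X in measurable X]setTI.
  by apply: (measurable_funD (@measurable_id _ R setT) (measurable_cst (D eps v))).
transitivity (P (f @^-1` [set x | B (x + D eps v)])); last by rewrite sta.
rewrite -[X in P X]setIT -integral_indic//.
by rewrite -[X in measurable X]setTI; exact: mf.
Qed.

Let win n (L t : R) := P [set w | (t - L < S n w <= t)%R].

Let mwinS n (L t : R) : measurable [set w | (t - L < S n w <= t)%R].
Proof.
have := measurable_funPTI (S n) (measurable_itv `]t - L, t]).
by congr measurable; apply/seteqP; split => w /=; rewrite in_itv.
Qed.

Let win_step n (L t : R) :
  win n.+1 L t = (\int[P]_v win n L (t - D eps v)%R)%E.
Proof.
rewrite /win (renewal_step (B := `]t - L, t]%classic) n)//.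
  apply: eq_integral => v _; congr (P _).
  by apply/seteqP; split => w /=; rewrite in_itv /=; lra.
Qed.

Let renewal_split n (L t : R) : 0 <= L ->
  (P [set w | (S n w <= t)%R] = P [set w | (S n w <= t - L)%R] + win n L t)%E.
Proof.
move=> L0.
have m1 : measurable [set w | (S n w <= t - L)%R] by exact: measurable_subordinator_le.
have m2 := mwinS n L t.
rewrite /win -measureU//; last first.
  by apply/seteqP; split => w //= [h1 /andP[h2 _]]; move: h1; rewrite leNgt h2.
congr (P _); apply/seteqP; split => w /=.
  by move=> h; have [h1|h1] := leP (S n w) (t - L); [left|right; rewrite h].
by case=> [h|/andP[]//]; lra.
Qed.

Let mwin n (L : R) : 0 <= L -> measurable_fun setT (win n L).
Proof.
move=> L0.
have mF : measurable_fun setT (fun t : R => P [set w | (S n w <= t)%R]).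
  apply: (eq_measurable_fun (cdf (S n))); last exact: cdf_measurable.
  move=> t _; rewrite /cdf /distribution /pushforward; congr (P _).
apply: (eq_measurable_fun (fun t : R =>
   P [set w | (S n w <= t)%R] - P [set w | (S n w <= t - L)%R])%E).
  move=> t _; rewrite (renewal_split n t L0) addeAC subee ?add0e//.
  by rewrite fin_num_measure//; exact: measurable_subordinator_le.
apply: emeasurable_funB => //.
by apply: (measurableT_comp mF); exact: measurable_funB.
Qed.

Let mwinD n (L t : R) : 0 <= L ->
  measurable_fun setT (fun v => win n L (t - D eps v)).
Proof.
move=> L0; apply: (measurableT_comp (mwin n L0)).
exact: measurable_funB.
Qed.

Let win0 (L t : R) : L < t -> win 0 L t = 0%E.
Proof.
move=> Lt; apply/eqP; rewrite -measure_le0 -(measure0 P).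
apply: ae_le_prob; [exact: mwinS|exact: measurable0|].
apply: filterS (subordinator_zero Dsub) => w D0 /=.
by rewrite /S mul0r D0 ltrBlDr add0r ltNge (ltW Lt).
Qed.

(** Subadditivity of the renewal function, before passing to the limit in N.
    While t <= L, the window ]t - L, t] lies below L.  When t > L, the walk does
    not start in the window, and after its first step the window is shifted:
    this is the induction on N. *)
Let win_sum_le N (L t : R) : 0 <= L ->
  (\sum_(0 <= n < N) win n L t <= \sum_(0 <= n < N) P [set w | (S n w <= L)%R])%E.
Proof.
move=> L0; elim: N t => [t|N IH t]; first by rewrite !big_geq.
have [tL|Lt] := leP t L.
  apply: lee_sum => n _; apply: le_measure; rewrite ?inE.
  - exact: mwinS.
  - exact: measurable_subordinator_le.
  - by move=> w /= /andP[_ /le_trans]; apply.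
rewrite big_nat_recl// win0// add0e big_nat_recr//=.
rewrite (eq_bigr _ (fun n _ => win_step n L t)).
rewrite -ge0_integral_sum//; last by move=> n; exact: mwinD.
apply: le_trans (leeDl _ _); last by rewrite measure_ge0.
apply: (@le_trans _ _
    (\int[P]_v (\sum_(0 <= n < N) P [set w | (S n w <= L)%R]))%E).
  apply: ge0_le_integral => //.
  - by move=> v _; apply: sume_ge0 => n _.
  - by apply: emeasurable_sum => n; exact: mwinD.
by rewrite integral_cst// [X in (_ * X)%E]probability_setT mule1.
Qed.

Let renewal_win (L t : R) : 0 <= L ->
  (renewal t = renewal (t - L) + \sum_(n <oo) win n L t)%E.
Proof.
move=> L0; rewrite /renewal -nneseriesD//.
by apply: eq_eseriesr => n _; exact: renewal_split.
Qed.

Let win_series_le (L t : R) : 0 <= L ->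
  (\sum_(n <oo) win n L t <= renewal L)%E.
Proof.
move=> L0; apply: lee_lim.
- exact: is_cvg_nneseries.
- exact: is_cvg_nneseries.
- by apply: nearW => N; exact: win_sum_le.
Qed.

Hypothesis phi0 : forall s : R, 0 < s -> 0 < phi s.

Let renewal_nd (s t : R) : s <= t -> (renewal s <= renewal t)%E.
Proof.
move=> st; apply: lee_nneseries => // n _; apply: le_measure; rewrite ?inE.
- exact: measurable_subordinator_le.
- exact: measurable_subordinator_le.
- by move=> w /= /le_trans; apply.
Qed.

Lemma renewal_fin (t : R) : renewal t = (fine (renewal t))%:E.
Proof.
rewrite fineK// ge0_fin_numE; last exact: nneseries_ge0.
have t1 : 0 < Num.max t 1 by rewrite lt_max ltr01 orbT.
apply: (@le_lt_trans _ _ (renewal (Num.max t 1))).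
  by apply: renewal_nd; rewrite le_max lexx.
apply: le_lt_trans (renewal_bound t1 _) (ltry _).
by rewrite phi0// divr_gt0.
Qed.

Let g_step (s t : R) : 0 <= s -> s < t ->
  (\sum_(n <oo) win n s t =
   \int[P]_v (\sum_(n <oo) win n s (t - D eps v)%R))%E.
Proof.
move=> s0 st.
rewrite integral_nneseries//; last by move=> n; exact: mwinD.
rewrite nneseries_recl// win0// add0e -nneseries_addn//.
by apply: eq_eseriesr => n _; rewrite addn1 win_step.
Qed.
Hypothesis phi_sublin : (t * phi (1 / t))^-1 @[t --> +oo] --> 0.

Let measurable_D_lt (x t : R) : measurable [set w | (D x w < t)%R].
Proof.
have := measurable_funPTI (D x) (measurable_itv `]-oo, t[).
by congr measurable; apply/seteqP; split => w /=; rewrite in_itv.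
Qed.

(** If D eps were almost surely less than s, then phi would be at most linear at
    0, which contradicts the hypothesis phi_sublin that t phi(1/t) diverges. *)
Let D_lt_lt1 (s : R) : 0 < s -> (P [set w | (D eps w < s)%R] < 1)%E.
Proof.
move=> s0; rewrite lt_neqAle probability_le1// andbT; apply/eqP => Ps.
have d0 : 0 < eps / s / 2 by rewrite !divr_gt0.
have /cvgrPdist_le /(_ _ d0) /near_pinftyP[M M0 HM] := phi_sublin.
have := HM _ (lexx M); rewrite sub0r normrN => /ler_normlW; apply/negP.
have M1 : 0 < 1 / M by rewrite divr_gt0.
have pM : 0 < M * phi (1 / M) by rewrite mulr_gt0// phi0.
rewrite -ltNge -[ltLHS]invrK ltf_pV2 ?posrE ?invr_gt0//.
apply: (@lt_le_trans _ _ (2 * (s / eps))); last first.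
  by rewrite le_eqVlt; apply/orP; left; apply/eqP; field; rewrite !gt_eqF.
apply: (@le_lt_trans _ _ (s / eps)); last first.
  by rewrite ltr_pMl ?divr_gt0// ltr1n.
have : ((expR (- (s / M)))%:E <= (expR (- (eps * phi (1 / M))))%:E)%E.
  rewrite -Dlap ?(ltW eps0) ?(ltW M1)// unlock.
  rewrite -[leLHS]mule1 -Ps -[X in P X]setIT -integral_indic//.
  have mI : measurable_fun setT (fun w => (\1_[set w | (D eps w < s)%R] w)%:E : \bar R).
    by apply/measurable_EFinP; exact: measurable_indic.
  rewrite -ge0_integralZl//.
  apply: ge0_le_integral => //.
  - exact: measurable_funeM.
  - exact: measurable_subordinator_exp.
  - move=> w _; rewrite -EFinM lee_fin indicE.
    have [|] := boolP (w \in _); last by rewrite mulr0n mulr0 expR_ge0.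
    rewrite inE /= => Ds; rewrite mulr1n mulr1 ler_expR lerN2.
    by rewrite mul1r mulrC ler_wpM2r ?invr_ge0 ?ltW.
rewrite lee_fin ler_expR lerN2 ler_pdivlMr// => h.
by rewrite ler_pdivlMr//; lra.
Qed.

(** The walk makes a step of size at least s, but bounded, with positive
    probability: this is the weight p of vanishing_increments. *)
Let D_window (s : R) : 0 < s -> exists2 K, s <= K &
  0 < fine (P [set w | (s <= D eps w <= K)%R]).
Proof.
move=> s0; pose l := fine (P [set w | (D eps w < s)%R]).
have lE : P [set w | (D eps w < s)%R] = l%:E by exact: prob_fine.
have l1 : l < 1 by rewrite -lte_fin -lE D_lt_lt1.
have : (fine (cdf (D eps) x) : R) @[x --> +oo] --> (1 : R) by apply: fine_cvg; exact: cvg_cdfy1.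
have d0 : 0 < (1 - l) / 2 by rewrite divr_gt0// subr_gt0.
move=> /cvgrPdist_le /(_ _ d0) /near_pinftyP[M M0 HM].
pose K := Num.max M s.
have MK : M <= K by rewrite le_max lexx.
have sK : s <= K by rewrite le_max lexx orbT.
exists K => //.
have mw : measurable [set w | (s <= D eps w <= K)%R].
  have := measurable_funPTI (D eps) (measurable_itv `[s, K]).
  by congr measurable; apply/seteqP; split => w /=; rewrite in_itv.
have mK := measurable_subordinator_le D eps K.
have := HM _ MK; rewrite ler_distlC => /andP[h _].
have E : (P [set w | (D eps w <= K)%R] = P [set w | (D eps w < s)%R] +
    P [set w | (s <= D eps w <= K)%R])%E.
  rewrite -measureU//; last first.
    by apply/seteqP; split => w //= [h1 /andP[h2 _]]; move: h1; rewrite ltNge h2.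
  congr (P _); apply/seteqP; split => w /=.
    by move=> h1; have [h2|h2] := ltP (D eps w) s; [left|right; rewrite h1].
  by case=> [h1|/andP[]//]; lra.
have E' : cdf (D eps) K = P [set w | (D eps w <= K)%R].
  by rewrite /cdf /distribution /pushforward; congr (P _).
move: h; rewrite E' E lE (prob_fine P mw) -EFinD /=; lra.
Qed.

(** Blackwell's renewal theorem when the steps have infinite mean: then the
    renewal function is sublinear. *)
Lemma renewal_increment_cvg0 (s : R) : 0 < s ->
  fine (renewal t) - fine (renewal (t - s)) @[t --> +oo] --> 0.
Proof.
move=> s0.
have [K sK p0] := D_window s0.
set B := [set w | (s <= D eps w <= K)%R] in p0.
have mB : measurable B.
  have := measurable_funPTI (D eps) (measurable_itv `[s, K]).
  by congr measurable; apply/seteqP; split => w /=; rewrite in_itv.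
pose p := fine (P B).
pose V t := fine (renewal t).
pose q t := fine (ccdf (D eps) t).
pose g L t := (\sum_(n <oo) win n L t)%E.
have gE L t : 0 <= L -> g L t = (V t - V (t - L))%:E.
  move=> L0; rewrite EFinB /V -!renewal_fin (renewal_win t L0) addeAC subee ?add0e//.
  by rewrite renewal_fin.
have V0 t : 0 <= V t by rewrite fine_ge0// nneseries_ge0.
have p1 : p <= 1 by rewrite -lee_fin -prob_fine// probability_le1.
(* V s * q (t - T0) accounts for a first step that exceeds t - T0: there only
   subadditivity bounds the increment. *)
apply: (@vanishing_increments _ V q s K p) => //.
- by rewrite p0 p1.
- by move=> x y xy; rewrite -lee_fin -!renewal_fin renewal_nd.
- by move=> t L L0; rewrite -lee_fin -gE// -renewal_fin win_series_le.
- have ub : expR 1 * t^-1 + expR 1 / eps * (t * phi (1 / t))^-1 @[t --> +oo] --> (0 : R).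
    rewrite -[X in _ --> X]addr0 -{1}(mulr0 (expR 1)) -{2}(mulr0 (expR 1 / eps)).
    apply: cvgD; apply: cvgMr => //.
    apply/cvgrPdist_le => e e0; apply/near_pinftyP.
    exists e^-1 => [|x ex]; first by rewrite invr_gt0.
    have x0 : 0 < x by apply: lt_le_trans ex; rewrite invr_gt0.
    rewrite sub0r normrN gtr0_norm ?invr_gt0// -[leRHS]invrK lef_pV2 ?posrE//.
    by rewrite invr_gt0.
  apply: (squeeze_cvgr _ (cvg_cst (0 : R)) ub).
  near=> t.
  have t0 : 0 < t by near: t; exact: nbhs_pinfty_gt.
  have f0 : 0 < phi (1 / t) by rewrite phi0// divr_gt0.
  rewrite divr_ge0 ?(ltW t0)//= ler_pdivrMr//.
  have : V t <= expR 1 * (1 + 1 / (eps * phi (1 / t))).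
    by rewrite -lee_fin -renewal_fin renewal_bound.
  move=> /le_trans; apply; rewrite le_eqVlt; apply/orP; left; apply/eqP.
  by field; rewrite !gt_eqF.
- by apply: fine_cvg; exact: cvg_ccdfy0.
move=> t A B' T0 st A0 AB gA gB.
have mC : measurable [set w | (t - T0 < D eps w)%R].
  have := measurable_funPTI (D eps) (measurable_itv `]t - T0, +oo[).
  by congr measurable; apply/seteqP; split => w /=; rewrite in_itv /= andbT.
have qE : P [set w | (t - T0 < D eps w)%R] = (q (t - T0))%:E.
  rewrite (prob_fine P mC) /q /ccdf /distribution /pushforward; congr (fine (P _))%:E.
  by apply/seteqP; split => w; rewrite /= in_itv /= andbT.
have iE (c : R) (E : set T) : 0 <= c -> measurable E ->
    (\int[P]_w (c * \1_E w)%:E = (c * fine (P E))%:E)%E.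
  move=> c0 mE; under eq_integral do rewrite EFinM.
  have mI : measurable_fun setT (fun w => (\1_E w)%:E : \bar R).
    by apply/measurable_EFinP; exact: measurable_indic.
  by rewrite ge0_integralZl ?lee_fin// integral_indic// setIT EFinM -(prob_fine P mE).
have mI (c : R) (E : set T) : measurable E ->
    measurable_fun setT (fun w => (c * \1_E w)%:E).
  by move=> mE; apply/measurable_EFinP; exact: measurable_funM.
have gS : (g s t = \int[P]_w g s (t - D eps w)%R)%E by exact: (g_step (ltW s0) st).
rewrite -lee_fin -(gE s t (ltW s0)) [leLHS]gS.
pose C := [set w | (t - T0 < D eps w)%R].
have mBc : measurable (~` B) by exact: measurableC.
have B0 : 0 <= B' by exact: le_trans AB.
pose f1 w := (A * \1_B w)%:E.
pose f2 w := (B' * \1_(~` B) w)%:E.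
pose f3 w := (V s * \1_C w)%:E.
have f10 w : (0 <= f1 w)%E by rewrite lee_fin mulr_ge0.
have f20 w : (0 <= f2 w)%E by rewrite lee_fin mulr_ge0.
have f30 w : (0 <= f3 w)%E by rewrite lee_fin mulr_ge0.
have mf1 : measurable_fun setT f1 by exact: mI.
have mf2 : measurable_fun setT f2 by exact: mI.
have mf3 : measurable_fun setT f3 by exact: mI.
have -> : (A * p + B' * (1 - p) + V s * q (t - T0))%:E =
  (\int[P]_w (f1 w + f2 w + f3 w))%E.
  have mf12 : measurable_fun setT (fun w => f1 w + f2 w)%E.
    exact: emeasurable_funD.
  have f120 w : setT w -> (0 <= f1 w + f2 w)%E by move=> _; rewrite adde_ge0.
  rewrite (ge0_integralD P measurableT f120 mf12)//.
  rewrite ge0_integralD// !iE// probability_setC// qE (prob_fine P mB) -/p.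
  by rewrite -EFinB /= -!EFinD.
apply: ge0_le_integral => //.
- by move=> w _; exact: nneseries_ge0.
- by apply: ge0_emeasurable_sum => // n _; exact/mwinD/ltW.
- by apply: emeasurable_funD => //; exact: emeasurable_funD.
move=> w _; rewrite (gE _ _ (ltW s0)).
rewrite /f1 /f2 /f3 -!EFinD lee_fin !indicE in_setC.
have Vs1 : 0 <= V s * ((w \in C)%:R) by rewrite mulr_ge0.
have [|wB] := boolP (w \in B).
  rewrite inE /= => /gA; rewrite mulr1n mulr0n mulr1 mulr0 addr0; lra.
rewrite mulr0n mulr1n mulr1 mulr0 add0r.
have [wC|] := boolP (w \in C).
  rewrite mulr1n mulr1.
  have : V (t - D eps w) - V (t - D eps w - s) <= V s.
    by rewrite -lee_fin -(gE _ _ (ltW s0)) -renewal_fin win_series_le// ltW.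
  lra.
move=> /negP; rewrite inE /C /= => /negP; rewrite -leNgt => h.
by rewrite mulr0n mulr0 addr0; apply: gB; lra.
Unshelve. all: by end_near.
Qed.
End walk.

(** * Paths of the inverse process *)

Section inverse.
Context d (T : measurableType d) (R : realType) (P : probability T R).
Variables (D : R -> {RV P >-> R}).
Hypothesis Dsub : subordinator D.

Let Y := inverse_process D.

(** Right continuity of the paths allows rational times, which gives the
    measurability of the inverse. *)
Let D_right (s t a : R) w : 0 <= s -> t < D s w -> s < a ->
  exists q : rat, s < ratr q < a /\ t < D (ratr q) w.
Proof.
move=> s0 tD sa.
have [[_ _ _ /(_ w)[+ _]] _] := Dsub.
move=> /(_ s s0) /cvgr_gt /(_ _ tD) [e /= e0 He].
have : s < Num.min a (s + e) by rewrite lt_min sa ltrDl.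
move=> /rat_in_itvoo[q]; rewrite in_itv /= lt_min => /and3P[sq qa qe].
exists q; rewrite sq qa; split => //; apply: He => //=.
by rewrite /ball_ /= ltr_norml; apply/andP; split; lra.
Qed.

Lemma inverse_ge0 (t : R) w : 0 <= Y t w.
Proof.
rewrite /Y /inverse_process; set A := [set s | _].
have [[s As]|A0] := pselect (A !=set0).
  by apply: lb_le_inf; [exists s|move=> x []].
by rewrite (_ : A = set0) ?inf0//; apply/seteqP; split => // x Ax; case: A0; exists x.
Qed.

Lemma inverse_le (t x : R) w : 0 <= x -> t < D x w -> Y t w <= x.
Proof.
move=> x0 tD; apply: ge_inf; last by split.
by exists 0 => z [].
Qed.

Lemma measurable_inverse (t : R) : measurable_fun setT (Y t).
Proof.
move=> mT; apply: (measurability _ (RGenInftyO.measurableE R)) => //.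
move=> _ [_ [a ->] <-]; rewrite setTI.
(* Where D never exceeds t, the inverse is the infimum 0 of the empty set. *)
pose Q (q : rat) := [set w | 0 <= ratr q :> R /\ t < D (ratr q) w].
have mQ q : measurable (Q q).
  have [q0|q0] := leP 0 (ratr q : R); last first.
    rewrite (_ : Q q = set0)//; apply/seteqP; split => // w [].
    by rewrite leNgt q0.
  have := measurable_funPTI (D (ratr q)) (measurable_itv `]t, +oo[).
  congr measurable; apply/seteqP; split => w /=; rewrite in_itv /= andbT.
    by split.
  by case.
rewrite (_ : _ @^-1` _ =
  (\bigcup_(q in [set q : rat | ratr q < a]) Q q) `|`
  ([set w | 0 < a] `&` ~` (\bigcup_q Q q))); last first.
  apply/seteqP; split => w; rewrite /= in_itv /=.
    move=> Ya; have [[s [s0 tD]]|A0] := pselect ([set s | 0 <= s /\ t < D s w] !=set0).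
      have [x [x0 tDx] xa] := @inf_lt _ [set s | 0 <= s /\ t < D s w] a
        (ex_intro _ s (conj s0 tD)) Ya.
      have [q [/andP[xq qa] tq]] := D_right x0 tDx xa.
      by left; exists q => //; split => //; apply: le_trans (ltW xq).
    right; split; first exact: le_lt_trans (inverse_ge0 t w) Ya.
    by move=> [q _ [q0 tq]]; apply: A0; exists (ratr q).
  case=> [[q qa [q0 tq]]|[a0 nQ]].
    exact: le_lt_trans (inverse_le q0 tq) qa.
  rewrite /Y /inverse_process (_ : [set s | _] = set0) ?inf0//.
  apply/seteqP; split => // s [s0 tD]; apply: nQ.
  have [|q [/andP[sq _] tq]] := @D_right s t (s + 1) w s0 tD; first by rewrite ltrDl.
  by exists q => //; split => //; apply: le_trans (ltW sq).
apply: measurableU.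
  rewrite bigcup_mkcond; apply: bigcupT_measurable_rat => q.
  by case: ifP.
apply: measurableI.
  have [a0|a0] := pselect (0 < a).
    by have -> : [set w : T | 0 < a] = setT by apply/seteqP; split.
  by have -> : [set w : T | 0 < a] = set0 by apply/seteqP; split.
by apply: measurableC; exact: bigcupT_measurable_rat.
Qed.

(** The properties of the paths of D, almost sure only, on which the estimates of
    the inverse process rely. *)
Definition regular_path (w : T) : Prop :=
  [/\ D 0 w = 0, (forall s t : R, 0 <= s -> s <= t -> D s w <= D t w) &
     forall t : R, exists n : nat, t < D n%:R w].

Lemma inverse_ge (t x : R) w : regular_path w -> 0 <= x -> D x w <= t ->
  x <= Y t w.
Proof.
move=> [_ mono unb] x0 Dt; apply: lb_le_inf.
  by have [n tn] := unb t; exists n%:R; split.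
move=> y [y0 tDy]; rewrite leNgt; apply/negP => yx.
by move: (lt_le_trans tDy (mono _ _ y0 (ltW yx))); rewrite ltNge Dt.
Qed.

Lemma inverse_nd (s t : R) w : regular_path w -> s <= t -> Y s w <= Y t w.
Proof.
move=> [_ mono unb] st; apply: lb_le_inf.
  by have [n tn] := unb t; exists n%:R; split.
move=> y [y0 tDy]; apply: inverse_le => //; exact: le_lt_trans tDy.
Qed.

(** The walk sampled at step e counts Y t from above with an error of at
    most one step. *)
Lemma grid_count (e t : R) w : regular_path w -> 0 < e -> 0 <= t ->
  exists j : nat, (forall n, (n < j)%N = (D (n%:R * e) w <= t)) /\
     Y t w <= j%:R * e <= Y t w + e.
Proof.
move=> rw e0 t0; have [D0 mono unb] := rw.
have ex : exists n : nat, t < D (n%:R * e) w.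
  have [n tn] := unb t; exists (Num.truncn (n%:R / e)).+1.
  apply: (lt_le_trans tn); apply: mono => //.
  by rewrite -ler_pdivrMr// ltW// truncnS_gt.
have nd m n : (m <= n)%N -> D (m%:R * e) w <= D (n%:R * e) w.
  move=> mn; apply: mono; first by rewrite mulr_ge0// ltW.
  by rewrite ler_pM2r// ler_nat.
pose j := ex_minn ex.
have [tj jmin] : t < D (j%:R * e) w /\
    (forall n, t < D (n%:R * e) w -> (j <= n)%N).
  by rewrite /j; case: ex_minnP.
have jP n : (n < j)%N = (D (n%:R * e) w <= t).
  apply/idP/idP => [nj|Dn].
    by rewrite leNgt; apply/negP => /jmin; rewrite leqNgt nj.
  rewrite ltnNge; apply/negP => /nd jn.
  by move: (lt_le_trans tj jn); rewrite ltNge Dn.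
exists j; split => //.
rewrite inverse_le ?mulr_ge0 ?(ltW e0)//=.
have : (0 < j)%N by rewrite jP mul0r D0.
case: (j) jP => // k kP _; rewrite -natr1 mulrDl mul1r lerD2r.
by apply: inverse_ge => //; rewrite -?kP// mulr_ge0// ltW.
Qed.

Variable phi : R -> R.
Hypothesis Dlap : forall t s : R, 0 <= t -> 0 <= s ->
  ('E_P[(fun w => expR (- (s * D t w)))] = (expR (- (t * phi s)))%:E)%E.
Hypothesis phi0 : forall s : R, 0 < s -> 0 < phi s.

(** That the paths are unbounded follows from the exponential bound: at a fixed
    level t, the probability of D n <= t decays geometrically in n. *)
Lemma ae_regular_path : {ae P, forall w, regular_path w}.
Proof.
have unb : {ae P, forall w, forall m : nat, exists n : nat, m.+1%:R < D n%:R w}.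
  apply/ae_foralln => m.
  pose A := \bigcap_n [set w | D n%:R w <= m.+1%:R].
  have mA : measurable A by apply: bigcapT_measurable => n; exact: measurable_subordinator_le.
  exists A; split => //.
    apply/eqP; rewrite -measure_le0; apply/lee_addgt0Pr => e e0; rewrite add0e.
    pose x := phi (1 / m.+1%:R).
    have x0 : 0 < x by rewrite phi0// divr_gt0.
    have q1 : 0 <= expR (- x) < 1 by rewrite expR_ge0 expR_lt1 oppr_lt0.
    have ee : 0 < e / expR 1 by rewrite divr_gt0// expR_gt0.
    have [n hn] := geometric_small q1 ee.
    apply: (@le_trans _ _ (P [set w | (D n.+1%:R w <= m.+1%:R)%R])).
      apply: le_measure; rewrite ?inE//; first exact: measurable_subordinator_le.
      by move=> w /(_ n.+1 I).
    apply: le_trans (subordinator_le_bound Dlap _ _ ler01) _ => //.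
    rewrite lee_fin mulrC -ler_pdivlMr ?expR_gt0//.
    by rewrite -mulrN expRM_natl.
  move=> w /= H n _ /=; rewrite leNgt; apply/negP => h; apply: H.
  by exists n.
have := subordinator_zero Dsub; apply: filterS3 unb (subordinator_mono Dsub) => w unb mono D0.
split => // t; have [n tn] := unb (Num.truncn t).
by exists n; apply: lt_trans tn; rewrite truncnS_gt.
Qed.

End inverse.

(** * Moments of the inverse process as renewal series *)

Section counting_series.
Context {R : realType}.

Lemma eseries_finite_support (f : nat -> \bar R) a : (forall n, 0 <= f n)%E ->
  (forall n, (a <= n)%N -> f n = 0%E) ->
  (\sum_(n <oo) f n = \sum_(0 <= n < a) f n)%E.
Proof.
move=> f0 fa; rewrite (nneseries_split 0 a)// add0n [X in (_ + X)%E]eseries0 ?adde0//.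
by move=> n an _; exact: fa.
Qed.

Lemma eseries_count (c : nat) :
  (\sum_(n <oo) ((n < c)%N%:R : R)%:E = c%:R%:E)%E.
Proof.
rewrite (eseries_finite_support (a := c)).
- rewrite sumEFin big_nat (eq_bigr (fun=> 1)); last by move=> n /andP[_ ->].
  by rewrite -big_nat sumr_const_nat subn0.
- by move=> n; rewrite lee_fin.
- by move=> n; rewrite leqNgt => /negbTE ->.
Qed.

(** With a and b the numbers of steps below s and below t, this counts the pairs
    of steps m <= n with m below s and n below t. *)
Lemma eseries_count2 (a b : nat) : (a <= b)%N ->
  (\sum_(m <oo) \sum_(k <oo) (((m < a)%N%:R * (m + k < b)%N%:R) : R)%:E =
   (a%:R * b%:R - a%:R * (a%:R - 1) / 2)%:E)%E.
Proof.
move=> ab.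
have inner m : (\sum_(k <oo) (((m < a)%N%:R * (m + k < b)%N%:R) : R)%:E =
    ((m < a)%N%:R * (b - m)%N%:R)%:E)%E.
  under eq_eseriesr do rewrite EFinM.
  rewrite nneseriesZl; last by move=> k _; rewrite lee_fin.
  rewrite EFinM; congr (_ * _)%E; rewrite -eseries_count.
  by apply: eq_eseriesr => k _; rewrite ltn_subRL.
under eq_eseriesr do rewrite inner.
rewrite (eseries_finite_support (a := a)).
- rewrite sumEFin big_nat (eq_bigr (fun m => b%:R - m%:R)); last first.
    by move=> m /andP[_ ma]; rewrite ma mul1r natrB// ltnW// (leq_trans ma).
  rewrite -big_nat; congr EFin.
  elim: a {ab inner} => [|a IH]; first by rewrite big_geq// !mul0r subrr.
  by rewrite big_nat_recr//= IH -natr1; field.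
- by move=> n; rewrite lee_fin mulr_ge0.
- by move=> n; rewrite leqNgt => /negbTE ->; rewrite mul0r.
Qed.

End counting_series.

Section inverse_moments.
Context d (T : measurableType d) (R : realType) (P : probability T R).
Variables (D : R -> {RV P >-> R}) (phi : R -> R).
Hypothesis Dsub : subordinator D.
Hypothesis Dlap : forall t s : R, 0 <= t -> 0 <= s ->
  ('E_P[(fun w => expR (- (s * D t w)))] = (expR (- (t * phi s)))%:E)%E.
Hypothesis phi0 : forall s : R, 0 < s -> 0 < phi s.

Let Y := inverse_process D.
Let mY t : measurable_fun setT (Y t) := measurable_inverse Dsub t.
Let regP := ae_regular_path Dsub Dlap phi0.

Definition walk_below (e t : R) (n : nat) : set T := [set w | D (n%:R * e) w <= t].

Let mhit e t n : measurable (walk_below e t n).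
Proof. exact: measurable_subordinator_le. Qed.

Let indic_hit e t n w : \1_(walk_below e t n) w = (D (n%:R * e) w <= t)%R%:R :> R.
Proof.
rewrite indicE; congr ((nat_of_bool _)%:R).
by apply/idP/idP; rewrite inE.
Qed.

Let mindic (A : set T) : measurable A ->
  measurable_fun setT (fun w => (\1_A w)%:E : \bar R).
Proof. by move=> mA; apply/measurable_EFinP; exact: measurable_indic. Qed.

(** The expectation of the bounds of grid_count. *)
Lemma renewal_mean (e t : R) : 0 < e -> 0 <= t ->
  (\int[P]_w (Y t w)%:E <= e%:E * renewal D e t)%E /\
  (e%:E * renewal D e t <= \int[P]_w (Y t w)%:E + e%:E)%E.
Proof.
move=> e0 t0.
pose c w := (e%:E * \sum_(n <oo) (\1_(walk_below e t n) w)%:E)%E.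
have s0 w : (0 <= \sum_(n <oo) (\1_(walk_below e t n) w)%:E :> \bar R)%E.
  by apply: nneseries_ge0 => n _ _; rewrite lee_fin.
have c0 w : (0 <= c w)%E by rewrite mule_ge0// lee_fin ltW.
have ms : measurable_fun setT (fun w => \sum_(n <oo) (\1_(walk_below e t n) w)%:E : \bar R)%E.
  apply: ge0_emeasurable_sum => [n w _ _|n _]; first by rewrite lee_fin.
  exact: mindic.
have mc : measurable_fun setT c by exact: measurable_funeM.
have cE : (\int[P]_w c w = e%:E * renewal D e t)%E.
  rewrite ge0_integralZl//; last by rewrite lee_fin ltW.
  have mh n : measurable_fun setT (fun w => (\1_(walk_below e t n) w)%:E : \bar R).
    exact: mindic.
  rewrite (integral_nneseries P measurableT mh)//.
  congr (_ * _)%E; apply: eq_eseriesr => n _.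
  by rewrite integral_indic// setIT.
have mYE : measurable_fun setT (EFin \o Y t) by exact/measurable_EFinP.
have jc w j : (forall n, (n < j)%N = (D (n%:R * e) w <= t)) ->
    c w = (j%:R * e)%:E.
  move=> jP; rewrite /c (eq_eseriesr (g := fun n => ((n < j)%N%:R)%:E)); last first.
    by move=> n _; rewrite indic_hit jP.
  by rewrite eseries_count -EFinM mulrC.
rewrite -cE; split.
  apply: ae_ge0_le_integral => //.
  - by move=> w _; rewrite lee_fin; exact: inverse_ge0.
  - apply: filterS regP => w rw _.
    have [j [jP /andP[Yj _]]] := grid_count rw e0 t0.
    by rewrite (jc w j jP) lee_fin.
rewrite -[X in (_ + X)%E]mule1 -(probability_setT P) -integral_cst// -ge0_integralD//; last 2 first.
- by move=> w _; rewrite lee_fin; exact: inverse_ge0.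
- by move=> w _; rewrite lee_fin ltW.
apply: ae_ge0_le_integral => //.
- by move=> w _; rewrite adde_ge0// lee_fin ?inverse_ge0// ltW.
- exact: emeasurable_funD.
- apply: filterS regP => w rw _.
  have [j [jP /andP[_ Yj]]] := grid_count rw e0 t0.
  by rewrite (jc w j jP) -EFinD lee_fin.
Qed.

(** The expected number of ordered pairs of steps, the first below s and the
    second, not earlier, below t. *)
Definition pair_renewal (e s t : R) : \bar R :=
  (\sum_(m <oo) \sum_(k <oo) P (walk_below e s m `&` walk_below e t (m + k)))%E.

Let seriesM (x y : nat -> \bar R) : (forall m, 0 <= x m)%E ->
  (forall m, x m \is a fin_num) -> (forall k, 0 <= y k)%E ->
  (\sum_(k <oo) y k)%E \is a fin_num ->
  (\sum_(m <oo) \sum_(k <oo) (x m * y k) =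
   (\sum_(m <oo) x m) * \sum_(k <oo) y k)%E.
Proof.
move=> x0 xf y0 yf.
transitivity (\sum_(m <oo) ((fine (\sum_(k <oo) y k))%:E * x m))%E.
  apply: eq_eseriesr => m _; rewrite -(fineK (xf m)) nneseriesZl//.
  by rewrite (fineK yf) (fineK (xf m)) muleC.
by rewrite nneseriesZl// (fineK yf) muleC.
Qed.

(** Given that step m is below s, step m + k is below t if the increment between
    them is at most t - s, and only if it is at most t.  The increment is
    independent of the past and distributed as step k. *)
Lemma pair_renewal_bounds (e s t : R) : 0 < e -> 0 <= s -> s <= t ->
  (renewal D e s * renewal D e (t - s) <= pair_renewal e s t)%E /\
  (pair_renewal e s t <= renewal D e s * renewal D e t)%E.
Proof.
move=> e0 s0 st.
have fin x := renewal_fin Dlap e0 phi0 x.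
have me m : 0 <= m%:R * e by rewrite mulr_ge0// ltW.
have ind m k x : P (walk_below e s m `&` [set w | D ((m + k)%:R * e) w - D (m%:R * e) w <= x])
    = (P (walk_below e s m) * P (walk_below e x k))%E.
  have le : m%:R * e <= (m + k)%:R * e by rewrite ler_pM2r// ler_nat leq_addr.
  have := subordinator_independent Dsub (me m) le (measurable_itv `]-oo, s]) (measurable_itv `]-oo, x]).
  have -> : (m + k)%:R * e - m%:R * e = k%:R * e by rewrite natrD; ring.
  have E (f : T -> R) z : f @^-1` `]-oo, z]%classic = [set w | f w <= z].
    by apply/seteqP; split => w; rewrite /= in_itv.
  by rewrite !E.
have mdiff m k x : measurable [set w | D ((m + k)%:R * e) w - D (m%:R * e) w <= x].
  have mf : measurable_fun setT (fun w => D ((m + k)%:R * e) w - D (m%:R * e) w).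
    exact: measurable_funB.
  have := mf measurableT _ (measurable_itv `]-oo, x]); rewrite setTI.
  by congr measurable; apply/seteqP; split => w /=; rewrite in_itv.
have renE x y : (renewal D e x * renewal D e y =
    \sum_(m <oo) \sum_(k <oo) (P (walk_below e x m) * P (walk_below e y k)))%E.
  rewrite seriesM//.
  - by move=> m; rewrite fin_num_measure.
  - by rewrite -/(renewal D e y) fin.
split.
  rewrite renE; apply: lee_nneseries => [m _ _|m _].
    by apply: nneseries_ge0 => k _ _; rewrite ?mule_ge0.
  apply: lee_nneseries => [k _ _|k _]; first by rewrite mule_ge0.
  rewrite -ind; apply: le_measure; rewrite ?inE; [exact: measurableI|exact: measurableI|].
  by move=> w []; rewrite /walk_below /= => h1 h2; split => //; lra.
rewrite renE; apply: lee_nneseries => [m _ _|m _].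
    by apply: nneseries_ge0 => k _ _; rewrite ?mule_ge0.
apply: lee_nneseries => // k _; rewrite -ind.
apply: ae_le_prob; [exact: measurableI|exact: measurableI|].
apply: filterS (subordinator_ge0 Dsub) => w Dge0; rewrite /walk_below /= => -[h1 h2].
by split => //=; have := Dge0 _ (me m); lra.
Qed.

(** With a and b the multiples of e that approximate Y s and Y t from above, e^2
    times the number of pairs is a b - a (a - e) / 2.  So the pair series
    approximates E[Y s Y t] - E[(Y s)^2] / 2; the terms with a factor e bound the
    error of discretization. *)
Lemma pair_renewal_mean (e s t : R) : 0 < e -> 0 <= s -> s <= t ->
  (\int[P]_w (Y s w * Y t w)%:E <= (e ^+ 2)%:E * pair_renewal e s t +
     \int[P]_w ((Y s w + e) * Y s w / 2)%:E)%E /\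
  ((e ^+ 2)%:E * pair_renewal e s t + \int[P]_w (Y s w * Y s w / 2)%:E <=
     \int[P]_w ((Y s w + e) * (Y t w + e) + e * Y s w / 2)%:E)%E /\
  (\int[P]_w (Y s w * Y t w / 2)%:E <= (e ^+ 2)%:E * pair_renewal e s t)%E.
Proof.
move=> e0 s0 st; have t0 : 0 <= t by exact: le_trans st.
pose f m k w : \bar R := (\1_(walk_below e s m) w * \1_(walk_below e t (m + k)) w)%:E.
have f0 m k w : (0 <= f m k w)%E by rewrite lee_fin mulr_ge0.
have mf m k : measurable_fun setT (f m k).
  by apply/measurable_EFinP; apply: measurable_funM.
have mf1 m : measurable_fun setT (fun w => \sum_(k <oo) f m k w)%E.
  by apply: ge0_emeasurable_sum.
have f10 m w : (0 <= \sum_(k <oo) f m k w)%E by apply: nneseries_ge0.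
pose c w := ((e ^+ 2)%:E * \sum_(m <oo) \sum_(k <oo) f m k w)%E.
have mf2 : measurable_fun setT (fun w => \sum_(m <oo) \sum_(k <oo) f m k w)%E.
  by apply: ge0_emeasurable_sum.
have f20 w : (0 <= \sum_(m <oo) \sum_(k <oo) f m k w)%E by apply: nneseries_ge0.
have e20 : (0 <= (e ^+ 2)%:E)%E by rewrite lee_fin exprn_ge0// ltW.
have c0 w : (0 <= c w)%E by rewrite mule_ge0.
have mc : measurable_fun setT c by exact: measurable_funeM.
have cE : (\int[P]_w c w = (e ^+ 2)%:E * pair_renewal e s t)%E.
  rewrite ge0_integralZl//; congr (_ * _)%E.
  rewrite (integral_nneseries P measurableT mf1)//.
  apply: eq_eseriesr => m _.
  rewrite (integral_nneseries P measurableT (mf m))//.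
  apply: eq_eseriesr => k _.
  rewrite /f; under eq_integral do rewrite -[(_ * _)%R]/((\1_(walk_below e s m) \* \1_(walk_below e t (m + k))) _) -indicI.
  by rewrite integral_indic ?setIT//; exact: measurableI.
have ij w i j : (forall n, (n < i)%N = (D (n%:R * e) w <= s)) ->
    (forall n, (n < j)%N = (D (n%:R * e) w <= t)) -> (i <= j)%N.
  move=> iP jP; rewrite leqNgt; apply/negP => ji.
  by move: (ltnn j); rewrite jP => /negP; apply; apply: le_trans st; rewrite -iP.
have jc w i j : (forall n, (n < i)%N = (D (n%:R * e) w <= s)) ->
    (forall n, (n < j)%N = (D (n%:R * e) w <= t)) ->
    c w = ((i%:R * e) * (j%:R * e) - (i%:R * e) * (i%:R * e - e) / 2)%:E.
  move=> iP jP.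
  rewrite /c (eq_eseriesr (g := fun m => \sum_(k <oo)
      (((m < i)%N%:R * (m + k < j)%N%:R) : R)%:E)%E); last first.
    move=> m _; apply: eq_eseriesr => k _.
    by rewrite /f !indic_hit iP jP.
  by rewrite eseries_count2 ?(ij _ _ _ iP jP)// -EFinM; congr EFin; field.
have mYY (a b : R -> R) : measurable_fun setT (fun w => a (Y s w)) ->
  measurable_fun setT (fun w => b (Y t w)) ->
  measurable_fun setT (fun w => (a (Y s w) * b (Y t w))%:E).
  by move=> ma mb; apply/measurable_EFinP; exact: measurable_funM.
have Ys0 w : 0 <= Y s w by exact: inverse_ge0.
have Yt0 w : 0 <= Y t w by exact: inverse_ge0.
have e0' := ltW e0.
rewrite -cE.
have m1 : measurable_fun setT (fun w => ((Y s w + e) * Y s w / 2)%:E).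
  apply/measurable_EFinP; apply: measurable_funM => //; apply: measurable_funM => //.
  exact: measurable_funD.
have m2 : measurable_fun setT (fun w => (Y s w * Y s w / 2)%:E).
  by apply/measurable_EFinP; apply: measurable_funM => //; apply: measurable_funM.
have m3 : measurable_fun setT
    (fun w => ((Y s w + e) * (Y t w + e) + e * Y s w / 2)%:E).
  apply/measurable_EFinP; apply: measurable_funD.
    by apply: measurable_funM; exact: measurable_funD.
  by apply: measurable_funM => //; exact: measurable_funM.
have m4 : measurable_fun setT (fun w => (Y s w * Y t w)%:E).
  by apply/measurable_EFinP; exact: measurable_funM.
have p1 w : (0 <= ((Y s w + e) * Y s w / 2)%:E)%E.
  by rewrite lee_fin divr_ge0// mulr_ge0// addr_ge0.
have p2 w : (0 <= (Y s w * Y s w / 2)%:E)%E.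
  by rewrite lee_fin divr_ge0// mulr_ge0.
have p3 w : (0 <= ((Y s w + e) * (Y t w + e) + e * Y s w / 2)%:E)%E.
  by rewrite lee_fin addr_ge0// ?divr_ge0 ?mulr_ge0 ?addr_ge0.
have p4 w : (0 <= (Y s w * Y t w)%:E)%E by rewrite lee_fin mulr_ge0.
rewrite -!ge0_integralD//; split; last split; apply: ae_ge0_le_integral => //.
- by move=> w _; rewrite adde_ge0.
- exact: emeasurable_funD.
- apply: filterS regP => w rw _.
  have [i [iP /andP[i1 i2]]] := grid_count rw e0 s0.
  have [j [jP /andP[j1 j2]]] := grid_count rw e0 t0.
  rewrite (jc w i j iP jP) -EFinD lee_fin.
  have := Ys0 w; have := Yt0 w.
  move: i1 i2 j1 j2; rewrite -/(Y s w) -/(Y t w).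
  move: (Y s w) (Y t w) (i%:R * e) (j%:R * e) => y z a b.
  nra.
- by move=> w _; rewrite adde_ge0.
- exact: emeasurable_funD.
- apply: filterS regP => w rw _.
  have [i [iP /andP[i1 i2]]] := grid_count rw e0 s0.
  have [j [jP /andP[j1 j2]]] := grid_count rw e0 t0.
  rewrite (jc w i j iP jP) -EFinD lee_fin.
  have [D0 _ _] := rw.
  have i3 : e <= i%:R * e.
    by rewrite ler_peMl// ler1n iP mul0r D0.
  have := Ys0 w; have := Yt0 w.
  move: i1 i2 i3 j1 j2; rewrite -/(Y s w) -/(Y t w).
  move: (Y s w) (Y t w) (i%:R * e) (j%:R * e) => y z a b.
  nra.
- by move=> w _; rewrite lee_fin divr_ge0// mulr_ge0.
- by apply/measurable_EFinP; apply: measurable_funM => //; apply: measurable_funM.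
- apply: filterS regP => w rw _.
  have [i [iP /andP[i1 i2]]] := grid_count rw e0 s0.
  have [j [jP /andP[j1 j2]]] := grid_count rw e0 t0.
  rewrite (jc w i j iP jP) lee_fin.
  have ije : i%:R * e <= j%:R * e by rewrite ler_pM2r// ler_nat (ij w).
  have := Ys0 w; have := Yt0 w.
  move: i1 i2 j1 j2 ije; rewrite -/(Y s w) -/(Y t w).
  move: (Y s w) (Y t w) (i%:R * e) (j%:R * e) => y z a b.
  nra.
Qed.

End inverse_moments.

(** * Regular variation of the renewal series *)

Lemma geometric_eseries (R : realType) (q : R) : 0 <= q < 1 ->
  (\sum_(n <oo) (q ^+ n)%:E = ((1 - q)^-1)%:E)%E.
Proof.
move=> /andP[q0 q1]; apply: cvg_lim => //.
have : series (geometric 1 q) n @[n --> \oo] --> 1 * (1 - q)^-1.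
  by apply: cvg_geometric_series; rewrite ger0_norm.
rewrite mul1r => H; apply: cvg_EFin.
  by apply: nearW => n; rewrite sumEFin.
apply: cvg_trans H; apply: near_eq_cvg; apply: nearW => n.
by rewrite /= sumEFin /=; apply: eq_bigr => i _; rewrite /= mul1r.
Qed.

Section laplace_of_renewal.
Context d (T : measurableType d) (R : realType) (P : probability T R).
Variables (D : R -> {RV P >-> R}) (phi : R -> R).
Hypothesis Dsub : subordinator D.
Hypothesis Dlap : forall t s : R, 0 <= t -> 0 <= s ->
  ('E_P[(fun w => expR (- (s * D t w)))] = (expR (- (t * phi s)))%:E)%E.
Hypothesis phi0 : forall s : R, 0 < s -> 0 < phi s.

Let pos : set R := [set x | (0 <= x)%R].

Let mpos : measurable pos.
Proof. by rewrite /pos -set_itvcy. Qed.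

Let law (x : R) := distribution P (D x).

Let mexp (s : R) : measurable_fun pos (fun x => (expR (- (s * x)))%:E).
Proof.
apply/measurable_EFinP; apply: measurableT_comp => //.
by apply: measurableT_comp => //; exact: measurable_funM.
Qed.

(** The integral runs over the half line, where the law of D x is
    concentrated. *)
Let law_laplace (x s : R) : 0 <= x -> 0 <= s ->
  (\int[law x]_(y in pos) (expR (- (s * y)))%:E = (expR (- (x * phi s)))%:E)%E.
Proof.
move=> x0 s0; rewrite -Dlap// unlock /law ge0_integral_pushforward//.
rewrite integral_mkcond /=.
have mpre : measurable (D x @^-1` pos).
  by rewrite -[X in measurable X]setTI; exact: measurable_funP.
apply: ge0_ae_eq_integral => //.
- apply/(measurable_restrictT _ mpre); exact: measurable_funTS (measurable_subordinator_exp D x s).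
- exact: measurable_subordinator_exp.
- by move=> w _; apply: erestrict_ge0 => v _; rewrite lee_fin expR_ge0.
- apply: filterS (subordinator_ge0 Dsub) => w Dw _ /=.
  by rewrite patchE mem_set//=; exact: Dw.
Qed.

Let law_le (x t : R) : 0 <= x ->
  law x [set y | (0 <= y <= t)%R] = P [set w | (D x w <= t)%R].
Proof.
move=> x0; rewrite /law /distribution /pushforward.
have m1 : measurable (D x @^-1` [set y | (0 <= y <= t)%R]).
  have := measurable_funPTI (D x) (measurable_itv `[0, t]).
  by congr measurable; apply/seteqP; split => w /=; rewrite in_itv.
apply: ae_eq_prob => //; first exact: measurable_subordinator_le.
by apply: filterS (subordinator_ge0 Dsub) => w Dw /=; rewrite Dw.
Qed.

Let psi (s : R) := (1 - expR (- phi s))^-1.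

Let q01 (s : R) : 0 < s -> 0 <= expR (- phi s) < 1.
Proof. by move=> s0; rewrite expR_ge0 expR_lt1 oppr_lt0 phi0. Qed.

(** The measures whose distribution functions are the renewal series for the
    step 1 of the walk. *)
Let m1 : {measure set R -> \bar R} := mseries (fun n => law n%:R) 0.
Let m2 : {measure set R -> \bar R} :=
  mseries (fun m => mseries (fun k => law (m + k)%:R) 0) 0.

Let m1_laplace (s : R) : 0 < s ->
  (\int[m1]_(x in pos) (expR (- (s * x)))%:E = (psi s)%:E)%E.
Proof.
move=> s0; rewrite ge0_integral_measure_series//.
rewrite -geometric_eseries ?q01//; apply: eq_eseriesr => n _.
by rewrite law_laplace ?(ltW s0)// -expRM_natl mulrN.
Qed.

Let m2_laplace (s : R) : 0 < s ->
  (\int[m2]_(x in pos) (expR (- (s * x)))%:E = (psi s ^+ 2)%:E)%E.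
Proof.
move=> s0; rewrite ge0_integral_measure_series//.
rewrite expr2 EFinM -[X in (_ = X * _)%E]geometric_eseries ?q01//.
rewrite muleC -nneseriesZl; last by move=> n _; rewrite lee_fin exprn_ge0// expR_ge0.
apply: eq_eseriesr => m _.
rewrite ge0_integral_measure_series//.
rewrite muleC -geometric_eseries ?q01// -nneseriesZl; last first.
  by move=> n _; rewrite lee_fin exprn_ge0// expR_ge0.
apply: eq_eseriesr => k _.
by rewrite law_laplace ?(ltW s0)// -EFinM -exprD -expRM_natl mulrN.
Qed.

Variables (al C : R).
Hypotheses (al0 : 0 < al) (C0 : 0 < C).
Hypothesis phi_asym : forall c : R, 0 < c ->
  phi (c / t) * t `^ al @[t --> +oo] --> C * c `^ al.

Lemma powRN_cvg0 (b : R) : 0 < b -> (t `^ b)^-1 @[t --> +oo] --> (0 : R).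
Proof.
move=> b0; apply/cvgrPdist_le => e e0; apply/near_pinftyP.
exists (e^-1 `^ b^-1) => [|t et]; first by rewrite powR_gt0 ?invr_gt0.
have t0 : 0 < t by apply: lt_le_trans et; rewrite powR_gt0 ?invr_gt0.
rewrite sub0r normrN gtr0_norm ?invr_gt0 ?powR_gt0// -[leRHS]invrK.
rewrite lef_pV2 ?posrE ?invr_gt0 ?powR_gt0//.
apply: (@le_trans _ _ ((e^-1 `^ b^-1) `^ b)).
  by rewrite -powRrM mulVf ?gt_eqF// powRr1// invr_ge0 ltW.
by apply: ge0_ler_powR; rewrite ?nnegrE ?powR_ge0// ltW.
Qed.

(** 1 / (1 - e^(-x)) lies between 1 / x and 1 / x + 1. *)
Let psi_cvg (j : nat) :
  psi (j.+1%:R / t) / t `^ al @[t --> +oo] --> (C * j.+1%:R `^ al)^-1.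
Proof.
have L : C * j.+1%:R `^ al != 0 by rewrite gt_eqF// mulr_gt0// powR_gt0.
have lo : (phi (j.+1%:R / t) * t `^ al)^-1 @[t --> +oo] -->
    (C * j.+1%:R `^ al)^-1 by exact: (cvgV L (phi_asym (ltr0Sn R j))).
have hi : (phi (j.+1%:R / t) * t `^ al)^-1 + (t `^ al)^-1 @[t --> +oo] -->
    (C * j.+1%:R `^ al)^-1.
  by rewrite -[X in _ --> X]addr0; exact: (cvgD lo (powRN_cvg0 al0)).
apply: (squeeze_cvgr _ lo hi); near=> t.
have t0 : 0 < t by near: t; apply: nbhs_pinfty_gt; exact: num_real.
have ta : 0 < t `^ al by rewrite powR_gt0.
have s0 : 0 < j.+1%:R / t by rewrite divr_gt0.
have p0 := phi0 s0.
rewrite /psi; set x := phi _ in p0 *.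
have e1 : 1 - x <= expR (- x) by have := expR_ge1Dx (- x).
have e2 : expR (- x) * (1 + x) <= 1.
  by rewrite expRN mulrC ler_pdivrMr ?expR_gt0// mul1r expR_ge1Dx.
have e3 : 0 < 1 - expR (- x) by rewrite subr_gt0 expR_lt1 oppr_lt0.
rewrite [(_ * _)^-1]invfM; apply/andP; split.
  by rewrite ler_wpM2r ?invr_ge0 ?(ltW ta)// lef_pV2 ?posrE//; lra.
have -> : x^-1 / t `^ al + (t `^ al)^-1 = (x^-1 + 1) / t `^ al by ring.
rewrite ler_wpM2r ?invr_ge0 ?(ltW ta)//.
have x1 : 0 < 1 + x by rewrite addr_gt0.
have -> : x^-1 + 1 = (x / (1 + x))^-1 by field; rewrite !gt_eqF.
have e4 : 0 < x / (1 + x) by rewrite divr_gt0.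
rewrite lef_pV2 ?posrE// ler_pdivrMr//; lra.
Unshelve. all: by end_near.
Qed.

Lemma renewal_regular :
  exists l : R, fine (renewal D 1 t) / t `^ al @[t --> +oo] --> l.
Proof.
have [|l lP] := tauberian m1_laplace al0.
  by move=> j; exists (C * j.+1%:R `^ al)^-1; exact: psi_cvg.
exists l; apply: cvg_trans lP; apply: near_eq_cvg; apply: nearW => t.
congr (fine _ / _); apply: eq_eseriesr => n _.
by rewrite mulr1; exact: law_le.
Qed.

Lemma pair_renewal_regular :
  exists l : R, fine (pair_renewal D 1 t t) / t `^ (al *+ 2) @[t --> +oo] --> l.
Proof.
have [||l lP] := tauberian m2_laplace (b := al *+ 2).
- by rewrite mulrn_wgt0.
- move=> j; exists ((C * j.+1%:R `^ al)^-1 * (C * j.+1%:R `^ al)^-1).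
  have H : psi (j.+1%:R / t) / t `^ al * (psi (j.+1%:R / t) / t `^ al)
      @[t --> +oo] --> (C * j.+1%:R `^ al)^-1 * (C * j.+1%:R `^ al)^-1.
    by apply: cvgM; exact: psi_cvg.
  apply: cvg_trans H; apply: near_eq_cvg; near=> t.
  have t0 : 0 < t by near: t; apply: nbhs_pinfty_gt; exact: num_real.
  rewrite mulr2n powRD; last by rewrite (gt_eqF t0) implybT.
  by rewrite expr2 invfM; ring.
exists l; apply: cvg_trans lP; apply: near_eq_cvg; apply: nearW => t.
congr (fine _ / _); apply: eq_eseriesr => m _; apply: eq_eseriesr => k _.
transitivity (P [set w | D (m + k)%:R w <= t]); first exact: law_le.
rewrite -[in LHS](mulr1 (m + k)%:R); apply: ae_eq_prob.
- exact: measurable_subordinator_le.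
- by apply: measurableI; exact: measurable_subordinator_le.
apply: filterS (subordinator_mono Dsub) => w mono; rewrite /walk_below /=; split=> [h|[]//].
split=> //; apply: le_trans h; apply: mono; rewrite !mulr1 ?ler_nat ?leq_addr//.
Unshelve. all: by end_near.
Qed.

End laplace_of_renewal.

(** * Expectation of integrable and square integrable functions *)

Section mean.
Context d (T : measurableType d) (R : realType) (P : probability T R).
Implicit Types f g : T -> R.

(** The real number E[f], for equations between reals; it is meaningful for
    integrable f. *)
Definition mean f : R := fine 'E_P[f].

Lemma Lfun1D f g : f \in Lfun P 1 -> g \in Lfun P 1 ->
  (fun w => f w + g w) \in Lfun P 1.
Proof. by move=> fL gL; exact: rpredD. Qed.

Lemma Lfun1Z (a : R) f : f \in Lfun P 1 -> (fun w => a * f w) \in Lfun P 1.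
Proof.
move=> fL; rewrite (_ : (fun w => a * f w) = a \o* f) ?Lfun_scale//.
by apply/funext => w; rewrite /= mulrC.
Qed.

Lemma Lfun1B f g : f \in Lfun P 1 -> g \in Lfun P 1 ->
  (fun w => f w - g w) \in Lfun P 1.
Proof. by move=> fL gL; exact: rpredB. Qed.

Lemma Lfun1C (a : R) : (fun=> a) \in Lfun P 1.
Proof. exact: Lfun_cst. Qed.

Lemma meanE f : f \in Lfun P 1 -> (\int[P]_w (f w)%:E = (mean f)%:E)%E.
Proof. by move=> fL; rewrite /mean fineK ?expectation_fin_num// unlock. Qed.

Lemma meanD f g : f \in Lfun P 1 -> g \in Lfun P 1 ->
  mean (fun w => f w + g w) = mean f + mean g.
Proof.
move=> fL gL; rewrite /mean -fineD ?expectation_fin_num//.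
by rewrite -expectationD.
Qed.

Lemma meanB f g : f \in Lfun P 1 -> g \in Lfun P 1 ->
  mean (fun w => f w - g w) = mean f - mean g.
Proof.
move=> fL gL; rewrite /mean -fineB ?expectation_fin_num//.
by rewrite -expectationB.
Qed.

Lemma meanZ (a : R) f : f \in Lfun P 1 -> mean (fun w => a * f w) = a * mean f.
Proof.
move=> fL; apply: EFin_inj; rewrite EFinM /mean !fineK ?expectation_fin_num ?Lfun1Z//.
rewrite -expectationZl//; congr expectation; apply/funext => w; exact: mulrC.
Qed.

Lemma meanC (a : R) : mean (fun=> a) = a.
Proof. by rewrite /mean expectation_cst. Qed.

Lemma mean_le f g : f \in Lfun P 1 -> g \in Lfun P 1 ->
  {ae P, forall w, f w <= g w} -> mean f <= mean g.
Proof.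
move=> fL gL fg.
have dL := Lfun1B gL fL.
rewrite -subr_ge0 -meanB// -lee_fin -meanE//.
have /Lfun1_integrable/integrableP[md _] := dL.
have -> : (\int[P]_w (g w - f w)%:E = \int[P]_w (`|g w - f w|)%:E)%E.
  apply: ae_eq_integral => //.
    by apply/measurable_EFinP; apply: measurableT_comp => //; exact/measurable_EFinP.
  by apply: filterS fg => w fgw _; rewrite ger0_norm// subr_ge0.
by apply: integral_ge0 => w _; rewrite lee_fin.
Qed.

Lemma mean_ge0 f : (forall w, 0 <= f w) -> 0 <= mean f.
Proof. by move=> f0; rewrite /mean fine_ge0// expectation_ge0. Qed.

Lemma Lfun1_ge0 f : measurable_fun setT f -> (forall w, 0 <= f w) ->
  (\int[P]_w (f w)%:E < +oo)%E -> f \in Lfun P 1.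
Proof.
move=> mf f0 fi; apply/Lfun1_integrable/integrableP; split.
  exact/measurable_EFinP.
by under eq_integral do rewrite /= ger0_norm//.
Qed.

Lemma Lfun2_sqr f : measurable_fun setT f ->
  (\int[P]_w (f w ^+ 2)%:E < +oo)%E -> f \in Lfun P 2%:E.
Proof.
move=> mf f2; rewrite inE; apply/andP; split; rewrite inE//=.
rewrite /finite_norm unlock poweR_lty//; apply: le_lt_trans f2.
rewrite le_eqVlt; apply/orP; left; apply/eqP; apply: eq_integral => w _.
by rewrite /= powR_mulrn// real_normK ?num_real.
Qed.

Lemma Lfun2M f g : f \in Lfun P 2%:E -> g \in Lfun P 2%:E ->
  (fun w => f w * g w) \in Lfun P 1.
Proof. by move=> fL gL; exact: Lfun2_mul_Lfun1. Qed.

Lemma Lfun2D f g : f \in Lfun P 2%:E -> g \in Lfun P 2%:E ->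
  (fun w => f w + g w) \in Lfun P 2%:E.
Proof.
have p1 : (1 <= 2%:E :> \bar R)%E by rewrite lee1n.
by move=> fL gL; exact: (Lfun_addr_closed P p1).2 fL gL.
Qed.

Lemma Lfun2C (a : R) : (fun=> a) \in Lfun P 2%:E.
Proof. exact: (@Lfun_cst _ _ _ P a 2). Qed.

Lemma Lfun2_Lfun1 f : f \in Lfun P 2%:E -> f \in Lfun P 1.
Proof. by apply: Lfun_subset12; rewrite fin_num_measure. Qed.

Lemma Lfun_measurable_fun f (p : \bar R) : f \in Lfun P p -> measurable_fun setT f.
Proof. by rewrite inE => /andP[]; rewrite inE. Qed.

Lemma covariance_mean f g : f \in Lfun P 2%:E -> g \in Lfun P 2%:E ->
  fine (covariance P f g) = mean (fun w => f w * g w) - mean f * mean g.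
Proof.
move=> fL gL.
have fgL : (f * g : T -> R) \in Lfun P 1 by exact: Lfun2_mul_Lfun1.
have [f1 g1] := (Lfun2_Lfun1 fL, Lfun2_Lfun1 gL).
rewrite covarianceE// fineB ?fin_numM ?expectation_fin_num//.
by rewrite fineM ?expectation_fin_num.
Qed.

End mean.

(** * Mean and covariance of the inverse process *)

(** The form in which the grid step tends to 0. *)
Lemma le_of_small_error (R : realType) (a b c : R) : 0 <= c ->
  (forall e : R, 0 < e -> e <= 1 -> a <= b + e * c) -> a <= b.
Proof.
move=> c0 H; apply/ler_addgt0Pr => x x0.
have c1 : 0 < c + 1 by lra.
pose e := Num.min 1 (x / (c + 1)).
have e0 : 0 < e by rewrite lt_min ltr01 divr_gt0.
have e1 : e <= 1 by rewrite ge_min lexx.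
apply: le_trans (H e e0 e1) _; rewrite lerD2l.
apply: (@le_trans _ _ (x / (c + 1) * c)).
  by rewrite ler_wpM2r// ge_min lexx orbT.
by rewrite mulrAC ler_pdivrMr//; nra.
Qed.

Section inverse_asymptotics.
Context d (T : measurableType d) (R : realType) (P : probability T R).
Variables (D : R -> {RV P >-> R}) (phi : R -> R) (al C : R).
Hypothesis Dsub : subordinator D.
Hypothesis Dlap : forall t s : R, 0 <= t -> 0 <= s ->
  ('E_P[(fun w => expR (- (s * D t w)))] = (expR (- (t * phi s)))%:E)%E.
Hypothesis phi0 : forall s : R, 0 < s -> 0 < phi s.
Hypotheses (al0 : 0 < al) (al1 : al < 1) (C0 : 0 < C).
Hypothesis phi_asym : forall c : R, 0 < c ->
  phi (c / t) * t `^ al @[t --> +oo] --> C * c `^ al.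

Let Y := inverse_process D.
Let mY t : measurable_fun setT (Y t) := measurable_inverse Dsub t.
Let Y0 t w : 0 <= Y t w := inverse_ge0 D t w.
Let V (e t : R) := fine (renewal D e t).
Let VE (e t : R) : 0 < e -> renewal D e t = (V e t)%:E.
Proof. by move=> e0; exact: (renewal_fin Dlap e0 phi0 t). Qed.

(** Twice the pair series for the step 1 dominates (Y t)^2. *)
Lemma inverse_L2 (t : R) : 0 <= t -> Y t \in Lfun P 2%:E.
Proof.
move=> t0; apply: Lfun2_sqr => //.
have [_ [_ h]] := pair_renewal_mean Dsub Dlap phi0 ltr01 t0 (lexx t).
have [_ h2] := pair_renewal_bounds Dsub Dlap phi0 ltr01 t0 (lexx t).
have -> : (\int[P]_w (Y t w ^+ 2)%:E = 2%:E * \int[P]_w (Y t w * Y t w / 2)%:E)%E.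
  rewrite -ge0_integralZl//.
  - by apply: eq_integral => w _; rewrite -EFinM; congr EFin; field.
  - by apply/measurable_EFinP; apply: measurable_funM => //; exact: measurable_funM.
  - by move=> w _; rewrite lee_fin divr_ge0 ?mulr_ge0.
apply: lte_mul_pinfty => //; apply: le_lt_trans h _.
rewrite expr1n mul1e; apply: le_lt_trans h2 _.
by rewrite VE// -EFinM ltry.
Qed.

Let YL1 t : 0 <= t -> Y t \in Lfun P 1.
Proof. by move=> t0; apply: Lfun2_Lfun1; exact: inverse_L2. Qed.

Let U t := mean P (Y t).
Let Q s t := mean P (fun w => Y s w * Y t w).

Let YYL1 s t : 0 <= s -> 0 <= t -> (fun w => Y s w * Y t w) \in Lfun P 1.
Proof. by move=> s0 t0; apply: Lfun2M; exact: inverse_L2. Qed.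

Let U_renewal (e t : R) : 0 < e -> 0 <= t -> U t <= e * V e t <= U t + e.
Proof.
move=> e0 t0; have := renewal_mean Dsub Dlap phi0 e0 t0.
rewrite meanE ?YL1// VE// -EFinM -EFinD !lee_fin => -[-> ->] //.
Qed.

Let W (e s t : R) := fine (pair_renewal D e s t).

Let V0 e x : 0 < e -> 0 <= e * V e x.
Proof. by move=> e0; rewrite mulr_ge0 ?(ltW e0)// fine_ge0// nneseries_ge0. Qed.

Let W_bounds (e s t : R) : 0 < e -> 0 <= s -> s <= t ->
  [/\ pair_renewal D e s t = (W e s t)%:E,
      (e * V e s) * (e * V e (t - s)) <= e ^+ 2 * W e s t &
      e ^+ 2 * W e s t <= (e * V e s) * (e * V e t)].
Proof.
move=> e0 s0 st.
have [h1 h2] := pair_renewal_bounds Dsub Dlap phi0 e0 s0 st.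
have WE : pair_renewal D e s t = (W e s t)%:E.
  rewrite /W fineK// ge0_fin_numE; last first.
    by apply: nneseries_ge0 => m _ _; exact: nneseries_ge0.
  by apply: le_lt_trans h2 _; rewrite !VE// -EFinM ltry.
move: h1 h2; rewrite WE !VE// -!EFinM !lee_fin => h1 h2.
have e2 : 0 <= e ^+ 2 by rewrite exprn_ge0// ltW.
split => //.
  have -> : e * V e s * (e * V e (t - s)) = e ^+ 2 * (V e s * V e (t - s)) by ring.
  exact: ler_wpM2l.
have -> : e * V e s * (e * V e t) = e ^+ 2 * (V e s * V e t) by ring.
exact: ler_wpM2l.
Qed.

Let W_upper (e s t : R) : 0 < e -> 0 <= s -> s <= t ->
  Q s t <= e ^+ 2 * W e s t + (Q s s / 2 + e / 2 * U s).
Proof.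
move=> e0 s0 st; have t0 : 0 <= t by exact: le_trans st.
have [h _] := pair_renewal_mean Dsub Dlap phi0 e0 s0 st.
have [WE _ _] := W_bounds e0 s0 st.
have fE : (fun w => (Y s w + e) * Y s w / 2) =
    fun w => 2^-1 * (Y s w * Y s w) + e / 2 * Y s w.
  by apply/funext => w; field.
have L1 : (fun w => 2^-1 * (Y s w * Y s w)) \in Lfun P 1.
  by apply: Lfun1Z; exact: YYL1.
have L2 : (fun w => e / 2 * Y s w) \in Lfun P 1 by apply: Lfun1Z; exact: YL1.
have L : (fun w => (Y s w + e) * Y s w / 2) \in Lfun P 1 by rewrite fE; exact: Lfun1D.
have LE : mean P (fun w => (Y s w + e) * Y s w / 2) = Q s s / 2 + e / 2 * U s.
  rewrite fE (meanD L1 L2) (meanZ _ (YYL1 s0 s0)) (meanZ _ (YL1 s0)).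
  by rewrite mulrC.
move: h; rewrite (meanE (YYL1 s0 t0)) (meanE L) LE WE -EFinM -EFinD lee_fin.
exact.
Qed.

Let W_lower (e s t : R) : 0 < e -> 0 <= s -> s <= t ->
  e ^+ 2 * W e s t + Q s s / 2 <=
    Q s t + (e * U t + ((e + e / 2) * U s + e ^+ 2)).
Proof.
move=> e0 s0 st; have t0 : 0 <= t by exact: le_trans st.
have [_ [h _]] := pair_renewal_mean Dsub Dlap phi0 e0 s0 st.
have [WE _ _] := W_bounds e0 s0 st.
pose f w := Y s w * Y t w + (e * Y t w + ((e + e / 2) * Y s w + e ^+ 2)).
have fE : (fun w => (Y s w + e) * (Y t w + e) + e * Y s w / 2) = f.
  by apply/funext => w; rewrite /f; field.
have L1 : (fun w => (e + e / 2) * Y s w) \in Lfun P 1 by apply: Lfun1Z; exact: YL1.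
have L2 : (fun w => e * Y t w) \in Lfun P 1 by apply: Lfun1Z; exact: YL1.
have L3 : (fun w => (e + e / 2) * Y s w + e ^+ 2) \in Lfun P 1.
  by apply: Lfun1D => //; exact: Lfun1C.
have L4 := Lfun1D L2 L3.
have L5 := YYL1 s0 t0.
have Lf : f \in Lfun P 1 by exact: Lfun1D.
have fm : mean P f = Q s t + (e * U t + ((e + e / 2) * U s + e ^+ 2)).
  rewrite /f (meanD L5 L4) (meanD L2 L3) (meanD L1 (Lfun1C P _)) meanC.
  by rewrite (meanZ _ (YL1 t0)) (meanZ _ (YL1 s0)).
have gE : (fun w => Y s w * Y s w / 2) = fun w => 2^-1 * (Y s w * Y s w).
  by apply/funext => w; rewrite mulrC.
have Lg : (fun w => Y s w * Y s w / 2) \in Lfun P 1.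
  by rewrite gE; apply: Lfun1Z; exact: YYL1.
have gm : mean P (fun w => Y s w * Y s w / 2) = Q s s / 2.
  by rewrite gE (meanZ _ (YYL1 s0 s0)) mulrC.
have : ((e ^+ 2)%:E * pair_renewal D e s t +
    \int[P]_w (Y s w * Y s w / 2)%:E <= \int[P]_w (f w)%:E)%E by rewrite -fE.
by rewrite (meanE Lg) (meanE Lf) WE gm fm -EFinM -EFinD lee_fin.
Qed.

Let U0 t : 0 <= U t.
Proof. exact: mean_ge0. Qed.

(** The pair series is at most V s * V t, and the grid step tends to 0. *)
Let cov_upper (s t : R) : 0 <= s -> s <= t -> Q s t <= U s * U t + Q s s / 2.
Proof.
move=> s0 st; have t0 : 0 <= t by exact: le_trans st.
have := U0 s; have := U0 t => Ut0 Us0.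
apply: (@le_of_small_error _ _ _ (U s + U t + 1 + U s)) => [|e e0 e1]; first by lra.
have [_ _ h2] := W_bounds e0 s0 st.
have h := W_upper e0 s0 st.
have /andP[_ hs] := U_renewal e0 s0.
have /andP[_ ht] := U_renewal e0 t0.
have : (e * V e s) * (e * V e t) <= (U s + e) * (U t + e).
  by apply: ler_pM => //; exact: V0.
nra.
Qed.

(** The counterpart of the upper bound, with V s * V (t - s). *)
Let cov_lower (s t : R) : 0 <= s -> s <= t ->
  U s * U (t - s) + Q s s / 2 <= Q s t.
Proof.
move=> s0 st; have t0 : 0 <= t by exact: le_trans st.
have ts0 : 0 <= t - s by rewrite subr_ge0.
have := U0 s; have := U0 t => Ut0 Us0.
apply: (@le_of_small_error _ _ _ (U s + U t + 1 + U s)) => [|e e0 e1]; first by lra.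
have [_ h2 _] := W_bounds e0 s0 st.
have h := W_lower e0 s0 st.
have /andP[hs _] := U_renewal e0 s0.
have /andP[ht _] := U_renewal e0 ts0.
have : U s * U (t - s) <= (e * V e s) * (e * V e (t - s)) by apply: ler_pM.
nra.
Qed.

Let U_nd (s t : R) : 0 <= s -> s <= t -> U s <= U t.
Proof.
move=> s0 st; have t0 : 0 <= t by exact: le_trans st.
apply: mean_le; [exact: YL1|exact: YL1|].
apply: filterS (ae_regular_path Dsub Dlap phi0) => w rw.
exact: inverse_nd.
Qed.

(** As alpha < 1, phi has infinite slope at 0 and the mean of D t is
    infinite. *)
Let phi_sublin : (t * phi (1 / t))^-1 @[t --> +oo] --> (0 : R).
Proof.
have L : C * 1 `^ al != 0 by rewrite gt_eqF// mulr_gt0// powR_gt0.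
have H1 : (phi (1 / t) * t `^ al)^-1 @[t --> +oo] --> (C * 1 `^ al)^-1.
  exact: (cvgV L (phi_asym ltr01)).
have H2 : (t `^ (1 - al))^-1 @[t --> +oo] --> (0 : R).
  by apply: powRN_cvg0; rewrite subr_gt0.
have H : (phi (1 / t) * t `^ al)^-1 * (t `^ (1 - al))^-1 @[t --> +oo] --> (0 : R).
  by rewrite -[X in _ --> X](mulr0 (C * 1 `^ al)^-1); apply: cvgM.
apply: cvg_trans H; apply: near_eq_cvg; near=> t.
have t0 : 0 < t by near: t; apply: nbhs_pinfty_gt; exact: num_real.
rewrite -invfM -mulrA -powRD; last by rewrite (gt_eqF t0) implybT.
by rewrite addrC subrK powRr1 ?ltW// mulrC.
Unshelve. all: by end_near.
Qed.

(** For a grid of step e = x / 2, e times the increment of the renewal function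
    differs from that of U by at most e. *)
Lemma inverse_mean_increment (s : R) : 0 < s ->
  U t - U (t - s) @[t --> +oo] --> (0 : R).
Proof.
move=> s0; apply/cvgrPdist_le => x x0.
pose e := x / 2.
have e0 : 0 < e by rewrite divr_gt0.
have /cvgrPdist_le /(_ 1 ltr01) := renewal_increment_cvg0 Dsub Dlap e0 phi0 phi_sublin s0.
apply: filterS2 (nbhs_pinfty_ge (num_real s)) => t st.
rewrite sub0r normrN => /ler_normlW.
rewrite -/(V e t) -/(V e (t - s)) => h.
have ts0 : 0 <= t - s by rewrite subr_ge0.
have t0 : 0 <= t by apply: le_trans st; exact: ltW.
have tst : t - s <= t by rewrite gerBl ltW.
rewrite sub0r normrN ger0_norm ?subr_ge0 ?U_nd//.
have /andP[h1 _] := U_renewal e0 t0.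
have /andP[_ h2] := U_renewal e0 ts0.
have : e * (V e t - V e (t - s)) <= e * 1 by rewrite ler_wpM2l// ltW.
have : x = 2 * e by rewrite /e; field.
lra.
Qed.

Lemma inverse_covariance_cvg (s : R) : 0 < s ->
  Q s t - U s * U t @[t --> +oo] --> Q s s / 2.
Proof.
move=> s0.
have H : U s * (U t - U (t - s)) @[t --> +oo] --> (0 : R).
  by rewrite -[X in _ --> X](mulr0 (U s)); apply: cvgMr; exact: inverse_mean_increment.
have lo : Q s s / 2 - U s * (U t - U (t - s)) @[t --> +oo] --> Q s s / 2.
  by rewrite -[X in _ --> X]subr0; apply: cvgB => //; exact: cvg_cst.
apply: (squeeze_cvgr _ lo (cvg_cst _)).
apply: filterS (nbhs_pinfty_ge (num_real s)) => t st.
have := cov_upper (ltW s0) st; have := cov_lower (ltW s0) st; lra.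
Qed.

(** At time x = 1 / (4 phi (1 / t)) the subordinator is still below t with
    probability at least 1/2, and then Y t >= x. *)
Lemma inverse_mean_ge (t : R) : 0 < t -> (8 * phi (1 / t))^-1 <= U t.
Proof.
move=> t0; have p0 : 0 < phi (1 / t) by rewrite phi0// divr_gt0.
pose x := (4 * phi (1 / t))^-1.
have x0 : 0 < x by rewrite invr_gt0 mulr_gt0.
have half : ((2^-1)%:E <= P [set w | (D x w <= t)%R])%E.
  apply: (subordinator_le_half Dsub Dlap (ltW x0) t0).
  by rewrite /x invfM -mulrA mulVf ?gt_eqF// mulr1.
set A := [set w | _] in half.
have mA : measurable A by exact: measurable_subordinator_le.
have : (x%:E * P A <= (U t)%:E)%E.
  rewrite -(meanE (YL1 (ltW t0))) -[X in P X]setIT -integral_indic//.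
  have mI : measurable_fun setT (fun w => (\1_A w)%:E : \bar R).
    by apply/measurable_EFinP; exact: measurable_indic.
  rewrite -ge0_integralZl ?lee_fin ?(ltW x0)//.
  apply: ae_ge0_le_integral => //.
  - by move=> w _; rewrite -EFinM lee_fin mulr_ge0// ltW.
  - exact: measurable_funeM.
  - by move=> w _; rewrite lee_fin.
  - exact/measurable_EFinP.
  apply: filterS (ae_regular_path Dsub Dlap phi0) => w rw _.
  rewrite -EFinM lee_fin indicE.
  have [|] := boolP (w \in A); last by rewrite mulr0n mulr0.
  by rewrite inE mulr1n mulr1 => Dx; apply: inverse_ge => //; exact: ltW.
rewrite (prob_fine P mA) -EFinM lee_fin => /(le_trans _); apply.
move: half; rewrite (prob_fine P mA) lee_fin => half.
have -> : (8 * phi (1 / t))^-1 = x * 2^-1.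
  by rewrite /x; field; rewrite gt_eqF.
by rewrite ler_pM2l.
Qed.

Lemma inverse_mean_regular :
  exists2 l : R, 0 < l & U t / t `^ al @[t --> +oo] --> l.
Proof.
have [l lP] := renewal_regular Dsub Dlap phi0 al0 C0 phi_asym.
have lo : V 1 t / t `^ al - (t `^ al)^-1 @[t --> +oo] --> l.
  by rewrite -[X in _ --> X]subr0; apply: cvgB => //; exact: powRN_cvg0.
have Ul : U t / t `^ al @[t --> +oo] --> l.
  apply: (squeeze_cvgr _ lo lP); near=> t.
  have t0 : 0 < t by near: t; apply: nbhs_pinfty_gt; exact: num_real.
  have ta : 0 <= (t `^ al)^-1 by rewrite invr_ge0 powR_ge0.
  have /andP[h1 h2] := U_renewal ltr01 (ltW t0).
  move: h1 h2; rewrite mul1r => h1 h2.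
  apply/andP; split; last exact: ler_wpM2r.
  have : V 1 t / t `^ al <= (U t + 1) / t `^ al by exact: ler_wpM2r.
  by rewrite mulrDl mul1r lerBlDr.
exists l => //.
have L : 8 * (C * 1 `^ al) != 0 by rewrite gt_eqF// !mulr_gt0// powR_gt0.
have H : (8 * (phi (1 / t) * t `^ al))^-1 @[t --> +oo] --> (8 * (C * 1 `^ al))^-1.
  by apply: cvgV => //; apply: cvgMr; exact: (phi_asym ltr01).
apply: (@lt_le_trans _ _ (8 * (C * 1 `^ al))^-1).
  by rewrite invr_gt0 !mulr_gt0// powR_gt0.
apply: (ler_cvg_to H Ul); near=> t.
have t0 : 0 < t by near: t; apply: nbhs_pinfty_gt; exact: num_real.
rewrite mulrA invfM; apply: ler_wpM2r; first by rewrite invr_ge0 powR_ge0.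
exact: inverse_mean_ge.
Unshelve. all: by end_near.
Qed.

Let cvg_scaled_down (f : R -> R) (l : R) : f t / t `^ al @[t --> +oo] --> l ->
  f t / t `^ (al *+ 2) @[t --> +oo] --> (0 : R).
Proof.
move=> fl.
have H : f t / t `^ al * (t `^ al)^-1 @[t --> +oo] --> (0 : R).
  by rewrite -[X in _ --> X](mulr0 l); apply: cvgM => //; exact: powRN_cvg0.
apply: cvg_trans H; apply: near_eq_cvg; near=> t.
have t0 : 0 < t by near: t; apply: nbhs_pinfty_gt; exact: num_real.
rewrite mulr2n powRD; last by rewrite (gt_eqF t0) implybT.
by rewrite -mulrA -invfM.
Unshelve. all: by end_near.
Qed.

Lemma inverse_sqr_regular :
  exists l : R, Q t t / t `^ (al *+ 2) @[t --> +oo] --> l.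
Proof.
have [l lP] := pair_renewal_regular Dsub Dlap phi0 al0 C0 phi_asym.
have [l1 _ l1P] := inverse_mean_regular.
have U2 := cvg_scaled_down l1P.
have one2 : (t `^ (al *+ 2))^-1 @[t --> +oo] --> (0 : R).
  by apply: powRN_cvg0; rewrite mulrn_wgt0.
have hi : 2 * (W 1 t t / t `^ (al *+ 2)) + U t / t `^ (al *+ 2)
    @[t --> +oo] --> 2 * l.
  by rewrite -[X in _ --> X]addr0; apply: cvgD => //; exact: cvgMr.
have lo : 2 * (W 1 t t / t `^ (al *+ 2)) -
    (5 * (U t / t `^ (al *+ 2)) + 2 * (t `^ (al *+ 2))^-1) @[t --> +oo] --> 2 * l.
  rewrite -[X in _ --> X]subr0; apply: cvgB; first exact: cvgMr.
  rewrite [X in _ --> X](_ : _ = 5 * 0 + 2 * 0); last by rewrite !mulr0 addr0.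
  by apply: cvgD; apply: cvgMr.
exists (2 * l); apply: (squeeze_cvgr _ lo hi); near=> t.
have t0 : 0 < t by near: t; apply: nbhs_pinfty_gt; exact: num_real.
have ta : 0 <= (t `^ (al *+ 2))^-1 by rewrite invr_ge0 powR_ge0.
have := W_upper ltr01 (ltW t0) (lexx t).
have := W_lower ltr01 (ltW t0) (lexx t).
rewrite expr1n mul1r => h1 h2.
set z := (t `^ _)^-1 in ta *.
have -> : 2 * (W 1 t t * z) - (5 * (U t * z) + 2 * z) = (2 * W 1 t t - 5 * U t - 2) * z.
  by ring.
have -> : 2 * (W 1 t t * z) + U t * z = (2 * W 1 t t + U t) * z by ring.
by apply/andP; split; apply: ler_wpM2r => //; lra.
Unshelve. all: by end_near.
Qed.

(** If D has passed t at time U t / 2, then Y t deviates from its mean by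
    at least U t / 2; the exponential bound controls the complementary event. *)
Lemma inverse_variance_ge (t r : R) : 0 < t -> 0 <= r ->
  (U t / 2) ^+ 2 * (1 - expR r * expR (- (U t / 2 * phi (r / t)))) <=
  Q t t - U t ^+ 2.
Proof.
move=> t0 r0; set x := U t / 2.
have x0 : 0 <= x by rewrite divr_ge0.
pose A := [set w | D x w <= t].
have mA : measurable A by exact: measurable_subordinator_le.
have PA : fine (P A) <= expR r * expR (- (x * phi (r / t))).
  by rewrite -lee_fin -(prob_fine P mA); exact: subordinator_le_bound.
have YL := YL1 (ltW t0); have YYL := YYL1 (ltW t0) (ltW t0).
have indL : (fun w => \1_A w : R) \in Lfun P 1.
  apply: Lfun1_ge0; [exact: measurable_indic|by []|].
  by rewrite integral_indic// setIT -ge0_fin_numE// fin_num_measure.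
have indm : mean P (fun w => \1_A w : R) = fine (P A).
  by apply: EFin_inj; rewrite -(meanE indL) integral_indic// setIT -prob_fine.
have fE : Q t t - U t ^+ 2 =
    mean P (fun w => Y t w * Y t w - (2 * U t * Y t w - U t ^+ 2)).
  have L1 : (fun w => 2 * U t * Y t w) \in Lfun P 1 by exact: Lfun1Z.
  have L2 := Lfun1B L1 (Lfun1C P (U t ^+ 2)).
  rewrite (meanB YYL L2) (meanB L1 (Lfun1C P _)) meanC (meanZ _ YL) -/(Q t t) -/(U t).
  by ring.
have gE : x ^+ 2 * (1 - fine (P A)) = mean P (fun w => x ^+ 2 - x ^+ 2 * \1_A w).
  rewrite (meanB (Lfun1C P _) (Lfun1Z _ indL)) meanC (meanZ _ indL) indm.
  by ring.
apply: (@le_trans _ _ (x ^+ 2 * (1 - fine (P A)))).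
  by rewrite ler_wpM2l ?exprn_ge0// lerD2l lerN2.
rewrite gE fE; apply: mean_le.
- by apply: Lfun1B; [exact: Lfun1C|exact: Lfun1Z].
- by apply: Lfun1B => //; apply: Lfun1B; [exact: Lfun1Z|exact: Lfun1C].
apply: aeW => w /=; rewrite indicE.
have -> : Y t w * Y t w - (2 * U t * Y t w - U t ^+ 2) = (U t - Y t w) ^+ 2 by ring.
have [_|] := boolP (w \in A).
  by rewrite mulr1n mulr1 subrr sqr_ge0.
move=> /negP; rewrite inE /A /= => /negP; rewrite -ltNge => tD.
rewrite mulr0n mulr0 subr0.
have Yx : Y t w <= x by exact: inverse_le.
have U2 : U t = 2 * x by rewrite /x; field.
by rewrite lerXn2r ?nnegrE//; lra.
Qed.

(** The limit of the tauberian theorem could vanish; the lower bound of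
    inverse_variance_ge, for r / t in place of 1 / t, shows that it does not when
    r is small: the exponent r - (l1 / 2) C r^alpha is then negative, as
    alpha < 1. *)
Lemma inverse_variance_regular :
  exists2 l : R, 0 < l & (Q t t - U t ^+ 2) / t `^ (al *+ 2) @[t --> +oo] --> l.
Proof.
have [l2 l2P] := inverse_sqr_regular.
have [l1 l10 l1P] := inverse_mean_regular.
have VP : (Q t t - U t ^+ 2) / t `^ (al *+ 2) @[t --> +oo] --> l2 - l1 * l1.
  have H : Q t t / t `^ (al *+ 2) - U t / t `^ al * (U t / t `^ al) @[t --> +oo]
      --> l2 - l1 * l1 by apply: cvgB => //; exact: cvgM.
  apply: cvg_trans H; apply: near_eq_cvg; near=> t.
  have t0 : 0 < t by near: t; apply: nbhs_pinfty_gt; exact: num_real.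
  rewrite mulrBl mulr2n powRD; last by rewrite (gt_eqF t0) implybT.
  by rewrite expr2 invfM; ring.
exists (l2 - l1 * l1) => //.
pose k := l1 / 2 * C.
have k0 : 0 < k by rewrite mulr_gt0// divr_gt0.
(* r solves r = (k / 2) r^alpha, so that r - k r^alpha = - r < 0. *)
pose r := (k / 2) `^ (1 - al)^-1.
have k20 : 0 < k / 2 by rewrite divr_gt0.
have r0 : 0 < r by rewrite powR_gt0.
have al1' : 0 < 1 - al by rewrite subr_gt0.
have rE : r = k / 2 * r `^ al.
  have -> : k / 2 = r `^ (1 - al).
    by rewrite /r -powRrM mulVf ?gt_eqF// powRr1// ltW.
  by rewrite -powRD ?subrK ?powRr1 ?(ltW r0)// (gt_eqF r0) implybT.
pose c := (l1 / 2) ^+ 2 * (1 - expR r * expR (- (l1 / 2 * (C * r `^ al)))).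
have c0 : 0 < c.
  rewrite mulr_gt0 ?exprn_gt0 ?divr_gt0// subr_gt0 -expRD expR_lt1.
  have ra : 0 < r `^ al by rewrite powR_gt0.
  have : 0 < k * r `^ al by rewrite mulr_gt0.
  rewrite {1}rE (mulrA (l1 / 2)) -/k; lra.
apply: (lt_le_trans c0).
have H : (U t / t `^ al / 2) * (U t / t `^ al / 2) *
   (1 - expR r * expR (- (U t / t `^ al / 2 * (phi (r / t) * t `^ al)))) @[t --> +oo] --> c.
  rewrite /c expr2.
  have U2 : U t / t `^ al / 2 @[t --> +oo] --> l1 / 2 by apply: cvgMl.
  apply: cvgM; first exact: cvgM.
  apply: cvgB; first exact: cvg_cst.
  apply: cvgMr; apply: (@cvg_comp _ _ _ _ expR _ _ _ _ (@continuous_expR R _)).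
  by apply: cvgN; apply: cvgM => //; exact: phi_asym.
apply: (ler_cvg_to H VP); near=> t.
have t0 : 0 < t by near: t; apply: nbhs_pinfty_gt; exact: num_real.
have ta : 0 < t `^ al by rewrite powR_gt0.
have := inverse_variance_ge t0 (ltW r0).
move=> h; apply: (@le_trans _ _ ((U t / 2) ^+ 2 *
   (1 - expR r * expR (- (U t / 2 * phi (r / t)))) / t `^ (al *+ 2))); last first.
  by rewrite ler_wpM2r// invr_ge0 powR_ge0.
rewrite le_eqVlt; apply/orP; left; apply/eqP.
have -> : U t / t `^ al / 2 * (phi (r / t) * t `^ al) = U t / 2 * phi (r / t).
  by field; rewrite gt_eqF.
rewrite mulr2n powRD; last by rewrite (gt_eqF t0) implybT.
by rewrite expr2; field; rewrite gt_eqF.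
Unshelve. all: by end_near.
Qed.

End inverse_asymptotics.

(** * Moments of the Poisson process *)

Section laws.
Context d (T : measurableType d) (R : realType) (P : probability T R).
Implicit Types f g : T -> R.

(** Nonnegative quadratic forms serve as test functions throughout: they need no
    integrability for decoupling, and all first and second moments follow from
    them by polarization. *)
Lemma quadratic_mean f g (q a b : R) : f \in Lfun P 2%:E -> g \in Lfun P 2%:E ->
  (\int[P]_w ((q - a * f w - b * g w) ^+ 2)%:E =
   (q ^+ 2 - 2 * q * (a * mean P f + b * mean P g) +
    (a ^+ 2 * mean P (fun w => f w * f w) + b ^+ 2 * mean P (fun w => g w * g w) +
     2 * a * b * mean P (fun w => f w * g w)))%:E)%E.
Proof.
move=> fL gL; have [f1 g1] := (Lfun2_Lfun1 fL, Lfun2_Lfun1 gL).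
have ff := Lfun2M fL fL; have gg := Lfun2M gL gL; have fg := Lfun2M fL gL.
have E : (fun w => (q - a * f w - b * g w) ^+ 2) =
   fun w => (q ^+ 2 - (2 * q * a * f w + 2 * q * b * g w)) +
     ((a ^+ 2 * (f w * f w) + b ^+ 2 * (g w * g w)) + 2 * a * b * (f w * g w)).
  by apply/funext => w; ring.
have A1 := Lfun1D (Lfun1Z (2 * q * a) f1) (Lfun1Z (2 * q * b) g1).
have A2 := Lfun1B (Lfun1C P (q ^+ 2)) A1.
have A3 := Lfun1D (Lfun1Z (a ^+ 2) ff) (Lfun1Z (b ^+ 2) gg).
have A4 := Lfun1D A3 (Lfun1Z (2 * a * b) fg).
have A5 := Lfun1D A2 A4.
have L : (fun w => (q - a * f w - b * g w) ^+ 2) \in Lfun P 1 by rewrite E.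
rewrite (meanE L) E; congr EFin.
rewrite (meanD A2 A4) (meanB (Lfun1C P _) A1) meanC (meanD (Lfun1Z _ f1) (Lfun1Z _ g1)).
rewrite (meanD A3 (Lfun1Z _ fg)) (meanD (Lfun1Z _ ff) (Lfun1Z _ gg)) !meanZ//.
by ring.
Qed.

Lemma same_law_integral (X Z : T -> R) (h : R -> \bar R) :
  measurable_fun setT X -> measurable_fun setT Z -> same_law P X Z ->
  measurable_fun setT h -> (forall x, 0 <= h x)%E ->
  (\int[P]_w h (X w) = \int[P]_w h (Z w))%E.
Proof.
move=> mX mZ XZ mh h0.
pose X' : {mfun T >-> R} := mfun_Sub (mem_set mX).
pose Z' : {mfun T >-> R} := mfun_Sub (mem_set mZ).
transitivity (\int[distribution P X']_x h x)%E.
  by rewrite ge0_integral_distribution.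
transitivity (\int[distribution P Z']_x h x)%E.
  by apply: eq_measure_integral => A mA _; exact: XZ.
by rewrite ge0_integral_distribution.
Qed.

(** Equality of E[(c + X)^2] and E[(c + Z)^2] for c = 0 and c = 1. *)
Lemma same_law_moments (X Z : T -> R) : measurable_fun setT X ->
  Z \in Lfun P 2%:E -> same_law P X Z ->
  [/\ X \in Lfun P 2%:E, mean P X = mean P Z &
      mean P (fun w => X w * X w) = mean P (fun w => Z w * Z w)].
Proof.
move=> mX ZL XZ; have mZ := Lfun_measurable_fun ZL.
have I (c : R) : (\int[P]_w ((c - (- 1) * X w - 0 * X w) ^+ 2)%:E =
    \int[P]_w ((c - (- 1) * Z w - 0 * Z w) ^+ 2)%:E)%E.
  apply: (@same_law_integral X Z (fun x => ((c - (- 1) * x - 0 * x) ^+ 2)%:E)) => //.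
    apply/measurable_EFinP; apply: measurable_funX; apply: measurable_funB.
      by apply: measurable_funB => //; exact: measurable_funM.
    exact: measurable_funM.
  by move=> x; rewrite lee_fin sqr_ge0.
have XL : X \in Lfun P 2%:E.
  apply: Lfun2_sqr => //; have := I 0; rewrite (quadratic_mean _ _ _ ZL ZL) => H.
  rewrite (_ : (\int[P]_w _)%E = (\int[P]_w ((0 - (- 1) * X w - 0 * X w) ^+ 2)%:E)%E).
    by rewrite H ltry.
  by apply: eq_integral => w _; congr EFin; ring.
have J c : _ := EFin_inj (etrans (etrans (esym (quadratic_mean c (-1) 0 XL XL)) (I c))
  (quadratic_mean c (-1) 0 ZL ZL)).
have := J 0; have := J 1.
split => //; lra.
Qed.

Lemma nat_integral (M : T -> nat) (f : nat -> R) :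
  measurable_fun setT M -> (forall n, 0 <= f n) ->
  (\int[P]_w (f (M w))%:E = \sum_(n <oo) (f n)%:E * P [set w | M w = n])%E.
Proof.
move=> mM f0.
have mF n : measurable [set w | M w = n].
  by have := mM measurableT [set n] I; rewrite setTI.
have mf : measurable_fun setT (fun w => (f (M w))%:E).
  by apply/measurable_EFinP; apply: (@measurableT_comp _ _ _ _ _ _ f _ M).
have U : \bigcup_n [set w | M w = n] = setT.
  by apply/seteqP; split => // w _; exists (M w).
rewrite -[in LHS]U ge0_integral_bigcup//.
- apply: eq_eseriesr => n _.
  rewrite (eq_integral (fun=> (f n)%:E)).
    by rewrite integral_cst.
  by move=> w; rewrite inE => /= ->.
- by rewrite U.
- by move=> w _; rewrite lee_fin.
- apply/trivIsetP => i j _ _ ij; apply/seteqP; split => // w [].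
  by rewrite /mkset => Mi Mj; move: ij; rewrite -Mi -Mj eqxx.
Qed.

End laws.

Section poisson.
Context d (T : measurableType d) (R : realType) (P : probability T R).
Variables (lambda : R) (N : R -> {RV P >-> nat}).
Hypotheses (l0 : 0 < lambda) (NP : poisson_process lambda N).

Let Nr t w : R := (N t w)%:R.

Lemma measurable_nat_real : forall t, measurable_fun setT (Nr t).
Proof.
move=> t; apply: (@measurableT_comp _ _ _ _ _ _ (fun n : nat => n%:R : R) _ (N t)) => //.
Qed.

(** The moments follow from (n + 1) pmf (n + 1) = r pmf n. *)
Let pmf_sums (r : R) : 0 < r ->
  [/\ (\sum_(n <oo) (poisson_pmf r n)%:E = 1)%E,
      (\sum_(n <oo) (n%:R%:E * (poisson_pmf r n)%:E) = r%:E)%E &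
      (\sum_(n <oo) ((n%:R ^+ 2)%:E * (poisson_pmf r n)%:E) = (r ^+ 2 + r)%:E)%E].
Proof.
move=> r0.
have p0 n : (0 <= (poisson_pmf r n)%:E)%E by rewrite lee_fin poisson_pmf_ge0.
have S1 : (\sum_(n <oo) (poisson_pmf r n)%:E = 1)%E.
  have : poisson_prob r 0 [set: nat] = 1%E by exact: probability_setT.
  by rewrite /poisson_prob r0 -nneseries_esumT.
have step n : (n.+1%:R * poisson_pmf r n.+1 = r * poisson_pmf r n).
  rewrite /poisson_pmf r0 factS natrM invfM exprS.
  have : n.+1%:R != 0 :> R by rewrite pnatr_eq0.
  have : n`!%:R != 0 :> R by rewrite pnatr_eq0 -lt0n fact_gt0.
  move: (n.+1%:R : R) (n`!%:R : R) => x y y0 x0.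
  by field; rewrite x0 y0.
have shift (f : nat -> R) : (forall n, 0 <= f n) -> f 0%N = 0 ->
    (\sum_(n <oo) ((f n)%:E * (poisson_pmf r n)%:E) =
     \sum_(n <oo) ((f n.+1)%:E * (poisson_pmf r n.+1)%:E))%E.
  move=> f0 f00; rewrite nneseries_recl//; last first.
    by move=> k _; rewrite mule_ge0// lee_fin.
  rewrite f00 mul0e add0e -nneseries_addn; last by move=> k; rewrite mule_ge0// lee_fin.
  by apply: eq_eseriesr => n _; rewrite addn1.
have S2 : (\sum_(n <oo) (n%:R%:E * (poisson_pmf r n)%:E) = r%:E)%E.
  rewrite (shift (fun n => n%:R))//.
  under eq_eseriesr do rewrite -EFinM step EFinM.
  by rewrite nneseriesZl// S1 mule1.
split => //.
rewrite (shift (fun n => n%:R ^+ 2)) ?expr0n//.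
have E n : ((n.+1%:R ^+ 2)%:E * (poisson_pmf r n.+1)%:E =
    r%:E * (n%:R%:E * (poisson_pmf r n)%:E + (poisson_pmf r n)%:E) :> \bar R)%E.
  have H : n.+1%:R ^+ 2 * poisson_pmf r n.+1 =
      r * (n%:R * poisson_pmf r n + poisson_pmf r n).
    by rewrite expr2 -mulrA step -natr1; ring.
  exact: (congr1 EFin H).
under eq_eseriesr do rewrite E.
have q0 n : (0 <= n%:R%:E * (poisson_pmf r n)%:E)%E by rewrite mule_ge0// lee_fin.
rewrite nneseriesZl; last by move=> n _; rewrite adde_ge0.
rewrite nneseriesD// S1 S2 -EFinD -EFinM expr2; congr EFin; ring.
Qed.

Let N_zero : {ae P, forall w, N 0 w = 0%N}.
Proof.
have [[H _ _ _] _] := NP; apply: filterS H => w /= /eqP.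
by rewrite pnatr_eq0 => /eqP.
Qed.

Lemma poisson_moments (t : R) : 0 <= t ->
  [/\ Nr t \in Lfun P 2%:E, mean P (Nr t) = lambda * t &
      mean P (fun w => Nr t w * Nr t w) = (lambda * t) ^+ 2 + lambda * t].
Proof.
move=> t0; have mN := measurable_nat_real t.
have I : (\int[P]_w (Nr t w)%:E = (lambda * t)%:E /\
    \int[P]_w (Nr t w ^+ 2)%:E = ((lambda * t) ^+ 2 + lambda * t)%:E)%E.
  move: t0; rewrite le_eqVlt => /predU1P[<-|t0].
    have E (f : nat -> R) : f 0%N = 0 -> (\int[P]_w (f (N 0 w))%:E = 0)%E.
      move=> f0; rewrite (ae_eq_integral (cst 0%E))//.
      - by rewrite integral0.
      - apply/measurable_EFinP.
        exact: (@measurableT_comp _ _ _ _ _ _ f _ (N 0)).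
      - by apply: filterS N_zero => w -> _; rewrite f0.
    rewrite mulr0 expr0n /= addr0; split.
      by rewrite (E (fun n => n%:R)).
    by rewrite (E (fun n => n%:R ^+ 2))// expr0n.
  have lt0 : 0 < lambda * t by rewrite mulr_gt0.
  have [_ S1 S2] := pmf_sums lt0.
  have [_ pmf] := NP.
  have mNt : measurable_fun setT (N t) by exact: measurable_funP.
  split.
    rewrite (@nat_integral _ _ _ _ (N t) (fun n => n%:R))// -S1.
    by apply: eq_eseriesr => n _; rewrite pmf.
  rewrite (@nat_integral _ _ _ _ (N t) (fun n => n%:R ^+ 2))//.
    by rewrite -S2; apply: eq_eseriesr => n _; rewrite pmf.
have [I1 I2] := I.
have NL : Nr t \in Lfun P 2%:E by apply: Lfun2_sqr => //; rewrite I2 ltry.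
split => //.
  by apply: EFin_inj; rewrite -meanE// Lfun2_Lfun1.
by apply: EFin_inj; rewrite -meanE ?Lfun2M// -I2; apply: eq_integral => w _; rewrite expr2.
Qed.

(** The product moment follows by polarization from that of the increment, which
    is distributed as the Poisson variable at time b - a. *)
Lemma poisson_increment (a b : R) : 0 <= a -> a <= b ->
  {ae P, forall w, Nr a w <= Nr b w} /\
  mean P (fun w => Nr a w * Nr b w) = (lambda * a) * (lambda * b) + lambda * a.
Proof.
move=> a0 ab; have b0 : 0 <= b by exact: le_trans ab.
have ba0 : 0 <= b - a by rewrite subr_ge0.
have [[_ _ sta _] _] := NP.
have H := sta a b a0 ab.
have mD : measurable_fun setT (fun w => Nr b w - Nr a w).
  by apply: measurable_funB; exact: measurable_nat_real.
split.
  have m0 : measurable [set w | Nr b w - Nr a w < 0].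
    have := mD measurableT _ (measurable_itv `]-oo, 0[); rewrite setTI.
    by congr measurable; apply/seteqP; split => w /=; rewrite in_itv.
  exists [set w | Nr b w - Nr a w < 0]; split => //.
    transitivity (P ((fun w => Nr (b - a) w) @^-1` `]-oo, 0[)).
      rewrite -(H _ (measurable_itv `]-oo, 0[)); congr (P _).
    rewrite (_ : _ @^-1` _ = set0) ?measure0//.
    by apply/seteqP; split => // w; rewrite /= in_itv /= ltNge ler0n.
  by move=> w /= /negP; rewrite -ltNge subr_lt0.
have [La Ma Sa] := poisson_moments a0.
have [Lb Mb Sb] := poisson_moments b0.
have [Lc Mc Sc] := poisson_moments ba0.
have [LD MD SD] := same_law_moments mD Lc H.
have : mean P (fun w => (Nr b w - Nr a w) * (Nr b w - Nr a w)) =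
    mean P (fun w => Nr b w * Nr b w) + mean P (fun w => Nr a w * Nr a w) -
    2 * mean P (fun w => Nr a w * Nr b w).
  have -> : (fun w => (Nr b w - Nr a w) * (Nr b w - Nr a w)) =
    fun w => (Nr b w * Nr b w + Nr a w * Nr a w) - 2 * (Nr a w * Nr b w).
    by apply/funext => w; ring.
  rewrite (meanB (Lfun1D (Lfun2M Lb Lb) (Lfun2M La La)) (Lfun1Z 2 (Lfun2M La Lb))).
  by rewrite (meanD (Lfun2M Lb Lb) (Lfun2M La La)) (meanZ 2 (Lfun2M La Lb)).
rewrite SD Sa Sb Sc; lra.
Qed.

End poisson.

(** * Second moments of the sums of claims *)

Section claims.
Context d (T : measurableType d) (R : realType) (P : probability T R).
Variables (X : nat -> {RV P >-> R}) (mu : R).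
Hypotheses (indX : mutually_independent P X)
  (lawX : forall i, same_law P (X i) (X 0%N))
  (meanX : ('E_P[X 0%N] = mu%:E)%E) (L2X : (X 0%N : T -> R) \in Lfun P 2%:E).

Definition second_moment : R := mean P (fun w => X 0%N w * X 0%N w).
Let m2 := second_moment.

Let X_moments i : [/\ (X i : T -> R) \in Lfun P 2%:E, mean P (X i) = mu &
  mean P (fun w => X i w * X i w) = m2].
Proof.
have mX : measurable_fun setT (X i) by exact: measurable_funP.
have [L M S] := same_law_moments mX L2X (lawX i).
by split => //; rewrite M /mean meanX.
Qed.

Let X_indep i j (A B : set R) : i != j -> measurable A -> measurable B ->
  P (X i @^-1` A `&` X j @^-1` B) = (P (X i @^-1` A) * P (X j @^-1` B))%E.
Proof.
move=> ij mA mB.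
pose C k : set R := if k == i then A else if k == j then B else setT.
have mC k : measurable (C k) by rewrite /C; case: ifP => // _; case: ifP.
have := indX (maxn i j).+1 mC.
have Ci : C i = A by rewrite /C eqxx.
have Cj : C j = B by rewrite /C eq_sym (negbTE ij) eqxx.
rewrite (_ : \bigcap_(k < _) _ = X i @^-1` A `&` X j @^-1` B); last first.
  apply/seteqP; split => w /= H.
    split; first by have := H i; rewrite /= ltnS leq_maxl Ci; exact.
    by have := H j; rewrite /= ltnS leq_maxr Cj; exact.
  case: H => HA HB k _; rewrite /C /=.
  by case: eqP => [->//|_]; case: eqP => [->//|_].
move=> ->.
have li : (i < (maxn i j).+1)%N by rewrite ltnS leq_maxl.
have lj : (j < (maxn i j).+1)%N by rewrite ltnS leq_maxr.
rewrite (bigD1 (Ordinal li))//= (bigD1 (Ordinal lj)) /=; last first.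
  by rewrite -val_eqE /= eq_sym.
rewrite big1 ?mule1 ?Ci ?Cj// => k /andP[ki kj].
have ki' : (k == i :> nat) = false by exact: negbTE ki.
have kj' : (k == j :> nat) = false by exact: negbTE kj.
by rewrite /C ki' kj' preimage_setT; exact: probability_setT.
Qed.

(** Polarization of the expectation of (X i + X j)^2, decoupled. *)
Let X_pair i j : i != j -> mean P (fun w => X i w * X j w) = mu ^+ 2.
Proof.
move=> ij.
have [Li Mi Si] := X_moments i; have [Lj Mj Sj] := X_moments j.
pose F (z : R * R) : \bar R := ((0 - (-1) * z.1 - (-1) * z.2) ^+ 2)%:E.
have mF : measurable_fun setT F.
  apply/measurable_EFinP; apply: measurable_funX; apply: measurable_funB.
    by apply: measurable_funB => //; exact: measurable_funM.
  exact: measurable_funM.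
have F0 z : (0 <= F z)%E by rewrite lee_fin sqr_ge0.
have mXi : measurable_fun setT (X i) by exact: measurable_funP.
have mXj : measurable_fun setT (X j) by exact: measurable_funP.
have := decoupling_maps mXi mXj (fun A B => X_indep ij (A := A) (B := B)) mF F0.
rewrite /F /= (quadratic_mean 0 (-1) (-1) Li Lj).
have L1 : (fun v => 2 * mu * X j v + m2) \in Lfun P 1.
  by apply: Lfun1D; [apply: Lfun1Z; exact: Lfun2_Lfun1|exact: Lfun1C].
have L2 := Lfun1D (Lfun2M Lj Lj) L1.
rewrite (eq_integral (fun v => (X j v * X j v + (2 * mu * X j v + m2))%:E)); last first.
  move=> v _.
  have E w : (0 - -1 * X i w - -1 * X j v) = (X j v - (-1) * X i w - 0 * X i w) by ring.
  under eq_integral do rewrite E.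
  by rewrite (quadratic_mean _ (-1) 0 Li Li) Mi Si; congr EFin; ring.
rewrite (meanE L2) (meanD (Lfun2M Lj Lj) L1) (meanD (Lfun1Z _ (Lfun2_Lfun1 Lj)) (Lfun1C P _)).
rewrite meanC (meanZ _ (Lfun2_Lfun1 Lj)) Mi Mj Si Sj => -[]; lra.
Qed.

Definition claim_sum (m : nat) (w : T) : R := \sum_(i < m) X i w.
Let S := claim_sum.

Let SS m : S m.+1 = fun w => S m w + X m w.
Proof. by apply/funext => w; rewrite /S /claim_sum big_ord_recr. Qed.

Let S0 : S 0 = cst 0.
Proof. by apply/funext => w; rewrite /S /claim_sum big_ord0. Qed.

Lemma claim_sum_L2 m : S m \in Lfun P 2%:E.
Proof.
elim: m => [|m IH]; first by rewrite S0; exact: Lfun2C.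
by rewrite SS; have [L _ _] := X_moments m; exact: Lfun2D.
Qed.

Let S_mean m : mean P (S m) = mu * m%:R.
Proof.
elim: m => [|m IH]; first by rewrite S0 mulr0; exact: meanC.
have [L M _] := X_moments m.
by rewrite SS (meanD (Lfun2_Lfun1 (claim_sum_L2 m)) (Lfun2_Lfun1 L)) IH M -natr1; ring.
Qed.

Let S_X m k : (m <= k)%N -> mean P (fun w => S m w * X k w) = mu ^+ 2 * m%:R.
Proof.
have [L M _] := X_moments k.
elim: m => [_|m IH mk].
  rewrite S0 mulr0 (_ : (fun w => _) = fun=> 0) ?meanC//.
  by apply/funext => w; rewrite /= mul0r.
have [Lm _ _] := X_moments m.
rewrite SS (_ : (fun w => _) = fun w => S m w * X k w + X m w * X k w); last first.
  by apply/funext => w; rewrite mulrDl.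
rewrite (meanD (Lfun2M (claim_sum_L2 m) L) (Lfun2M Lm L)) IH ?(ltnW mk)// X_pair.
  by rewrite -natr1; ring.
by rewrite neq_ltn mk.
Qed.

Let S_sqr m : mean P (fun w => S m w * S m w) =
  mu ^+ 2 * m%:R ^+ 2 + (m2 - mu ^+ 2) * m%:R.
Proof.
elim: m => [|m IH].
  rewrite S0 (_ : (fun w => _) = fun=> 0); last first.
    by apply/funext => w; rewrite /= mul0r.
  by rewrite meanC; ring.
have [L _ E2] := X_moments m; have LS := claim_sum_L2 m.
have A1 := Lfun1Z 2 (Lfun2M LS L).
have A2 := Lfun1D (Lfun2M LS LS) A1.
rewrite SS (_ : (fun w => _) =
    fun w => S m w * S m w + 2 * (S m w * X m w) + X m w * X m w); last first.
  by apply/funext => w; ring.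
rewrite (meanD A2 (Lfun2M L L)) (meanD (Lfun2M LS LS) A1) (meanZ _ (Lfun2M LS L)).
by rewrite IH S_X// E2 -natr1; ring.
Qed.

Let S_prod m k : mean P (fun w => S m w * S (m + k) w) =
  mu ^+ 2 * m%:R * (m + k)%:R + (m2 - mu ^+ 2) * m%:R.
Proof.
have LS := claim_sum_L2.
elim: k => [|k IH]; first by rewrite addn0 S_sqr; ring.
have [L _ _] := X_moments (m + k).
rewrite addnS SS (_ : (fun w => _) =
    fun w => S m w * S (m + k) w + S m w * X (m + k) w); last first.
  by apply/funext => w; rewrite mulrDr.
rewrite (meanD (Lfun2M (LS m) (LS _)) (Lfun2M (LS m) L)) IH S_X ?leq_addr//.
by rewrite -natr1; ring.
Qed.

Let S_min m n : mean P (fun w => S m w * S n w) =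
  mu ^+ 2 * m%:R * n%:R + (m2 - mu ^+ 2) * Num.min m%:R n%:R.
Proof.
wlog mn : m n / (m <= n)%N => [H|].
  have [/H//|/ltnW nm] := leqP m n.
  rewrite minC mulrAC -(H _ _ nm); congr mean.
  by apply/funext => w; rewrite mulrC.
by rewrite min_l ?ler_nat// -(subnKC mn) S_prod.
Qed.

(** E[(q - a S m - b S n)^2] where S m and S n are sums of x = m and y = n
    claims. *)
Definition claim_quadratic (q a b x y : R) : R :=
  (q - mu * (a * x + b * y)) ^+ 2 +
  (m2 - mu ^+ 2) * (a ^+ 2 * x + b ^+ 2 * y + 2 * a * b * Num.min x y).

Lemma claim_sum_quadratic (q a b : R) (m n : nat) :
  (\int[P]_w ((q - a * S m w - b * S n w) ^+ 2)%:E =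
    (claim_quadratic q a b m%:R n%:R)%:E)%E.
Proof.
rewrite (quadratic_mean _ _ _ (claim_sum_L2 m) (claim_sum_L2 n)).
by rewrite !S_mean !S_sqr S_min /claim_quadratic; congr EFin; ring.
Qed.

(** E[(mu - X 0)^2] >= 0. *)
Lemma second_moment_gt0 : 0 < mu -> 0 < m2.
Proof.
move=> mu0.
have [L M S2] := X_moments 0.
have := quadratic_mean mu 1 0 L L; rewrite M S2 => H.
have : (0 <= \int[P]_w ((mu - 1 * X 0 w - 0 * X 0 w) ^+ 2)%:E)%E.
  by apply: integral_ge0 => w _; rewrite lee_fin sqr_ge0.
rewrite H lee_fin; have : 0 < mu ^+ 2 by rewrite exprn_gt0.
lra.
Qed.

End claims.

(** * Joint measurability of time changes *)

Section random_index.
Context d (U : measurableType d) (R : realType).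

Lemma measurable_nat_fun (g : U -> nat) :
  (forall k, measurable (g @^-1` [set k])) -> measurable_fun setT g.
Proof.
move=> mg _ B _; rewrite setTI.
rewrite (_ : g @^-1` B = \bigcup_(k in B) (g @^-1` [set k])).
  by apply: bigcup_measurable.
apply/seteqP; split => u; first by move=> Bu; exists (g u).
by move=> [k Bk gk]; have guk : g u = k := gk; rewrite /preimage /= guk.
Qed.

(** A countable case distinction on the value of the index. *)
Lemma measurable_nat_index (g : U -> nat) (f : nat -> U -> R) :
  measurable_fun setT g -> (forall k, measurable_fun setT (f k)) ->
  measurable_fun setT (fun u => f (g u) u).
Proof.
move=> mg mf _ B mB; rewrite setTI.
rewrite (_ : _ @^-1` B = \bigcup_k (g @^-1` [set k] `&` f k @^-1` B)).
  apply: bigcup_measurable => k _; apply: measurableI.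
    by rewrite -[X in measurable X]setTI; exact: mg.
  by rewrite -[X in measurable X]setTI; exact: mf.
apply/seteqP; split => u; first by move=> Bu; exists (g u).
by move=> [k _ [gk fB]]; have guk : g u = k := gk; rewrite /preimage /= guk.
Qed.

Lemma measurable_real_nat (g : U -> nat) :
  measurable_fun setT (fun u => (g u)%:R : R) -> measurable_fun setT g.
Proof.
move=> mg; apply: measurable_nat_fun => k.
rewrite (_ : _ @^-1` _ = (fun u => (g u)%:R : R) @^-1` [set k%:R]).
  by rewrite -[X in measurable X]setTI; apply: mg.
apply/seteqP; split => u /=; first by move=> ->.
by move=> /eqP; rewrite eqr_nat => /eqP.
Qed.

End random_index.

(** By right continuity, f at time y is the limit of f at the grid points
    (k + 1) / (n + 1) just above y, and there the time takes countably many
    values. *)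
Lemma measurable_time_change d1 d2 (U1 : measurableType d1)
    (U2 : measurableType d2) (R : realType) (f : R -> U1 -> R) (y : U2 -> R) :
  (forall t, 0 <= t -> measurable_fun setT (f t)) ->
  (forall u t, 0 <= t -> f x u @[x --> t^'+] --> f t u) ->
  measurable_fun setT y -> (forall u, 0 <= y u) ->
  measurable_fun setT (fun z : U1 * U2 => f (y z.2) z.1).
Proof.
move=> mf rcf my y0.
pose g n (z : U1 * U2) := Num.truncn (y z.2 * n.+1%:R).
pose t n k : R := k.+1%:R / n.+1%:R.
have yn0 n (z : U1 * U2) : 0 <= y z.2 * n.+1%:R by rewrite mulr_ge0.
have my2 : measurable_fun setT (fun z : U1 * U2 => y z.2).
  by apply: (measurableT_comp my); exact: measurable_snd.
have mg n : measurable_fun setT (g n).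
  apply: measurable_nat_fun => k.
  have mm : measurable_fun setT (fun z : U1 * U2 => y z.2 * n.+1%:R).
    exact: measurable_funM.
  have := mm measurableT _ (measurable_itv `[k%:R, k.+1%:R[); rewrite setTI.
  congr measurable; apply/seteqP; split => z /=; rewrite in_itv /= /g.
    by rewrite -truncn_eq// => /eqP.
  by move=> <-; exact: truncn_itv.
apply: (@measurable_fun_cvg _ _ _ _ (fun n z => f (t n (g n z)) z.1)).
  move=> n; apply: (measurable_nat_index (f := fun k z => f (t n k) z.1)) => // k.
  apply: measurableT_comp; last exact: measurable_fst.
  by apply: mf; rewrite divr_ge0.
move=> z _.
have H := rcf z.1 _ (y0 z.2).
apply/cvgrPdist_le => e e0.
have /cvgrPdist_le /(_ e e0) [r /= r0 Hr] := H.
near=> n.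
apply: Hr; last first.
  rewrite /t /g ltr_pdivlMr//.
  by have /andP[] := truncn_itv (yn0 n z).
rewrite /ball_ /= /t /g ltr_norml.
have /andP[h1 h2] := truncn_itv (yn0 n z).
set k := (Num.truncn _) in h1 h2 *.
have n0 : (0 : R) < n.+1%:R by [].
have rn : n.+1%:R^-1 < r by near: n; exact: near_infty_natSinv_lt (PosNum r0).
have h3 : y z.2 < k.+1%:R / n.+1%:R by rewrite ltr_pdivlMr.
have h4 : k%:R / n.+1%:R <= y z.2 by rewrite ler_pdivrMr.
have h5 : k.+1%:R / n.+1%:R = k%:R / n.+1%:R + n.+1%:R^-1 :> R.
  by rewrite -[in LHS]natr1 mulrDl mul1r.
rewrite h5 in h3 *.
move: (k%:R / n.+1%:R : R) (n.+1%:R^-1 : R) rn h3 h4 => p q qr h3 h4.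
by apply/andP; split; lra.
Unshelve. all: by end_near.
Qed.

Section generated.
Context d (T : measurableType d) (R : realType).

Lemma measurable_events (I : Type) (J : set I) (X : I -> T -> R) (i : I) : J i ->
  measurable_fun (setT : set (g_sigma_algebraType (events J X))) (X i).
Proof.
move=> Ji _ B mB; rewrite setTI; apply: sub_sigma_algebra.
by exists i => //; exists B => //; rewrite setTI.
Qed.

Lemma measurable_generated_sub d' (U : measurableType d') (G H : set (set T)) (f : T -> U) :
  G `<=` H -> measurable_fun (setT : set (g_sigma_algebraType G)) f ->
  measurable_fun (setT : set (g_sigma_algebraType H)) f.
Proof.
move=> GH mf _ B mB; have := mf measurableT B mB.
by apply: sub_smallest2r; [exact: smallest_sigma_algebra|exact: GH].
Qed.

Lemma events_measurable (I : Type) (J : set I) (X : I -> T -> R) :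
  (forall i, J i -> measurable_fun setT (X i)) -> events J X `<=` measurable.
Proof. by move=> mX _ [i Ji] [B mB <-]; exact: mX. Qed.

Lemma measurable_diagonal d' (V : measurableType d') (G H : set (set T))
    (F : (g_sigma_algebraType G * g_sigma_algebraType H)%type -> V) :
  G `<=` measurable -> H `<=` measurable -> measurable_fun setT F ->
  measurable_fun setT (fun w : T => F (w, w)).
Proof.
move=> mG mH mF.
pose iG (w : T) : g_sigma_algebraType G := w.
pose iH (w : T) : g_sigma_algebraType H := w.
have miG : measurable_fun setT iG.
  by move=> _ A mA; rewrite setTI; exact: generated_measurable mA.
have miH : measurable_fun setT iH.
  by move=> _ A mA; rewrite setTI; exact: generated_measurable mA.
apply: (measurableT_comp mF).
by apply: (@measurable_fun_pair _ _ _ _ _ _ iG iH).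
Qed.

End generated.

(** * Covariance of the risk process *)

Section risk_moments.
Context d (T : measurableType d) (R : realType) (P : probability T R).
Variables (u mu rho lambda : R) (N : R -> {RV P >-> nat}) (Y : R -> T -> R)
  (X : nat -> {RV P >-> R}).
Let M := time_change N Y.
Let times := [set t : R | 0 <= t].
Let Nr (t : R) (w : T) : R := (N t w)%:R.
Let Mr (t : R) (w : T) : R := (M t w)%:R.
Hypotheses (l0 : 0 < lambda) (NP : poisson_process lambda N).
Hypotheses (mY : forall t, measurable_fun setT (Y t)) (Y0 : forall t w, 0 <= Y t w)
  (YL2 : forall t, 0 <= t -> Y t \in Lfun P 2%:E)
  (Ynd : forall s t, 0 <= s -> s <= t -> {ae P, forall w, Y s w <= Y t w}).
Hypothesis indNY : independent_systems P (events times Nr) (events times Y).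
Hypotheses (indX : mutually_independent P X)
  (lawX : forall i, same_law P (X i) (X 0%N))
  (meanX : ('E_P[X 0%N] = mu%:E)%E) (L2X : (X 0%N : T -> R) \in Lfun P 2%:E).
Hypothesis indXYM : independent_systems P (events setT X)
  (events times Y `|` events times Mr).

Let m2 := second_moment X.
Let theta := m2 * lambda.
Let kappa := mu * rho * lambda.
Let Rk := risk_process u mu rho lambda Y M X.
Let Phi := claim_quadratic X mu.

Let GN := events times Nr.
Let GY := events times Y.
Let GX := events setT X.
Let GM := GY `|` events times Mr.

Let mGN : GN `<=` measurable.
Proof. by apply: events_measurable => t _; exact: measurable_nat_real. Qed.

Let mGY : GY `<=` measurable.
Proof. by apply: events_measurable => t _. Qed.

Let mGX : GX `<=` measurable.
Proof. by apply: events_measurable => i _; exact: measurable_funP. Qed.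

Let joint_N (t : R) : 0 <= t -> measurable_fun setT
  (fun z : (g_sigma_algebraType GN * g_sigma_algebraType GY)%type =>
     Nr (Y t z.2) z.1).
Proof.
move=> t0.
apply: (@measurable_time_change _ _ (g_sigma_algebraType GN)
  (g_sigma_algebraType GY) R (fun t (w : T) => Nr t w) (Y t)).
- by move=> x x0; exact: measurable_events.
- move=> w x x0; have [[_ _ _ /(_ w)[H _]] _] := NP; exact: H.
- exact: measurable_events.
- exact: Y0.
Qed.

Let mM (t : R) : 0 <= t -> measurable_fun setT (Mr t).
Proof.
by move=> t0; exact: (measurable_diagonal mGN mGY (joint_N t0)).
Qed.

Let mGM : GM `<=` measurable.
Proof.
rewrite /GM => A [|]; first exact: mGY.
by move: A; apply: events_measurable => t; exact: mM.
Qed.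

Let joint_X (t : R) : 0 <= t -> measurable_fun setT
  (fun z : (g_sigma_algebraType GX * g_sigma_algebraType GM)%type =>
     claim_sum X (M t z.2) z.1).
Proof.
move=> t0.
apply: (@measurable_nat_index _ _ R
  (fun z : (g_sigma_algebraType GX * g_sigma_algebraType GM)%type => M t z.2)
  (fun m z => claim_sum X m z.1)).
  have mMn : measurable_fun (setT : set (g_sigma_algebraType GM)) (M t).
    apply: (@measurable_real_nat _ _ R).
    apply: (@measurable_generated_sub _ _ _ _ (events times Mr)).
      by move=> A HA; right.
    exact: measurable_events.
  by apply: (measurableT_comp mMn); exact: measurable_snd.
move=> m.
have mS : measurable_fun (setT : set (g_sigma_algebraType GX)) (claim_sum X m).
  by apply: measurable_sum => i; exact: measurable_events.
by apply: (measurableT_comp mS); exact: measurable_fst.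
Qed.

Let joint_YX (t : R) : 0 <= t -> measurable_fun setT
  (fun z : (g_sigma_algebraType GX * g_sigma_algebraType GM)%type => Y t z.2).
Proof.
move=> t0.
have mYt : measurable_fun (setT : set (g_sigma_algebraType GM)) (Y t).
  apply: (@measurable_generated_sub _ _ _ _ GY); first by move=> A HA; left.
  exact: measurable_events.
by apply: (measurableT_comp mYt); exact: measurable_snd.
Qed.

Let joint_YN (t : R) : 0 <= t -> measurable_fun setT
  (fun z : (g_sigma_algebraType GN * g_sigma_algebraType GY)%type => Y t z.2).
Proof.
move=> t0.
have mYt : measurable_fun (setT : set (g_sigma_algebraType GY)) (Y t).
  exact: measurable_events.
by apply: (measurableT_comp mYt); exact: measurable_snd.
Qed.

Let risk_measurable (t : R) : 0 <= t -> measurable_fun setT (Rk t).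
Proof.
move=> t0.
have mS := measurable_diagonal mGX mGM (joint_X t0).
apply: measurable_funB => //; apply: measurable_funD => //.
exact: measurable_funM.
Qed.

Let poisson_min (y z : R) : 0 <= y -> 0 <= z ->
  mean P (fun w => Nr y w * Nr z w) = (lambda * y) * (lambda * z) + lambda * Num.min y z /\
  (fun w => Num.min (Nr y w) (Nr z w)) \in Lfun P 1 /\
  mean P (fun w => Num.min (Nr y w) (Nr z w)) = lambda * Num.min y z.
Proof.
wlog yz : y z / y <= z => [H|] y0 z0.
  case/orP: (le_total y z) => [yz|zy]; first exact: (H y z yz y0 z0).
  have [h1 [h2 h3]] := H z y zy z0 y0.
  have -> : (fun w => Nr y w * Nr z w) = (fun w => Nr z w * Nr y w).
    by apply/funext => w; rewrite mulrC.
  have -> : (fun w => Num.min (Nr y w) (Nr z w)) =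
      (fun w => Num.min (Nr z w) (Nr y w)).
    by apply/funext => w; rewrite minC.
  rewrite (minC y z) h1 h3; split; last by split.
  by ring.
have [ae h] := poisson_increment l0 NP y0 yz.
have [Ly My _] := poisson_moments l0 NP y0.
have [Lz _ _] := poisson_moments l0 NP z0.
rewrite (min_l yz); split => //.
have mmin : measurable_fun setT (fun w => Num.min (Nr y w) (Nr z w)).
  by apply: measurable_minr; exact: measurable_nat_real.
have I : (\int[P]_w (Num.min (Nr y w) (Nr z w))%:E = (lambda * y)%:E)%E.
  rewrite -My -(meanE (Lfun2_Lfun1 Ly)); apply: ae_eq_integral => //.
  - exact/measurable_EFinP.
  - by apply/measurable_EFinP; exact: measurable_nat_real.
  - by apply: filterS ae => w h' _; rewrite min_l.
have L : (fun w => Num.min (Nr y w) (Nr z w)) \in Lfun P 1.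
  apply: Lfun1_ge0 => //; last by rewrite I ltry.
  by move=> w; rewrite le_min !ler0n.
by split => //; apply: EFin_inj; rewrite -(meanE L).
Qed.

(** Averaging the claims leaves a function of the numbers of claims by times y
    and z, which is averaged over N: E[X^2] appears as the sum of the variance of
    the claims and of mu^2, the contribution of the Poisson fluctuations. *)
Let poisson_Phi (q a b y z : R) : 0 <= y -> 0 <= z ->
  (\int[P]_w (Phi q a b (Nr y w) (Nr z w))%:E =
   ((q - mu * lambda * (a * y + b * z)) ^+ 2 +
    theta * (a ^+ 2 * y + b ^+ 2 * z + 2 * a * b * Num.min y z))%:E)%E.
Proof.
move=> y0 z0.
have [Ly My Sy] := poisson_moments l0 NP y0.
have [Lz Mz Sz] := poisson_moments l0 NP z0.
have [H1 [L H2]] := poisson_min y0 z0.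
pose f w := (q - mu * a * Nr y w - mu * b * Nr z w) ^+ 2.
pose c := m2 - mu ^+ 2.
pose g w := (c * a ^+ 2 * Nr y w + c * b ^+ 2 * Nr z w) +
  c * (2 * a * b) * Num.min (Nr y w) (Nr z w).
have fI := quadratic_mean q (mu * a) (mu * b) Ly Lz.
have fL : f \in Lfun P 1.
  apply: Lfun1_ge0.
  - apply: measurable_funX; apply: measurable_funB.
      apply: measurable_funB => //; apply: measurable_funM => //.
      exact: measurable_nat_real.
    by apply: measurable_funM => //; exact: measurable_nat_real.
  - by move=> w; exact: sqr_ge0.
  - by rewrite fI ltry.
have A1 := Lfun1D (Lfun1Z (c * a ^+ 2) (Lfun2_Lfun1 Ly)) (Lfun1Z (c * b ^+ 2) (Lfun2_Lfun1 Lz)).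
have A2 := Lfun1Z (c * (2 * a * b)) L.
have gL : g \in Lfun P 1 by exact: Lfun1D A1 A2.
have gm : mean P g = (c * a ^+ 2 * (lambda * y) + c * b ^+ 2 * (lambda * z)) +
    c * (2 * a * b) * (lambda * Num.min y z).
  rewrite /g (meanD A1 A2) (meanD (Lfun1Z _ (Lfun2_Lfun1 Ly)) (Lfun1Z _ (Lfun2_Lfun1 Lz))).
  by rewrite (meanZ _ (Lfun2_Lfun1 Ly)) (meanZ _ (Lfun2_Lfun1 Lz)) (meanZ _ L) My Mz H2.
have E : (fun w => Phi q a b (Nr y w) (Nr z w)) = fun w => f w + g w.
  by apply/funext => w; rewrite /Phi /claim_quadratic /f /g /c -/m2; ring.
have FL : (fun w => Phi q a b (Nr y w) (Nr z w)) \in Lfun P 1 by rewrite E; exact: Lfun1D.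
rewrite (meanE FL) E (meanD fL gL) gm; congr EFin.
have -> : mean P f = fine (\int[P]_w (f w)%:E)%E by rewrite (meanE fL).
rewrite fI /= My Mz Sy Sz H1 /theta /c; ring.
Qed.

(** Decouple first the claims from (Y, M), then N from Y.  The premium rate
    exceeds the mean claim rate by kappa, whence the term in kappa. *)
Let risk_quadratic (k a b s t : R) : 0 <= s -> 0 <= t ->
  (\int[P]_w ((k + a * Rk s w + b * Rk t w) ^+ 2)%:E =
   \int[P]_w ((k + (a + b) * u + kappa * (a * Y s w + b * Y t w)) ^+ 2 +
     theta * (a ^+ 2 * Y s w + b ^+ 2 * Y t w +
       2 * a * b * Num.min (Y s w) (Y t w)))%:E)%E.
Proof.
move=> s0 t0.
pose q v := k + (a + b) * u + mu * (1 + rho) * lambda * (a * Y s v + b * Y t v).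
pose F (z : (g_sigma_algebraType GX * g_sigma_algebraType GM)%type) : \bar R :=
  ((q z.2 - a * claim_sum X (M s z.2) z.1 - b * claim_sum X (M t z.2) z.1) ^+ 2)%:E.
have mF : measurable_fun setT F.
  apply/measurable_EFinP; apply: measurable_funX; apply: measurable_funB.
    apply: measurable_funB; last by apply: measurable_funM => //; exact: joint_X.
    apply: measurable_funD => //; apply: measurable_funM => //.
    apply: measurable_funD; apply: measurable_funM => //; exact: joint_YX.
  by apply: measurable_funM => //; exact: joint_X.
have F0 z : (0 <= F z)%E by rewrite lee_fin sqr_ge0.
pose F' (z : (g_sigma_algebraType GN * g_sigma_algebraType GY)%type) : \bar R :=
  (Phi (q z.2) a b (Nr (Y s z.2) z.1) (Nr (Y t z.2) z.1))%:E.
have mF' : measurable_fun setT F'.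
  apply/measurable_EFinP; apply: measurable_funD.
    apply: measurable_funX; apply: measurable_funB.
      apply: measurable_funD => //; apply: measurable_funM => //.
      by apply: measurable_funD; apply: measurable_funM => //; exact: joint_YN.
    apply: measurable_funM => //.
    by apply: measurable_funD; apply: measurable_funM => //; exact: joint_N.
  apply: measurable_funM => //; apply: measurable_funD.
    by apply: measurable_funD; apply: measurable_funM => //; exact: joint_N.
  by apply: measurable_funM => //; apply: measurable_minr; exact: joint_N.
have F'0 z : (0 <= F' z)%E.
  rewrite /F' /Phi -(claim_sum_quadratic indX lawX meanX L2X).
  by apply: integral_ge0 => w _; rewrite lee_fin sqr_ge0.
transitivity (\int[P]_w F (w, w))%E.
  apply: eq_integral => w _; rewrite /F /= /Rk /risk_process /q /claim_sum.
  by congr EFin; congr (_ ^+ 2); ring.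
rewrite (decoupling_systems mGX mGM indXYM mF F0).
transitivity (\int[P]_w F' (w, w))%E.
  by apply: eq_integral => v _; rewrite /F /F' /= (claim_sum_quadratic indX lawX meanX L2X).
rewrite (decoupling_systems mGN mGY indNY mF' F'0).
apply: eq_integral => v _; rewrite /F' /= poisson_Phi//.
by congr EFin; rewrite /q /kappa; congr (_ ^+ 2 + _); ring.
Qed.

Let U t := mean P (Y t).
Let Q s t := mean P (fun w => Y s w * Y t w).

Let risk_quadratic_value (k a b s t : R) : 0 <= s -> s <= t ->
  let q := k + (a + b) * u in
  (\int[P]_w ((k + a * Rk s w + b * Rk t w) ^+ 2)%:E =
   (q ^+ 2 + 2 * q * kappa * (a * U s + b * U t) +
    kappa ^+ 2 * (a ^+ 2 * Q s s + b ^+ 2 * Q t t + 2 * a * b * Q s t) +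
    theta * (a ^+ 2 * U s + b ^+ 2 * U t + 2 * a * b * U s))%:E)%E.
Proof.
move=> s0 st q; have t0 := le_trans s0 st.
have [Ls Lt] := (YL2 s0, YL2 t0).
rewrite risk_quadratic//.
pose f w := (q - (- (kappa * a)) * Y s w - (- (kappa * b)) * Y t w) ^+ 2.
have fI := quadratic_mean q (- (kappa * a)) (- (kappa * b)) Ls Lt.
have fL : f \in Lfun P 1.
  apply: Lfun1_ge0.
  - by apply: measurable_funX; apply: measurable_funB;
      [apply: measurable_funB => //|]; exact: measurable_funM.
  - by move=> w; exact: sqr_ge0.
  - by rewrite fI ltry.
pose g w := theta * a ^+ 2 * Y s w + theta * b ^+ 2 * Y t w + theta * (2 * a * b) * Y s w.
have A1 := Lfun1D (Lfun1Z (theta * a ^+ 2) (Lfun2_Lfun1 Ls)) (Lfun1Z (theta * b ^+ 2) (Lfun2_Lfun1 Lt)).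
have A2 := Lfun1Z (theta * (2 * a * b)) (Lfun2_Lfun1 Ls).
have gL : g \in Lfun P 1 by exact: Lfun1D A1 A2.
rewrite (ae_eq_integral (fun w => (f w + g w)%:E))//.
- rewrite (meanE (Lfun1D fL gL)) (meanD fL gL) /g (meanD A1 A2).
  rewrite (meanD (Lfun1Z _ (Lfun2_Lfun1 Ls)) (Lfun1Z _ (Lfun2_Lfun1 Lt))) (meanZ _ (Lfun2_Lfun1 Lt)) !(meanZ _ (Lfun2_Lfun1 Ls)).
  have -> : mean P f = fine (\int[P]_w (f w)%:E)%E by rewrite (meanE fL).
  by rewrite fI /= /U /Q; congr EFin; ring.
- apply/measurable_EFinP; apply: measurable_funD.
    apply: measurable_funX; apply: measurable_funD => //; apply: measurable_funM => //.
    by apply: measurable_funD; exact: measurable_funM.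
  apply: measurable_funM => //; apply: measurable_funD.
    by apply: measurable_funD; exact: measurable_funM.
  by apply: measurable_funM => //; exact: measurable_minr.
- by apply/measurable_EFinP; have /Lfun_measurable_fun := Lfun1D fL gL.
- apply: filterS (Ynd s0 st) => w st' _.
  by rewrite (min_l st') /f /g /q; congr EFin; ring.
Qed.

Lemma risk_L2 (t : R) : 0 <= t -> Rk t \in Lfun P 2%:E.
Proof.
move=> t0; apply: Lfun2_sqr; first exact: risk_measurable.
rewrite (eq_integral (fun w => ((0 + 1 * Rk t w + 0 * Rk t w) ^+ 2)%:E)).
  by rewrite (risk_quadratic_value 0 1 0 t0 (lexx t)) ltry.
by move=> w _; congr EFin; ring.
Qed.

(** The quadratic forms for five choices of (k, a, b) determine the moments. *)
Lemma risk_covariance (s t : R) : 0 <= s -> s <= t ->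
  fine (covariance P (Rk s) (Rk t)) = kappa ^+ 2 * (Q s t - U s * U t) + theta * U s.
Proof.
move=> s0 st; have t0 := le_trans s0 st.
have [Ls Lt] := (risk_L2 s0, risk_L2 t0).
have H (k a b : R) :
  k ^+ 2 + 2 * k * (a * mean P (Rk s) + b * mean P (Rk t)) +
  (a ^+ 2 * mean P (fun w => Rk s w * Rk s w) + b ^+ 2 * mean P (fun w => Rk t w * Rk t w) +
   2 * a * b * mean P (fun w => Rk s w * Rk t w)) =
  (k + (a + b) * u) ^+ 2 + 2 * (k + (a + b) * u) * kappa * (a * U s + b * U t) +
    kappa ^+ 2 * (a ^+ 2 * Q s s + b ^+ 2 * Q t t + 2 * a * b * Q s t) +
    theta * (a ^+ 2 * U s + b ^+ 2 * U t + 2 * a * b * U s).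
  apply: EFin_inj; rewrite -(risk_quadratic_value k a b s0 st).
  transitivity (\int[P]_w ((k - (- a) * Rk s w - (- b) * Rk t w) ^+ 2)%:E)%E.
    by rewrite (quadratic_mean _ _ _ Ls Lt); congr EFin; ring.
  by apply: eq_integral => w _; congr EFin; ring.
rewrite covariance_mean//.
(* Comparing h1 with h2 and h3 with h4 gives the means; h5 gives the product
   moment. *)
have h1 := H 0 1 0; have h2 := H 1 1 0; have h3 := H 0 0 1; have h4 := H 1 0 1.
have h5 := H 0 1 1.
have -> : mean P (Rk s) = u + kappa * U s by lra.
have -> : mean P (Rk t) = u + kappa * U t by lra.
have -> : mean P (fun w => Rk s w * Rk t w) =
  u ^+ 2 + u * kappa * (U s + U t) + kappa ^+ 2 * Q s t + theta * U s by lra.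
by ring.
Qed.

End risk_moments.

(** * Long-range dependence *)

(** If the covariance has a limit, the correlation decays as the inverse of the
    standard deviation. *)
Lemma regular_ratio (R : realType) (cov var : R -> R) (v c l nu : R) :
  0 < v -> 0 < c -> 0 < l ->
  cov t @[t --> +oo] --> c ->
  var t / t `^ (nu *+ 2) @[t --> +oo] --> l ->
  exists c' : R, cov t / (Num.sqrt v * Num.sqrt (var t)) / (c' * t `^ (- nu))
    @[t --> +oo] --> (1 : R).
Proof.
move=> v0 c0 l0 covc varl.
have sv : 0 < Num.sqrt v by rewrite sqrtr_gt0.
have sl : 0 < Num.sqrt l by rewrite sqrtr_gt0.
exists (c / (Num.sqrt v * Num.sqrt l)).
have H : cov t / c * (Num.sqrt l / Num.sqrt (var t / t `^ (nu *+ 2)))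
    @[t --> +oo] --> (c / c * (Num.sqrt l / Num.sqrt l)).
  apply: cvgM; first exact: cvgMl.
  apply: cvgMr; apply: cvgV; first exact: lt0r_neq0.
  by apply: cvg_comp varl _; exact: sqrt_continuous.
rewrite !divff ?lt0r_neq0// mulr1 in H.
apply: cvg_trans H; apply: near_eq_cvg; near=> t.
have t0 : 0 < t by near: t; apply: nbhs_pinfty_gt; exact: num_real.
have p0 : 0 < t `^ nu by exact: powR_gt0.
have V0 : 0 < var t / t `^ (nu *+ 2).
  by near: t; exact: (cvgr_gt l varl).
have E : t `^ (nu *+ 2) = t `^ nu ^+ 2.
  by rewrite mulr2n powRD ?expr2//; rewrite (gt_eqF t0) implybT.
have v'0 : 0 < var t.
  by move: V0; rewrite pmulr_lgt0 // invr_gt0 powR_gt0.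
rewrite E sqrtrM ?ltW// sqrtrV ?sqr_ge0// sqrtr_sqr gtr0_norm// powRN.
have sV : 0 < Num.sqrt (var t) by rewrite sqrtr_gt0.
by field; rewrite !lt0r_neq0.
Unshelve. all: by end_near.
Qed.

Section risk_lrd.
Context d (T : measurableType d) (R : realType) (P : probability T R).
Variables (D : R -> {RV P >-> R}) (phi : R -> R) (al C : R).
Hypothesis Dsub : subordinator D.
Hypothesis Dlap : forall t s : R, 0 <= t -> 0 <= s ->
  ('E_P[(fun w => expR (- (s * D t w)))] = (expR (- (t * phi s)))%:E)%E.
Hypothesis phi0 : forall s : R, 0 < s -> 0 < phi s.
Hypotheses (al0 : 0 < al) (al1 : al < 1) (C0 : 0 < C).
Hypothesis phi_asym : forall c : R, 0 < c ->
  phi (c / t) * t `^ al @[t --> +oo] --> C * c `^ al.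
Variables (u mu rho lambda : R) (N : R -> {RV P >-> nat}) (X : nat -> {RV P >-> R}).
Let Y := inverse_process D.
Let M := time_change N Y.
Let times := [set t : R | 0 <= t].
Hypotheses (l0 : 0 < lambda) (mu0 : 0 < mu)
  (NP : poisson_process lambda N).
Hypothesis indNY : independent_systems P (events times (fun t w => (N t w)%:R : R))
  (events times Y).
Hypotheses (indX : mutually_independent P X)
  (lawX : forall i, same_law P (X i) (X 0%N))
  (meanX : ('E_P[X 0%N] = mu%:E)%E) (L2X : (X 0%N : T -> R) \in Lfun P 2%:E).
Hypothesis indXYM : independent_systems P (events setT X)
  (events times Y `|` events times (fun t w => (M t w)%:R : R)).

Let Rk := risk_process u mu rho lambda Y M X.
Let kappa := mu * rho * lambda.
Let theta := second_moment X * lambda.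
Let U t := mean P (Y t).
Let Q s t := mean P (fun w => Y s w * Y t w).

Let YL2 (t : R) : 0 <= t -> Y t \in Lfun P 2%:E.
Proof. exact: inverse_L2 Dsub Dlap phi0 t. Qed.

Let Ynd (s t : R) : 0 <= s -> s <= t -> {ae P, forall w, Y s w <= Y t w}.
Proof.
move=> _ st; apply: filterS (ae_regular_path Dsub Dlap phi0) => w rw.
exact: inverse_nd.
Qed.

Let theta0 : 0 < theta.
Proof. by rewrite mulr_gt0// (second_moment_gt0 lawX meanX L2X). Qed.

Let U0 (t : R) : 0 < t -> 0 < U t.
Proof.
move=> t0; apply: lt_le_trans (inverse_mean_ge Dsub Dlap phi0 t0).
by rewrite invr_gt0 mulr_gt0// phi0// divr_gt0.
Qed.

Let RL2 (t : R) : 0 <= t -> Rk t \in Lfun P 2%:E.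
Proof.
exact: (risk_L2 u rho l0 NP (measurable_inverse Dsub) (inverse_ge0 D) YL2 Ynd
  indNY indX lawX meanX L2X indXYM).
Qed.

Let cov (s t : R) : 0 <= s -> s <= t ->
  fine (covariance P (Rk s) (Rk t)) = kappa ^+ 2 * (Q s t - U s * U t) + theta * U s.
Proof.
exact: (risk_covariance u rho l0 NP (measurable_inverse Dsub) (inverse_ge0 D) YL2 Ynd
  indNY indX lawX meanX L2X indXYM).
Qed.

Let var t := kappa ^+ 2 * (Q t t - U t ^+ 2) + theta * U t.

Let varE (t : R) : 0 <= t -> fine 'V_P[Rk t] = var t.
Proof. by move=> t0; rewrite /var expr2 -(cov t0 (lexx t)). Qed.

Let var_gt0 (t : R) : 0 < t -> 0 < var t.
Proof.
move=> t0; apply: ltr_wpDl; last by rewrite mulr_gt0// U0.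
apply: mulr_ge0; first exact: sqr_ge0.
have t0' := ltW t0.
rewrite expr2 -(covariance_mean (YL2 t0') (YL2 t0')).
by rewrite fine_ge0// variance_ge0.
Qed.

(** Var (Y t), of order t^(2 alpha), dominates E[Y t], of order t^alpha, unless
    its coefficient kappa vanishes. *)
Let var_regular : exists nu, [/\ 0 < nu, nu < 1 &
  exists2 l : R, 0 < l & var t / t `^ (nu *+ 2) @[t --> +oo] --> l].
Proof.
have [l1 l10 l1P] := inverse_mean_regular Dsub Dlap phi0 al0 C0 phi_asym.
have [l2 l20 l2P] := inverse_variance_regular Dsub Dlap phi0 al0 al1 C0 phi_asym.
have [k0|k0] := eqVneq kappa 0.
  have h1 := al1.
  (* Without safety loading only the term in E[Y t] remains. *)
  exists (al / 2); split; [exact: divr_gt0|by lra|].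
  exists (theta * l1); first exact: mulr_gt0.
  have H : theta * (U t / t `^ al) @[t --> +oo] --> theta * l1 by exact: cvgMr.
  apply: cvg_trans H; apply: near_eq_cvg; near=> t.
  have -> : al / 2 *+ 2 = al by rewrite mulr2n; lra.
  by rewrite /var k0 expr0n mul0r add0r mulrA.
exists al; split => //; exists (kappa ^+ 2 * l2).
  by rewrite mulr_gt0// exprn_even_gt0.
have H : kappa ^+ 2 * ((Q t t - U t ^+ 2) / t `^ (al *+ 2)) +
    theta * (U t / t `^ al * (t `^ al)^-1) @[t --> +oo] -->
    kappa ^+ 2 * l2 + theta * (l1 * 0).
  apply: cvgD; first exact: cvgMr.
  by apply: cvgMr; apply: cvgM => //; exact: powRN_cvg0.
rewrite !mulr0 addr0 in H.
apply: cvg_trans H; apply: near_eq_cvg; near=> t.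
have t0 : 0 < t by near: t; apply: nbhs_pinfty_gt; exact: num_real.
rewrite /var mulr2n powRD; last by rewrite (gt_eqF t0) implybT.
by rewrite invfM; ring.
Unshelve. all: by end_near.
Qed.

Lemma risk_long_range_dependent : long_range_dependent P Rk.
Proof.
split; first exact: RL2.
have [nu [nu0 nu1 [l l_gt0 lP]]] := var_regular.
exists nu; first by rewrite nu0 nu1.
move=> s s0; have s0' := ltW s0.
pose c := kappa ^+ 2 * (Q s s / 2) + theta * U s.
have c0 : 0 < c.
  apply: ltr_wpDl; last by rewrite mulr_gt0// U0.
  apply: mulr_ge0; first exact: sqr_ge0.
  by rewrite divr_ge0// mean_ge0// => w; rewrite -expr2 sqr_ge0.
have cv : kappa ^+ 2 * (Q s t - U s * U t) + theta * U s @[t --> +oo] --> c.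
  apply: cvgD; last exact: cvg_cst.
  by apply: cvgMr; exact: (inverse_covariance_cvg Dsub Dlap phi0 al1 C0 phi_asym s0).
have [c' H] := regular_ratio (var_gt0 s0) c0 l_gt0 cv lP.
exists c'; apply: cvg_trans H; apply: near_eq_cvg; near=> t.
have st : s <= t by near: t; apply: nbhs_pinfty_ge; exact: num_real.
by rewrite /correlation cov// varE// varE// (le_trans s0' st).
Unshelve. all: by end_near.
Qed.

End risk_lrd.

Lemma powR_scale (R : realType) (a b c t : R) : 0 < c -> 0 < t ->
  (c / t) `^ a * t `^ b = c `^ a * t `^ (b - a).
Proof.
move=> c0 t0.
have t1 : 0 <= t^-1 by rewrite invr_ge0 ltW.
rewrite powRM ?(ltW c0)// -powR_inv1 ?(ltW t0)// -powRrM mulN1r -mulrA -powRD.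
  by rewrite addrC.
by rewrite (gt_eqF t0) implybT.
Qed.

Theorem theorem4p2 (d : measure_display) (T : measurableType d) (R : realType)
    (P : probability T R)
    (a1 a2 C1 C2 u mu rho lambda : R)
    (D : R -> {RV P >-> R}) (N : R -> {RV P >-> nat})
    (X : nat -> {RV P >-> R}) :
  0 < a2 -> a2 < a1 -> a1 < 1 ->
  0 <= C1 -> 0 <= C2 -> C1 + C2 = 1 ->
  0 < u -> 0 <= rho -> 0 < lambda -> 0 < mu ->
  mixed_stable_subordinator a1 a2 C1 C2 D ->
  poisson_process lambda N ->
  let Y := inverse_process D in
  let M := time_change N Y in
  let times := [set t : R | 0 <= t] in
  independent_systems P (events times (fun t w => (N t w)%:R : R))
    (events times Y) ->
  mutually_independent P X ->
  (forall i, same_law P (X i) (X 0%N)) ->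
  ('E_P[X 0%N] = mu%:E)%E ->
  (X 0%N : T -> R) \in Lfun P 2%:E ->
  independent_systems P (events setT X)
    (events times Y `|` events times (fun t w => (M t w)%:R : R)) ->
  long_range_dependent P (risk_process u mu rho lambda Y M X).
Proof.
move=> a20 a21 a11 C10 C20 C12 _ rho0 l0 mu0 [Dsub Dlap] NP Y M times.
move=> indNY indX lawX meanX L2X indXYM.
pose phi (s : R) := C1 * s `^ a1 + C2 * s `^ a2.
have phi0 (s : R) : 0 < s -> 0 < phi s.
  move=> s0; have p1 : 0 < s `^ a1 by exact: powR_gt0.
  have p2 : 0 < s `^ a2 by exact: powR_gt0.
  have [C1p|C1n] := ltP 0 C1.
    by apply: ltr_pwDl; [exact: mulr_gt0|rewrite mulr_ge0// ltW].
  by apply: ltr_wpDl; [rewrite mulr_ge0// ltW|rewrite mulr_gt0//; lra].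
(* a2 governs phi at 0 as soon as it occurs, being the smaller index. *)
have [C2p|C2n] := ltP 0 C2.
  apply: (risk_long_range_dependent (al := a2) (C := C2) Dsub Dlap phi0) => //.
    exact: lt_trans a21 a11.
  move=> c c0.
  have b0 : 0 < a1 - a2 by rewrite subr_gt0.
  have H : C1 * (c `^ a1 * (t `^ (a1 - a2))^-1) + C2 * c `^ a2 @[t --> +oo] -->
      C1 * (c `^ a1 * 0) + C2 * c `^ a2.
    apply: cvgD; last exact: cvg_cst.
    by apply: cvgMr; apply: cvgMr; exact: powRN_cvg0.
  rewrite !mulr0 add0r in H.
  apply: cvg_trans H; apply: near_eq_cvg; near=> t.
  have t0 : 0 < t by near: t; apply: nbhs_pinfty_gt; exact: num_real.
  rewrite /phi mulrDl -!mulrA !powR_scale// subrr powRr0 mulr1.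
  by rewrite -powRN opprB.
have C20' : C2 = 0 by lra.
have C11 : C1 = 1 by lra.
apply: (risk_long_range_dependent (al := a1) (C := 1) Dsub Dlap phi0) => //.
  exact: lt_trans a20 a21.
move=> c c0.
apply: cvg_near_cst; near=> t.
have t0 : 0 < t by near: t; apply: nbhs_pinfty_gt; exact: num_real.
by rewrite /phi C20' C11 mul0r addr0 -mulrA powR_scale// subrr powRr0 mulr1.
Unshelve. all: by end_near.
Qed.
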